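(* Let $V\ge 0$, $V\in L^{3/2}(\mathbb{R}^3)+L^\infty(\mathbb{R}^3)$, $\lim_{|x|\to\infty}V(x)=0$, and assume $$V(x)\ge V_{TF}(x)=\sum_{k=1}^K\frac{\alpha_k}{|x-r_k|}\quad\text{for a.e. }x\in\mathbb{R}^3,$$ for some $K\in\mathbb{N}$, $\{\alpha_k\}_{k=1}^K\subset(0,\infty)$ and $\{r_k\}_{k=1}^K\subset\mathbb{R}^3$. Let $M>0$, let $\{u_n\}_{n\in\mathbb{N}}$ be any minimizing sequence for $I_V(M)$, and let $N$, $\{m^i\}_{i=0}^N$, $\{x_n^i\}$, $\{u^i\}_{i=0}^N$ be concentration data for $\{u_n\}$ (as defined in the context). Then either $M\in\mathcal{M}_V$, or splitting occurs (i.e. $N\ge1$) with $$m^0\ge\mathcal{Z}:=\sum_{k=1}^K\alpha_k.$$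
   Context: Fix constants $c_1,c_2>0$. Functions are real-valued. For a potential $V$ with $V\ge0$, $V\in L^{3/2}(\mathbb{R}^3)+L^\infty(\mathbb{R}^3)$, $\lim_{|x|\to\infty}V(x)=0$ (or $V\equiv0$), and $u\in H^1(\mathbb{R}^3)$, set $$\mathcal{E}_V(u)=\int_{\mathbb{R}^3}\left[|\nabla u|^2+c_1|u|^{10/3}-c_2|u|^{8/3}-V u^2\right]dx+\frac12\int_{\mathbb{R}^3}\int_{\mathbb{R}^3}\frac{u^2(x)u^2(y)}{|x-y|}\,dx\,dy,$$ and for $M>0$, $I_V(M)=\inf\{\mathcal{E}_V(u):u\in H^1(\mathbb{R}^3),\ \|u\|_{L^2}^2=M\}$. $\mathcal{E}_0$, $I_0$ denote these objects for $V\equiv0$. A minimizing sequence for $I_V(M)$ is a sequence $u_n\in H^1(\mathbb{R}^3)$ with $\|u_n\|_{L^2}^2=M$ and $\mathcal{E}_V(u_n)\to I_V(M)$. $\mathcal{M}_V$ is the set of $M>0$ such that $I_V(M)$ has a minimizer $u\in H^1(\mathbb{R}^3)$ with $\int u^2=M$. Concentration data for a minimizing sequence $\{u_n\}$ of $I_V(M)$ with $V\not\equiv0$ (such data always exist): a number $N\in\mathbb{N}\cup\{0\}$, masses $m^0,\dots,m^N>0$, translations $\{x_n^i\}_{n}\subset\mathbb{R}^3$ ($0\le i\le N$) with $x_n^0=0$, and functions $u^0,\dots,u^N\in H^1(\mathbb{R}^3)$ such that, along a subsequence: $u_n-\sum_{i=0}^Nu^i(\cdot-x_n^i)\to0$ in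 $H^1(\mathbb{R}^3)$; $\|u^i\|_{L^2}^2=m^i$; $\mathcal{E}_V(u^0)=I_V(m^0)$ and $\mathcal{E}_0(u^i)=I_0(m^i)$ for $i\ge1$; $\sum_{i=0}^Nm^i=M$; $I_V(m^0)+\sum_{i=1}^NI_0(m^i)=I_V(M)$; $|x_n^i-x_n^j|\to\infty$ for $i\neq j$; and there is a common $\mu\le0$ such that $-\Delta u^0+\frac53c_1u^0|u^0|^{4/3}-\frac43c_2u^0|u^0|^{2/3}-Vu^0+(|u^0|^2\star|\cdot|^{-1})u^0=\mu u^0$ and, for $i\ge1$, $-\Delta u^i+\frac53c_1u^i|u^i|^{4/3}-\frac43c_2u^i|u^i|^{2/3}+(|u^i|^2\star|\cdot|^{-1})u^i=\mu u^i$. Splitting occurs when $N\ge1$. *)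

(* Defs.v *)
From HB Require Import structures.
From mathcomp Require Import all_boot all_order all_algebra.
From mathcomp Require Import all_classical all_reals all_analysis.

Set Implicit Arguments.
Unset Strict Implicit.
Unset Printing Implicit Defensive.
Import Order.TTheory GRing.Theory Num.Theory.
Import numFieldNormedType.Exports.

Local Open Scope classical_set_scope.
Local Open Scope ring_scope.

(* R^3, with the product topology and the product Borel sigma-algebra.
   Every Lebesgue measurable function is a.e. equal to a Borel one, so the
   Borel functions used below represent all classes in the L^p spaces. *)
Notation R3 R := (R * R * R)%type.

Section Space.
Variable R : realType.

Definition leb3 : {measure set (measurableTypeR R * measurableTypeR R
                                * measurableTypeR R) -> \bar R} :=
  ((@lebesgue_measure R \x @lebesgue_measure R) \x @lebesgue_measure R)%E.

(* Euclidean norm; the library norm on a product is the sup norm. *)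
Definition enorm (x : R3 R) : R :=
  Num.sqrt (x.1.1 ^+ 2 + x.1.2 ^+ 2 + x.2 ^+ 2).

Definition basis3 (i : 'I_3) : R3 R :=
  ((i == 0 :> nat)%:R, (i == 1 :> nat)%:R, (i == 2 :> nat)%:R).

Definition L2 (u : R3 R -> R) : Prop := u \in Lfun leb3 2%:E.

(* ||u||_{L^2}^2 *)
Definition mass (u : R3 R -> R) : \bar R := \int[leb3]_x (u x ^+ 2)%:E.

End Space.

Section Sobolev.
Variable R : realType.
Implicit Types u g phi : R3 R -> R.

Definition iter_partial (s : seq 'I_3) phi : R3 R -> R :=
  foldr (fun i f x => 'D_(basis3 R i) f x) phi s.

Definition smooth phi : Prop := forall s : seq 'I_3,
  continuous (iter_partial s phi) /\
  forall i x, derivable (iter_partial s phi) x (basis3 R i).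

(* C_c^oo(R^3) *)
Definition test_function phi : Prop :=
  smooth phi /\ compact (closure [set x | phi x != 0]).

Definition weak_partial (i : 'I_3) u g : Prop :=
  forall phi, test_function phi ->
    \int[@leb3 R]_x (u x * 'D_(basis3 R i) phi x)
    = - \int[@leb3 R]_x (g x * phi x).

Definition H1 u : Prop :=
  L2 u /\ forall i, exists g, L2 g /\ weak_partial i u g.

(* A representative of the i-th weak partial derivative, which is unique up to
   a.e. equality; the default value 0 is only used when u has none in L^2. *)
Definition wpartial (i : 'I_3) u : R3 R -> R :=
  xget (cst 0) [set g | L2 g /\ weak_partial i u g].

Definition gradsq u (x : R3 R) : R := \sum_(i < 3) wpartial i u x ^+ 2.

Definition H1norm u : \bar R :=
  ((mass u + \int[@leb3 R]_x (gradsq u x)%:E) `^ 2^-1)%E.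

End Sobolev.

Section Potentials.
Variable R : realType.

(* L^{3/2}(R^3) + L^oo(R^3) *)
Definition L32_plus_Loo (V : R3 R -> R) : Prop :=
  exists V1 V2 : R3 R -> R,
    [/\ V1 \in Lfun (@leb3 R) (3 / 2)%:E, V2 \in Lfun (@leb3 R) +oo%E
      & forall x, V x = V1 x + V2 x].

(* lim_{|x| -> oo} V(x) = 0; V being a class of functions, the limit is taken
   up to null sets. *)
Definition vanishes_at_infinity (V : R3 R -> R) : Prop :=
  forall e : R, 0 < e -> exists A : R,
    {ae @leb3 R, forall x : R3 R, A < enorm x -> `|V x| <= e}.

(* At x = r k the k-th summand is 0, by the convention 0^-1 = 0. *)
Definition V_TF (K : nat) (alpha : 'I_K -> R) (r : 'I_K -> R3 R)
    (x : R3 R) : R :=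
  \sum_(k < K) alpha k / enorm (x - r k).

End Potentials.

Section Energy.
Variables (R : realType) (c1 c2 : R).
Implicit Types (V u : R3 R -> R) (M : R).

Definition energy V u : \bar R :=
  (\int[@leb3 R]_x
     (gradsq u x + c1 * `|u x| `^ (10 / 3) - c2 * `|u x| `^ (8 / 3)
      - V x * u x ^+ 2)%R%:E
   + (1 / 2)%R%:E *
     \int[@leb3 R]_x \int[@leb3 R]_y
       (u x ^+ 2 * u y ^+ 2 / enorm (x - y))%R%:E)%E.

Definition inf_energy V M : \bar R :=
  ereal_inf [set energy V u | u in [set u | H1 u /\ mass u = M%:E]].

Definition minimizing_sequence V M (u : nat -> R3 R -> R) : Prop :=
  (forall n, H1 (u n) /\ mass (u n) = M%:E) /\
  energy V (u n) @[n --> \oo] --> inf_energy V M.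

Definition minimizer V M u : Prop :=
  [/\ H1 u, mass u = M%:E & energy V u = inf_energy V M].

Definition attained_masses V : set R := [set M | 0 < M /\ exists u, minimizer V M u].

(* |u|^2 \star |.|^{-1} *)
Definition coulomb u (x : R3 R) : R :=
  \int[@leb3 R]_y (u y ^+ 2 / enorm (x - y)).

(* - Delta u + 5/3 c1 u |u|^{4/3} - 4/3 c2 u |u|^{2/3} - V u
   + (|u|^2 \star |.|^{-1}) u = lam u, in the weak sense. *)
Definition euler_lagrange V (lam : R) u : Prop :=
  forall phi, test_function phi ->
    \int[@leb3 R]_x
      (\sum_(i < 3) wpartial i u x * 'D_(basis3 R i) phi x
       + (5 / 3 * c1 * (u x * `|u x| `^ (4 / 3))
          - 4 / 3 * c2 * (u x * `|u x| `^ (2 / 3))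
          - V x * u x + coulomb u x * u x) * phi x)
    = lam * \int[@leb3 R]_x (u x * phi x).

Definition translate (a : R3 R) u : R3 R -> R := fun x => u (x - a).

(* The subsequence is u o sigma; the profiles are indexed by 'I_N.+1, that is
   0 <= i <= N, and x n i is the i-th translation at rank n. *)
Definition concentration_data V M (u : nat -> R3 R -> R) (N : nat)
    (m : 'I_N.+1 -> R) (x : nat -> 'I_N.+1 -> R3 R)
    (w : 'I_N.+1 -> R3 R -> R) : Prop :=
  (forall i, 0 < m i) /\
  (forall n, x n ord0 = 0) /\
  (forall i, H1 (w i)) /\
  (exists sigma : nat -> nat,
    increasing_seq sigma /\
    H1norm (fun y => u (sigma n) y
                     - \sum_(i < N.+1) translate (x (sigma n) i) (w i) y)
      @[n --> \oo] --> 0%E /\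
    (forall i j, i != j ->
       enorm (x (sigma n) i - x (sigma n) j) @[n --> \oo] --> +oo)) /\
  (forall i, mass (w i) = (m i)%:E) /\
  energy V (w ord0) = inf_energy V (m ord0) /\
  (forall i, i != ord0 -> energy (cst 0) (w i) = inf_energy (cst 0) (m i)) /\
  \sum_(i < N.+1) m i = M /\
  (inf_energy V (m ord0)
   + \sum_(i < N.+1 | i != ord0) inf_energy (cst 0%R) (m i)
     = inf_energy V M)%E /\
  (exists2 lam : R, lam <= 0 &
    euler_lagrange V lam (w ord0) /\
    forall i, i != ord0 -> euler_lagrange (cst 0) lam (w i)).

End Energy.

(* Main.v *)
(** If the profile [w = u^0] had mass [a < Z], splitting would not be optimal.
    Glue [w] to a translate of [v = u^1], of mass [b], by
    [z_y = sqrt (w^2 + v(. - y)^2)]. The masses and the [V]-terms add up, the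
    kinetic energies are subadditive because [z_y] is the norm of the vector
    [(w, v(. - y))], the powers 10/3 and 8/3 cost at most a multiple of
    [\int w^2 v(. - y)^2], and the Coulomb term gains
    [\int\int w(x)^2 v(z)^2 / |x - z - y|]. Average over [y] against a tent of
    radius [n] and let [S] be the potential of the tent at its centre: the cost
    of the powers stays bounded, the Coulomb repulsion is at most [a b S]
    because the potential is largest at the centre, whereas the attraction
    exerted by [V_TF] is at least [Z b S (1 - o(1))]. As [S] tends to infinity
    with [n], some [y] satisfies [E_V(z_y) < E_V(w) + E_0(v)]. The other
    profiles are added in the same way at an arbitrarily small cost, for [S] is
    negligible compared to the mass of the tent, and the resulting function of
    mass [M] has energy below [I_V(M)].

    Membership in [H^1] and the size of weak derivatives are read off from the
    difference quotients [u(. + h e_i) - u]. If some [V u^2] with [u] in [H^1]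
    fails to be integrable, then [I_V(M)] is [-oo] and a multiple of [u]
    attains it; otherwise all energies are real numbers. *)

From HB Require Import structures.
Require Import Defs.
From mathcomp Require Import all_boot all_order all_algebra.
From mathcomp Require Import all_classical all_reals all_analysis.
From mathcomp Require Import measurable_realfun ring lra.
Set Implicit Arguments.
Unset Strict Implicit.
Unset Printing Implicit Defensive.
Import Order.TTheory GRing.Theory Num.Theory.
Import numFieldNormedType.Exports.
Local Open Scope classical_set_scope.
Local Open Scope ring_scope.


(** * Translations of Lebesgue measure on R^3 *)

(** The profiles are only known to lie in H^1 and no rate of decay is at hand, so [v] cannot be sent
    far away and the energy expanded in the inverse distance. Averaging avoids this: once the
    integrals are exchanged and [y] is integrated first, only the masses of [w^2] and [v^2] and the
    potential of the tent remain. The square root of a sum of squares needs neither cutoff nor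
    renormalisation, at the price of a chain rule for weak derivatives. Difference quotients
    circumvent it, since the Euclidean norm of the plane contracts increments. A bound on the
    quotients becomes a weak derivative through Riesz representation on the test functions, and the
    lemma of du Bois-Reymond makes its norm independent of the representative. The Sobolev estimate
    obtained is of weak type: the measure of [|u| > 2^k] is at most a multiple of [64^-k]. This puts
    [u] in L^4 and makes overlaps, powers and Coulomb energies finite, but does not decide whether
    [V u^2] is integrable when [V] has an L^{3/2} part; hence the separate treatment of an infinite
    attraction. *)

Section ProductSigmaFinite.
Context (R : realType) d1 d2 (T1 : measurableType d1) (T2 : measurableType d2).
Variables (m1 : {sigma_finite_measure set T1 -> \bar R})
  (m2 : {sigma_finite_measure set T2 -> \bar R}).

Lemma product_measure1_sigma_finite : sigma_finite [set: T1 * T2] (m1 \x m2)%E.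
Proof.
have /sigma_finiteP[F [TF ndF Foo]] := sigma_finiteT m1.
have /sigma_finiteP[G [TG ndG Goo]] := sigma_finiteT m2.
exists (fun n => F n `*` G n).
  rewrite -setXTT TF TG predeqE => -[x y]; split.
    move=> [/= [n _ Fnx] [k _ Gky]]; exists (maxn n k) => //; split.
    - by move: x Fnx; exact/subsetPset/ndF/leq_maxl.
    - by move: y Gky; exact/subsetPset/ndG/leq_maxr.
  by move=> [n _ []/= ? ?]; split; exists n.
move=> k; have [? ?] := Foo k; have [? ?] := Goo k.
split; first exact: measurableX.
by rewrite product_measure1E// lte_mul_pinfty// ge0_fin_numE.
Qed.

(* A copy of [m1 \x m2] on which the sigma-finite structure can be inferred:
   on [product_measure1] itself the probability instance shadows it. *)
Definition sf_product : set (T1 * T2) -> \bar R := (m1 \x m2)%E.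
HB.instance Definition _ :=
  Measure.copy sf_product ((m1 \x m2)%E : measure (T1 * T2)%type R).
HB.instance Definition _ :=
  Measure_isSigmaFinite.Build _ _ _ sf_product product_measure1_sigma_finite.

(** The pushforward under [f] x [g] agrees with the product measure on rectangles, and these
    determine it. *)
Lemma product_measure1_preserving (f : T1 -> T1) (g : T2 -> T2) :
    measurable_fun setT f -> measurable_fun setT g ->
    (forall A, measurable A -> m1 (f @^-1` A) = m1 A) ->
    (forall A, measurable A -> m2 (g @^-1` A) = m2 A) ->
  forall A, measurable A ->
    (m1 \x m2)%E ((fun x => (f x.1, g x.2)) @^-1` A) = (m1 \x m2)%E A.
Proof.
move=> mf mg fm1 gm2 A mA.
have mfg : measurable_fun setT (fun x : T1 * T2 => (f x.1, g x.2)).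
  apply/measurable_fun_pairP; split.
    exact: (measurableT_comp mf measurable_fst).
  exact: (measurableT_comp mg measurable_snd).
apply/esym; apply: (@product_measure_unique _ _ _ _ _ _ _
  (pushforward (m1 \x m2)%E (fun x => (f x.1, g x.2)))) => // B C mB mC; rewrite -(fm1 B)// -(gm2 C)//.
rewrite -product_measure1E//.
- by rewrite -[f @^-1` B]setTI; exact: mf.
- by rewrite -[g @^-1` C]setTI; exact: mg.
Qed.
End ProductSigmaFinite.

Section Translation.
Variable R : realType.
Local Notation T1 := (measurableTypeR R).
Local Notation T2 := (T1 * T1)%type.
Local Notation T3 := (T1 * T1 * T1)%type.

(** [sleb3] is convertible to [leb3]; its type carries the sigma-finiteness that Tonelli's theorem
    asks for. *)
Definition sleb2 : {sigma_finite_measure set T2 -> \bar R} :=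
  sf_product (@lebesgue_measure R) (@lebesgue_measure R).
Definition sleb3 : {sigma_finite_measure set T3 -> \bar R} :=
  sf_product sleb2 (@lebesgue_measure R).

Lemma measurable_addr (a : R) : measurable_fun [set: T1] (fun x : T1 => (x : R) + a : T1).
Proof. exact: (measurable_funD (@measurable_id _ R setT) (measurable_cst a)). Qed.

Lemma lebesgue_measure_translation (a : R) (A : set T1) : measurable A ->
  lebesgue_measure ((fun x : R => x + a) @^-1` A) = lebesgue_measure A.
Proof.
move=> mA.
have ma := measurable_addr a.
pose m' := pushforward (@lebesgue_measure R) (fun x : T1 => (x : R) + a : T1).
apply/esym; apply: (@lebesgue_measure_unique _ m') => // _ [[x y]] _ <-.
have E : (fun z : R => z + a) @^-1` `]x, y]%classic = `]x - a, y - a]%classic.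
  by apply/seteqP; split => z /=; rewrite !in_itv/= ltrBlDr lerBrDr.
transitivity (lebesgue_measure `]x - a, y - a]%classic); last by rewrite -E.
rewrite !lebesgue_measure_itv/= !lte_fin ltrD2r.
by case: ifPn => // _; rewrite -!EFinD; congr EFin; ring.
Qed.

Lemma leb3_translation (a : R3 R) (A : set T3) : measurable A ->
  leb3 R ((fun x : R3 R => x + a) @^-1` A) = leb3 R A.
Proof.
move=> mA.
rewrite -[RHS](@product_measure1_preserving R _ _ T2 T1 sleb2 (@lebesgue_measure R)
  (fun x => (x.1 + a.1.1, x.2 + a.1.2)) (fun x => x + a.2))//.
- apply/measurable_fun_pairP; split.
    exact: (measurableT_comp (measurable_addr a.1.1) measurable_fst).
  exact: (measurableT_comp (measurable_addr a.1.2) measurable_snd).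
- exact: measurable_addr.
- apply: (@product_measure1_preserving R _ _ T1 T1 lebesgue_measure lebesgue_measure
  (fun x => x + a.1.1) (fun x => x + a.1.2)).
  + exact: measurable_addr.
  + exact: measurable_addr.
  + exact: lebesgue_measure_translation.
  + exact: lebesgue_measure_translation.
- exact: lebesgue_measure_translation.
Qed.

Lemma mcoord1 : measurable_fun [set: T3] (fun x : T3 => x.1.1 : R).
Proof. exact: (measurableT_comp measurable_fst measurable_fst). Qed.
Lemma mcoord2 : measurable_fun [set: T3] (fun x : T3 => x.1.2 : R).
Proof. exact: (measurableT_comp measurable_snd measurable_fst). Qed.
Lemma mcoord3 : measurable_fun [set: T3] (fun x : T3 => x.2 : R).
Proof. exact: measurable_snd. Qed.

Lemma measurable_fun3 d (T : measurableType d) (f : T -> T3) :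
  measurable_fun setT (fun x => (f x).1.1 : R) ->
  measurable_fun setT (fun x => (f x).1.2 : R) ->
  measurable_fun setT (fun x => (f x).2 : R) ->
  measurable_fun setT f.
Proof.
move=> f1 f2 f3; apply/measurable_fun_pairP; split => //.
by apply/measurable_fun_pairP; split.
Qed.

Lemma measurable_add3 d (T : measurableType d) (f g : T -> T3) :
  measurable_fun setT f -> measurable_fun setT g ->
  measurable_fun setT (fun x => (f x : R3 R) + g x : T3).
Proof.
move=> mf mg; apply: measurable_fun3 => /=; apply: measurable_funD.
- exact: (measurableT_comp mcoord1 mf).
- exact: (measurableT_comp mcoord1 mg).
- exact: (measurableT_comp mcoord2 mf).
- exact: (measurableT_comp mcoord2 mg).
- exact: (measurableT_comp mcoord3 mf).
- exact: (measurableT_comp mcoord3 mg).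
Qed.

Lemma measurable_opp3 d (T : measurableType d) (f : T -> T3) :
  measurable_fun setT f -> measurable_fun setT (fun x => - (f x : R3 R) : T3).
Proof.
move=> mf; apply: measurable_fun3 => /=; apply: measurable_funN.
- exact: (measurableT_comp mcoord1 mf).
- exact: (measurableT_comp mcoord2 mf).
- exact: (measurableT_comp mcoord3 mf).
Qed.

Lemma measurable_sub3 d (T : measurableType d) (f g : T -> T3) :
  measurable_fun setT f -> measurable_fun setT g ->
  measurable_fun setT (fun x => (f x : R3 R) - g x : T3).
Proof. by move=> mf mg; apply: measurable_add3 => //; exact: measurable_opp3. Qed.

Lemma measurable_shift3 (a : R3 R) :
  measurable_fun [set: T3] (fun x : T3 => (x : R3 R) + a : T3).
Proof. exact: (@measurable_add3 _ T3 id (cst a)). Qed.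

Lemma ge0_integral_shift (a : R3 R) (f : T3 -> \bar R) :
  measurable_fun setT f -> (forall x, 0 <= f x)%E ->
  (\int[leb3 R]_x f ((x : R3 R) + a)%R = \int[leb3 R]_x f x)%E.
Proof.
move=> mf f0; have ms := measurable_shift3 a.
have := @ge0_integral_pushforward _ _ T3 T3 R _ ms (leb3 R) setT f measurableT mf (in1W f0).
rewrite preimage_setT => <-.
apply: eq_measure_integral => // A mA _; exact: leb3_translation.
Qed.

Lemma integral_shift (a : R3 R) (f : T3 -> \bar R) : measurable_fun setT f ->
  (\int[leb3 R]_x f ((x : R3 R) + a)%R = \int[leb3 R]_x f x)%E.
Proof.
move=> mf; rewrite [RHS]integralE [LHS]integralE; congr (_ - _)%E.
  rewrite -(ge0_integral_shift a (measurable_funepos mf) (funepos_ge0 f)).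
  by apply: eq_integral => x _; rewrite !funeposE.
rewrite -(ge0_integral_shift a (measurable_funeneg mf) (funeneg_ge0 f)).
by apply: eq_integral => x _; rewrite !funenegE.
Qed.

Lemma Rintegral_shift (a : R3 R) (f : T3 -> R) : measurable_fun setT f ->
  \int[leb3 R]_x f ((x : R3 R) + a) = \int[leb3 R]_x f x.
Proof.
by move=> mf; rewrite /Rintegral -(integral_shift a (f := EFin \o f))//; exact/measurable_EFinP.
Qed.

Lemma tonelli3 (f : T3 * T3 -> \bar R) : measurable_fun setT f ->
  (forall x, 0 <= f x)%E ->
  (\int[leb3 R]_x \int[leb3 R]_y f (x, y) = \int[leb3 R]_y \int[leb3 R]_x f (x, y))%E.
Proof. exact: (@fubini_tonelli _ _ _ _ R sleb3 sleb3 f). Qed.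

Lemma measurable_integral3 d (T : measurableType d) (f : T * T3 -> \bar R) :
  measurable_fun setT f -> (forall x, 0 <= f x)%E ->
  measurable_fun setT (fun x => \int[leb3 R]_y f (x, y))%E.
Proof. exact: (@measurable_fun_fubini_tonelli_F _ _ _ _ R sleb3 f). Qed.

Lemma measurable_comp_shift d (T : measurableType d) (f : T3 -> T) (a : R3 R) :
  measurable_fun setT f -> measurable_fun [set: T3] (fun x : T3 => f ((x : R3 R) + a)).
Proof. by move=> mf; exact: (measurableT_comp mf (measurable_shift3 a)). Qed.

End Translation.

(** * Square integrable functions *)

Section SquareIntegrable.
Context d (T : measurableType d) (R : realType) (mu : {measure set T -> \bar R}).
Implicit Types u v f g : T -> R.

Lemma Lfun2P u : u \in Lfun mu 2%:E <->
  measurable_fun setT u /\ (\int[mu]_x (u x ^+ 2)%:E < +oo)%E.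
Proof.
split=> [uL2|[mu_ iu]].
  split; first by move: uL2; rewrite inE => /andP[]; rewrite inE.
  have /integrableP[_] := Lfun2_integrable_sqr uL2.
  by under eq_integral do rewrite /= ger0_norm ?sqr_ge0//.
rewrite inE; apply/andP; split; rewrite inE//=.
rewrite /finite_norm unlock /Lnorm; apply: poweR_lty.
rewrite (eq_integral (fun x => (u x ^+ 2)%:E))// => x _.
by rewrite /= powR_mulrn// real_normK ?num_real.
Qed.

Definition ip u v : R := \int[mu]_x (u x * v x).

Lemma ip_integrable u v : u \in Lfun mu 2%:E -> v \in Lfun mu 2%:E ->
  mu.-integrable setT (EFin \o (fun x => u x * v x)).
Proof. by move=> u2 v2; apply/Lfun1_integrable; exact: Lfun2_mul_Lfun1. Qed.

Lemma ipC u v : ip u v = ip v u.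
Proof. by apply: eq_Rintegral => x _; rewrite mulrC. Qed.

Lemma Lfun2D u v : u \in Lfun mu 2%:E -> v \in Lfun mu 2%:E ->
  (fun x => u x + v x) \in Lfun mu 2%:E.
Proof. by move=> u2 v2; apply: (Lfun_addr_closed _ _).2 => //; rewrite lee_fin ler1n. Qed.

Lemma Lfun2Z a u : u \in Lfun mu 2%:E -> (fun x => a * u x) \in Lfun mu 2%:E.
Proof.
move=> /Lfun2P[mu_ iu]; apply/Lfun2P; split.
  exact: measurable_funM.
under eq_integral do rewrite exprMn EFinM.
rewrite ge0_integralZl_EFin ?sqr_ge0//.
- by rewrite lte_mul_pinfty// lee_fin sqr_ge0.
- by move=> x _; rewrite lee_fin sqr_ge0.
- exact/measurable_EFinP/measurable_funX.
Qed.

Lemma Lfun2B u v : u \in Lfun mu 2%:E -> v \in Lfun mu 2%:E ->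
  (fun x => u x - v x) \in Lfun mu 2%:E.
Proof.
move=> u2 v2; have := Lfun2D u2 (Lfun2Z (-1) v2).
by under eq_fun do rewrite mulN1r.
Qed.

Lemma ipDl u v w : u \in Lfun mu 2%:E -> v \in Lfun mu 2%:E ->
  w \in Lfun mu 2%:E -> ip (fun x => u x + v x) w = ip u w + ip v w.
Proof.
move=> u2 v2 w2; rewrite /ip -RintegralD//; try exact: ip_integrable.
by apply: eq_Rintegral => x _; rewrite mulrDl.
Qed.

Lemma ipZl a u w : u \in Lfun mu 2%:E -> w \in Lfun mu 2%:E ->
  ip (fun x => a * u x) w = a * ip u w.
Proof.
move=> u2 w2; rewrite /ip -RintegralZl//; last exact: ip_integrable.
by apply: eq_Rintegral => x _; rewrite mulrA.
Qed.

Lemma ipBl u v w : u \in Lfun mu 2%:E -> v \in Lfun mu 2%:E ->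
  w \in Lfun mu 2%:E -> ip (fun x => u x - v x) w = ip u w - ip v w.
Proof.
move=> u2 v2 w2; rewrite /ip -RintegralB//; try exact: ip_integrable.
by apply: eq_Rintegral => x _; rewrite mulrBl.
Qed.

Lemma ip_ge0 u : 0 <= ip u u.
Proof. by apply: Rintegral_ge0 => x _; rewrite -expr2 sqr_ge0. Qed.

Lemma ip_sqrE u : u \in Lfun mu 2%:E -> (\int[mu]_x (u x ^+ 2)%:E)%E = (ip u u)%:E.
Proof.
move=> u2; rewrite /ip /Rintegral fineK; last first.
  by apply: integrable_fin_num => //; exact: ip_integrable.
by apply: eq_integral => x _; rewrite expr2.
Qed.

(** Evaluate at the vertex [- b / a]. If [a = 0] the polynomial is affine, and a nonzero slope would
    let it take the value -1. *)
Lemma nonneg_quadratic (a b c : R) : 0 <= a ->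
  (forall t, 0 <= t ^+ 2 * a + 2 * t * b + c) -> b ^+ 2 <= a * c.
Proof.
rewrite le_eqVlt => /predU1P[<-|a0] H.
  rewrite mul0r; case: (eqVneq b 0) => [->|b0]; first by rewrite expr0n.
  exfalso; have := H (- (c + 1) / (2 * b)).
  by rewrite mulr0 add0r (_ : _ + c = -1) ?ler0N1//; field.
have := H (- b / a).
rewrite (_ : _ + c = c - b ^+ 2 / a); last by field; lra.
by rewrite subr_ge0 ler_pdivrMr// mulrC.
Qed.

Lemma cauchy_schwarz u v : u \in Lfun mu 2%:E -> v \in Lfun mu 2%:E ->
  ip u v ^+ 2 <= ip u u * ip v v.
Proof.
move=> u2 v2; apply: nonneg_quadratic => [|t]; first exact: ip_ge0.
have tu := Lfun2Z t u2; have w2 := Lfun2D tu v2.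
have := ip_ge0 (fun x => t * u x + v x).
rewrite ipDl// (ipC (fun x => t * u x)) (ipC v) !ipDl// !ipZl// (ipC u (fun x => t * u x)) ipZl//.
by rewrite (ipC v (fun x => t * u x)) ipZl//; lra.
Qed.

Lemma le0_geometric (x c q : R) : 0 <= q < 1 -> (forall n, x <= c * q ^+ n) -> x <= 0.
Proof.
move=> /andP[q0 q1] H.
have cv : (fun n => c * q ^+ n) @ \oo --> c * 0.
  by apply: cvgMr; apply: cvg_expr; rewrite ger0_norm.
rewrite -(mulr0 c); apply: (ler_cvg_to (cvg_cst x) cv).
by near=> n; exact: H.
Unshelve. all: by end_near. Qed.

Lemma sqr_le_norm (a b : R) : `|a| <= b -> a ^+ 2 <= b ^+ 2.
Proof. by move=> ab; rewrite -[a ^+ 2]real_normK ?num_real// lerXn2r ?nnegrE// (le_trans _ ab). Qed.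

Lemma geometric_increments_cvg (a : R^nat) (c : R) :
    (forall n, `|a n.+1 - a n| <= c * (2^-1) ^+ n) ->
  exists2 l, a @ \oo --> l & forall n, `|l - a n| <= 2 * c * (2^-1) ^+ n.
Proof.
move=> inc; have c0 : 0 <= c by have := inc 0; rewrite expr0 mulr1; exact: le_trans.
have bnd n m : `|a (n + m)%N - a n| <= 2 * c * (2^-1) ^+ n - 2 * c * (2^-1) ^+ (n + m).
  elim: m => [|m IH]; first by rewrite addn0 !subrr normr0.
  rewrite addnS (_ : _ - a n = (a (n + m).+1 - a (n + m)%N) + (a (n + m)%N - a n)); last by ring.
  apply: le_trans (ler_normD _ _) _; apply: le_trans (lerD (inc _) IH) _.
  by rewrite exprS le_eqVlt; apply/orP; left; apply/eqP; field.
have g0 n : 0 <= 2 * c * (2^-1) ^+ n by rewrite !mulr_ge0// exprn_ge0.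
have bnd' n m : `|a (n + m)%N - a n| <= 2 * c * (2^-1) ^+ n.
  by apply: le_trans (bnd n m) _; rewrite gerBl.
(* Adding a bound for the tail turns the sequence into a nonincreasing one, whose convergence
   follows from boundedness below. *)
pose b n := a n + 2 * c * (2^-1) ^+ n.
have ndb : nonincreasing_seq b.
  apply/nonincreasing_seqP => n; rewrite /b exprS.
  by have := inc n; rewrite ler_norml => /andP[_]; lra.
have cb : cvgn b.
  apply: nonincreasing_is_cvgn => //; exists (a 0%N - 2 * c) => _ [n _ <-].
  have := bnd' 0%N n; rewrite add0n expr0 mulr1 ler_norml => /andP[+ _].
  by have := g0 n; rewrite /b; lra.
have ga : (fun n => 2 * c * (2^-1) ^+ n) @ \oo --> 0.
  rewrite -(mulr0 (2 * c)); apply: cvgMr; apply: cvg_expr.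
  by rewrite ger0_norm// invf_lt1// ltr1n.
have ca : a @ \oo --> limn b.
  rewrite (_ : a = b \- (fun n => 2 * c * (2^-1) ^+ n)); last first.
    by apply/funext => n; rewrite /b /= addrK.
  by rewrite -(subr0 (limn b)); exact: cvgB.
exists (limn b) => // n.
have cn : (fun m => `|a (n + m)%N - a n|) @ \oo --> `|limn b - a n|.
  apply: cvg_norm; apply: cvgB; last exact: cvg_cst.
  move: ca; rewrite -(cvg_shiftn n a).
  by rewrite (_ : (fun m => a (n + m)%N) = [sequence a (m + n)%N]_m)//; apply/funext => m /=; rewrite addnC.
apply: (ler_cvg_to cn (cvg_cst (2 * c * (2^-1) ^+ n))).
by near=> m; exact: bnd'.
Unshelve. all: by end_near. Qed.

(* Geometric decay of the increments makes the sequence Cauchy at every point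
   where [sum 4^n (f_(n+1) - f_n)^2] is finite, that is almost everywhere. *)
Lemma riesz_fischer (f : (T -> R)^nat) : (forall n, f n \in Lfun mu 2%:E) ->
    (forall n, ip (fun x => f n.+1 x - f n x) (fun x => f n.+1 x - f n x)
       <= (8^-1) ^+ n) ->
  exists2 g, g \in Lfun mu 2%:E &
    forall n, ip (fun x => g x - f n x) (fun x => g x - f n x) <= 8 * (4^-1) ^+ n.
Proof.
move=> fL2 inc.
have mf n : measurable_fun setT (f n) by have /Lfun2P[] := fL2 n.
(* Against increments of size [8^-n] the weight [4^n] leaves integrals [2^-n], of sum 2. Where the
   series is finite, the increments are at most a multiple of [2^-n]. *)
pose s n x : \bar R := (4 ^+ n * (f n.+1 x - f n x) ^+ 2)%:E.
have s0 n x : (0 <= s n x)%E.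
  by rewrite lee_fin; apply: mulr_ge0; [exact: exprn_ge0|exact: sqr_ge0].
have ms n : measurable_fun setT (s n).
  apply/measurable_EFinP/measurable_funM => //.
  by apply/measurable_funX/measurable_funB.
pose S x := (\sum_(n <oo) s n x)%E.
have S0 x : (0 <= S x)%E by apply: nneseries_ge0.
have mS : measurable_fun setT S by apply: ge0_emeasurable_sum.
have iS : (\int[mu]_x S x <= 2%:E)%E.
  rewrite integral_nneseries//.
  apply: lime_le; first by apply: is_cvg_nneseries => n _ _; exact: integral_ge0.
  apply: nearW => n.
  suff : (\sum_(0 <= k < n) \int[mu]_x s k x <= (2 - 2 * (2^-1) ^+ n)%:E)%E.
    by move=> /le_trans; apply; rewrite lee_fin gerBl mulr_ge0// exprn_ge0.
  elim: n => [|n IH]; first by rewrite big_geq// expr0 mulr1 subrr.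
  rewrite big_nat_recr//=.
  have ->: ((2 - 2 * 2^-1 ^+ n.+1)%:E = (2 - 2 * 2^-1 ^+ n)%:E + ((2^-1) ^+ n)%:E :> \bar R)%E.
    by rewrite -EFinD exprS; congr EFin; field.
  apply: leeD => //.
  under eq_integral do rewrite /s EFinM.
  rewrite ge0_integralZl_EFin//; last first.
  - by apply/measurable_EFinP/measurable_funX/measurable_funB.
  - by move=> x _; rewrite lee_fin sqr_ge0.
  rewrite (ip_sqrE (Lfun2B (fL2 n.+1) (fL2 n))) -EFinM lee_fin.
  apply: le_trans (ler_wpM2l _ (inc n)) _; first exact: exprn_ge0.
  by rewrite -exprMn (_ : 4 * 8^-1 = 2^-1 :> R)//; field.
pose A := [set x | (S x < +oo)%E].
have mA : measurable A by rewrite -[A]setTI; exact: emeasurable_fun_infty_o.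
have aeA : {ae mu, forall x, A x}.
  have : mu.-integrable setT S.
    apply/integrableP; split => //.
    under eq_integral do rewrite gee0_abs//.
    by apply: le_lt_trans iS _; rewrite ltry.
  move=> /(integrable_ae measurableT); apply: filterS => x /(_ I).
  by rewrite ge0_fin_numE.
have key x : A x -> exists2 l, f ^~ x @ \oo --> l &
    forall n, (((l - f n x) ^+ 2)%:E <= (4 * (4^-1) ^+ n)%:E * S x)%E.
  move=> Ax; have [r Sr] : exists r, S x = r%:E.
    by exists (fine (S x)); rewrite fineK// ge0_fin_numE.
  have r0 : 0 <= r by rewrite -lee_fin -Sr.
  have inc_x n : `|f n.+1 x - f n x| <= Num.sqrt r * (2^-1) ^+ n.
    have snr : (s n x <= r%:E)%E.
      rewrite -Sr; apply: le_trans (nneseries_lim_ge n.+1 _) => [|k _ _]; last exact: s0.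
      by rewrite big_nat_recr//= leeDr//; exact: sume_ge0.
    rewrite -(@ler_pXn2r _ 2)// ?nnegrE ?mulr_ge0 ?sqrtr_ge0// ?exprn_ge0//.
    rewrite real_normK ?num_real// !exprMn sqr_sqrtr//.
    rewrite -exprM mulnC exprM (_ : 2^-1 ^+ 2 = 4^-1); last by field.
    by rewrite exprVn ler_pdivlMr ?exprn_gt0// mulrC -lee_fin.
  have [l fl lb] := geometric_increments_cvg inc_x.
  exists l => // n; rewrite Sr -EFinM lee_fin.
  apply: le_trans (sqr_le_norm (lb n)) _; rewrite !exprMn sqr_sqrtr//.
  rewrite -exprM mulnC exprM (_ : 2^-1 ^+ 2 = 4^-1); last by field.
  by rewrite le_eqVlt; apply/orP; left; apply/eqP; ring.
(* Cut off outside [A], the sequence converges at every point, so that its limit is measurable. *)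
pose h n x := f n x * \1_A x.
pose g x := limn (h ^~ x).
have hg x : h ^~ x @ \oo --> g x.
  rewrite /g /h; have [Ax|nAx] := pselect (A x).
    have [l fl _] := key x Ax; apply/cvg_ex; exists l.
    by rewrite indicE mem_set//=; under eq_fun do rewrite mulr1.
  rewrite indicE memNset//=; under eq_fun do rewrite mulr0.
  exact: is_cvg_cst.
have mg : measurable_fun setT g.
  apply: (measurable_fun_cvg (h := h)) => [n|x _]; last exact: hg.
  by apply: measurable_funM => //; exact: measurable_indic.
have bnd n : (\int[mu]_x ((g x - f n x) ^+ 2)%:E <= (8 * (4^-1) ^+ n)%:E)%E.
  have -> : (8 * (4^-1) ^+ n)%:E = ((4 * 4^-1 ^+ n)%:E * 2%:E :> \bar R)%E.
    by rewrite -EFinM; congr EFin; ring.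
  apply: (@le_trans _ _ ((4 * 4^-1 ^+ n)%:E * \int[mu]_x S x)%E); last first.
    by rewrite lee_wpmul2l// lee_fin mulr_ge0// exprn_ge0.
  rewrite -ge0_integralZl_EFin//.
  apply: ae_ge0_le_integral => //.
  - by move=> x _; rewrite lee_fin sqr_ge0.
  - by apply/measurable_EFinP/measurable_funX/measurable_funB.
  - by move=> x _; rewrite mule_ge0// lee_fin mulr_ge0// exprn_ge0.
  - exact: measurable_funeM.
  apply: filterS aeA => x Ax _; have [l fl] := key x Ax.
  suff -> : g x = l by [].
  apply: cvg_unique (hg x) _ => //; rewrite /h indicE mem_set//=.
  by under eq_fun do rewrite mulr1.
have gf n : (fun x => g x - f n x) \in Lfun mu 2%:E.
  apply/Lfun2P; split; first exact: measurable_funB.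
  by apply: le_lt_trans (bnd n) _; rewrite ltry.
exists g => [|n].
  have := Lfun2D (gf 0%N) (fL2 0%N).
  by under eq_fun do rewrite subrK.
by have := bnd n; rewrite (ip_sqrE (gf n)) lee_fin.
Qed.

Lemma ip_axpy a u v : u \in Lfun mu 2%:E -> v \in Lfun mu 2%:E ->
  ip (fun x => a * u x + v x) (fun x => a * u x + v x)
  = a ^+ 2 * ip u u + 2 * a * ip u v + ip v v.
Proof.
move=> u2 v2; have tu := Lfun2Z a u2; have w2 := Lfun2D tu v2.
rewrite ipDl// (ipC (fun x => a * u x)) (ipC v) !ipDl// !ipZl//.
by rewrite (ipC u (fun x => a * u x)) (ipC v (fun x => a * u x)) !ipZl//; ring.
Qed.

(* The representing function is the limit of a minimizing sequence of
   [ip phi phi - 2 * l phi]. *)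
Lemma riesz_representation (P : (T -> R) -> Prop) (l : (T -> R) -> R) (C : R) :
    0 <= C -> P (fun=> 0) ->
    (forall phi, P phi -> phi \in Lfun mu 2%:E) ->
    (forall a phi psi, P phi -> P psi -> P (fun x => a * phi x + psi x)) ->
    (forall a phi psi, P phi -> P psi ->
       l (fun x => a * phi x + psi x) = a * l phi + l psi) ->
    (forall phi, P phi -> l phi ^+ 2 <= C * ip phi phi) ->
  exists k, [/\ k \in Lfun mu 2%:E, ip k k <= C & forall phi, P phi -> l phi = ip k phi].
Proof.
move=> C0 P0 PL2 Plin llin lbnd.
pose J phi := ip phi phi - 2 * l phi.
have JC phi : P phi -> - C <= J phi.
  move=> /lbnd; have := ip_ge0 phi; rewrite /J.
  set n := ip phi phi; set t := l phi => n0 tn.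
  rewrite leNgt; apply/negP => h.
  have : 0 < (2 * t - (n + C)) * (2 * t + (n + C)) by apply: mulr_gt0; lra.
  by have := sqr_ge0 (n - C); nra.
pose A := [set J phi | phi in P].
have infA : has_inf A.
  split; first by exists (J (fun=> 0)); exists (fun=> 0).
  by exists (- C) => _ [phi Pphi <-]; exact: JC.
pose D := inf A.
have JD phi : P phi -> D <= J phi by move=> Pphi; apply: ge_inf; [exact: infA.2|exists phi].
pose e n : R := 8^-1 ^+ n / 4.
have /choice[phi phiP] n : exists phi, P phi /\ J phi <= D + e n.
  have en : 0 < e n by rewrite /e divr_gt0// exprn_gt0.
  have [_ [phi Pphi <-] lt] := inf_adherent en infA.
  by exists phi; split => //; exact: ltW.
have Pn n : P (phi n) by have [] := phiP n.
have Jn n : J (phi n) <= D + e n by have [] := phiP n.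
have L2n n : phi n \in Lfun mu 2%:E by exact: PL2.
have Jaxpy a f g : P f -> P g ->
    J (fun x => a * f x + g x) = a ^+ 2 * ip f f + 2 * a * (ip f g - l f) + J g.
  by move=> Pf Pg; rewrite /J ip_axpy ?PL2// llin//; ring.
have inc n : ip (fun x => phi n.+1 x - phi n x) (fun x => phi n.+1 x - phi n x) <= 8^-1 ^+ n.
  pose psi x := -1 * phi n x + phi n.+1 x.
  have Ppsi : P psi by exact: Plin.
  have -> : (fun x => phi n.+1 x - phi n x) = psi by apply/funext => x; rewrite /psi; ring.
  (* The midpoint of [phi n] and [phi n.+1]: by the parallelogram law the squared distance is at
     most [2 * (e n + e n.+1)], hence at most [8^-n]. *)
  have := JD _ (Plin (2^-1) _ _ Ppsi (Pn n)); rewrite Jaxpy// /psi.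
  have := Jn n; have := Jn n.+1.
  rewrite ip_axpy// -{1 2}/psi ipDl ?Lfun2Z// ipZl// llin// /J.
  rewrite (ipC (phi n.+1) (phi n)) /e exprS.
  have : (0 : R) <= 8^-1 ^+ n by exact: exprn_ge0.
  lra.
have [k kL2 kn] := riesz_fischer L2n inc.
(* An approximate Euler equation: moving from [phi n] along [psi] lowers [J] by at most [e n], which
   bounds a discriminant. *)
have Jl n psi : P psi -> (ip (phi n) psi - l psi) ^+ 2 <= e n * ip psi psi.
  move=> Ppsi; rewrite mulrC; apply: nonneg_quadratic => [|t]; first exact: ip_ge0.
  have := JD _ (Plin t _ _ Ppsi (Pn n)); rewrite Jaxpy// (ipC psi).
  by have := Jn n; lra.
have ipk psi : P psi -> l psi = ip k psi.
  move=> Ppsi; have psi2 := PL2 _ Ppsi.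
  apply/eqP; rewrite -subr_eq0 -sqrf_eq0 eq_le sqr_ge0 andbT.
  apply: (@le0_geometric _ (17 * ip psi psi) 4^-1) => [|n].
    by rewrite invr_ge0 ler0n invf_lt1// ltr1n.
  have h1 := Jl n _ Ppsi.
  have := cauchy_schwarz (Lfun2B kL2 (L2n n)) psi2; rewrite ipBl// => h2.
  have h3 : ip (fun x => k x - phi n x) (fun x => k x - phi n x) * ip psi psi
      <= 8 * 4^-1 ^+ n * ip psi psi by rewrite ler_wpM2r ?ip_ge0.
  have h4 : e n * ip psi psi <= 4^-1 ^+ n / 4 * ip psi psi.
    rewrite ler_wpM2r ?ip_ge0// /e ler_wpM2r// lerXn2r ?nnegrE//.
    by rewrite lef_pV2 ?posrE// ler_nat.
  have := sqr_ge0 (ip (phi n) psi - l psi - (ip k psi - ip (phi n) psi)).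
  have : 0 <= 4^-1 ^+ n * ip psi psi by rewrite mulr_ge0 ?ip_ge0// exprn_ge0.
  nra.
exists k; split => //.
(* Once [l] is the pairing with [k], [J (phi n)] equals [|k - phi n|^2 - |k|^2], and it is at least
   [- C]. *)
rewrite -subr_le0; apply: (@le0_geometric _ 8 4^-1) => [|n].
  by rewrite invr_ge0 ler0n invf_lt1// ltr1n.
have := JC _ (Pn n); have := kn n; rewrite /J ipk//.
rewrite ipBl ?Lfun2B// (ipC k) (ipC (phi n) (fun x => k x - phi n x)) !ipBl//.
by rewrite (ipC (phi n) k); lra.
Qed.
End SquareIntegrable.

(** * Smooth bumps *)

Section BumpFunctions.
Variable R : realType.
Implicit Types (f g : R3 R -> R) (t c a : R).

(** For [n = 0] this is the classical smooth function exp(-1/t), extended by 0. The powers of 1/t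
    make the span of the family stable under differentiation. *)
Definition flat (n : nat) t : R := if 0 < t then (t^-1) ^+ n * expR (- t^-1) else 0.

Lemma flat_ge0 n t : 0 <= flat n t.
Proof.
rewrite /flat; case: ifPn => // t0.
by rewrite mulr_ge0 ?expR_ge0// exprn_ge0// invr_ge0 ltW.
Qed.

(** Compare exp(1/t) with the term of order [n + 2] of its series. The quadratic bound is what makes
    the derivative at 0 vanish. *)
Lemma flat_le_sqr n t : flat n t <= n.+2`!%:R * t ^+ 2.
Proof.
rewrite /flat; case: ifPn => [t0|_]; last by rewrite mulr_ge0 ?sqr_ge0.
have s0 : 0 < t^-1 by rewrite invr_gt0.
rewrite expRN ler_pdivrMr ?expR_gt0//.
have := expR_ge1Dxn n.+1 (ltW s0) => h.
have {}h : t^-1 ^+ n.+2 / n.+2`!%:R <= expR t^-1 by apply: le_trans h; rewrite lerDr.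
rewrite ler_pdivrMr ?ltr0n ?fact_gt0// in h.
have -> : t^-1 ^+ n = t ^+ 2 * t^-1 ^+ n.+2.
  by rewrite !exprVn !exprS expr0; field; rewrite expf_neq0 ?gt_eqF.
move: (t ^+ 2) (sqr_ge0 t) h => q q0; move: (t^-1 ^+ n.+2) => z h.
by rewrite -mulrA mulrCA; apply: ler_wpM2l => //; rewrite mulrC.
Qed.

Lemma is_derive_flat n t : is_derive t 1 (flat n) (flat n.+2 t - n%:R * flat n.+1 t).
Proof.
have [t0|t0|->] := ltgtP t 0.
- rewrite {2 3}/flat ltNge (ltW t0)/= mulr0 subr0.
  apply: (@near_eq_is_derive R R R (cst 0) (flat n) t 1 0).
  near=> s; rewrite /flat ltNge ltW//=; near: s.
  exact: lt_nbhsl.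
- apply: (@near_eq_is_derive R R R (fun s : R => (s^-1) ^+ n * expR (- s^-1))).
    near=> s; rewrite /flat ifT//; near: s; exact: lt_nbhsr.
  have t0' : t != 0 by rewrite gt_eqF.
  have dV : is_derive t (1 : R) (fun s : R => s^-1) (- t ^- 2).
    have := @is_deriveV _ id t 1 1 t0' (is_derive_id _ _).
    by rewrite scaler1.
  have dk (s : R) : is_derive s (1 : R) (fun s : R => s ^+ n * expR (- s))
      ((n%:R * s ^+ n.-1) * expR (- s) - s ^+ n * expR (- s)).
    have dX : is_derive s (1 : R) ((id : R -> R) ^+ n) ((n%:R * s ^+ n.-1) *: 1).
      exact: is_deriveX.
    have de : is_derive s (1 : R) (expR \o -%R) (expR (- s) * (- 1)).
      exact: is_derive1_comp.
    have := @is_deriveM _ _ _ _ _ _ _ _ dX de.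
    rewrite (_ : id ^+ n * (expR \o -%R) = (fun s : R => s ^+ n * expR (- s))); last first.
      by rewrite exprfctE mulrfctE.
    move=> /is_derive_eq; apply; rewrite scaler1 exprfctE /=.
    by rewrite /GRing.scale/=; ring.
  have := @is_derive1_comp _ _ (fun s : R => s^-1) t _ _ (dk t^-1) dV.
  move=> /is_derive_eq; apply; rewrite /flat t0.
  rewrite -exprVn; move: (t^-1) (expR _) => z E.
  by case: n {dk} => [|n] /=; rewrite !exprS ?expr0; ring.
- rewrite /flat ltxx mulr0 subr0.
  have cv : (fun h => h^-1 *: ((flat n \o shift 0) (h *: (1 : R)) - flat n 0)) @ 0^' --> (0 : R).
    apply/cvgrPdist_le => e e0; near=> h.
    have h0 : h != 0 by near: h; exact: nbhs_dnbhs_neq.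
    rewrite sub0r normrN /= addr0 [h *: 1]mulr1 {2}/flat ltxx subr0.
    rewrite normrM normfV (ger0_norm (flat_ge0 _ _)) ler_pdivrMl ?normr_gt0//.
    apply: le_trans (flat_le_sqr _ _) _.
    rewrite -[h ^+ 2]real_normK ?num_real// expr2 mulrCA ler_wpM2l//.
    have : `|h| <= e / n.+2`!%:R.
      near: h; apply: dnbhs0_le; by rewrite divr_gt0// ltr0n fact_gt0.
    by rewrite ler_pdivlMr ?ltr0n ?fact_gt0// mulrC.
  by apply: DeriveDef; [exact: cvgP cv|exact: cvg_lim cv].
Unshelve. all: by end_near. Qed.

Definition coord (j : 'I_3) (x : R3 R) : R :=
  if val j == 0 then x.1.1 else if val j == 1 then x.1.2 else x.2.

Lemma coordD j (x y : R3 R) : coord j (x + y) = coord j x + coord j y.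
Proof. by rewrite /coord; case: ifP => // _; case: ifP. Qed.

Lemma coord_diag j (t : R) : coord j (t, t, t) = t.
Proof. by rewrite /coord; case: ifP => //; case: ifP. Qed.

Lemma coord_basis3 i j (h : R) : coord j (h *: basis3 R i) = h * (i == j)%:R.
Proof. by case: i j => [[|[|[|//]]] ?] [[|[|[|//]]] ?]. Qed.

Lemma coord_continuous j : continuous (coord j).
Proof.
case: j => [[|[|[|//]]] jP] x; rewrite /coord /=.
- apply: (continuous_comp (f := fst) (g := fst)); exact: cvg_fst.
- apply: (continuous_comp (f := fst) (g := snd)); [exact: cvg_fst|exact: cvg_snd].
- exact: cvg_snd.
Qed.

Lemma is_derive_line (f : R3 R -> R) x v d :
  is_derive (0 : R) 1 (fun h => f (h *: v + x)) d <-> is_derive x v f d.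
Proof.
have E : (fun h => h^-1 *: ((f \o shift x) (h *: v) - f x)) =
   (fun h => h^-1 *: (((fun h => f (h *: v + x)) \o shift 0) (h *: (1 : R)) -
     f ((0 : R) *: v + x))).
  by apply/funext => h /=; rewrite addr0 scale0r add0r [_%:A]mulr1.
split=> -[df dv].
- by apply: DeriveDef; [rewrite /derivable E|rewrite /derive E].
- by apply: DeriveDef; [rewrite /derivable -E|rewrite /derive -E].
Qed.

(* The class contains the coordinate functions only through [flat], so that all
   its members are infinitely differentiable by construction. *)
Inductive elementary : (R3 R -> R) -> Prop :=
| elementary_cst c : elementary (fun=> c)
| elementary_flat n c a j : elementary (fun x => flat n (c * (coord j x - a)))
| elementaryD f g : elementary f -> elementary g -> elementary (fun x => f x + g x)
| elementaryM f g : elementary f -> elementary g -> elementary (fun x => f x * g x).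

Lemma is_derive_elementary f : elementary f -> forall i,
  exists2 g, elementary g & forall x, is_derive x (basis3 R i) f (g x).
Proof.
move=> ef i; elim: ef => {f} [c|n c a j|f g _ [f' ef' df] _ [g' eg' dg]|
    f g ef [f' ef' df] eg [g' eg' dg]].
- exists (fun=> 0); first exact: elementary_cst.
  by move=> x; exact: is_derive_cst.
- exists (fun x => (c * (i == j)%:R) * (flat n.+2 (c * (coord j x - a)) +
     (- n%:R) * flat n.+1 (c * (coord j x - a)))).
    by repeat (apply: elementaryD || apply: elementaryM || apply: elementary_cst ||
      apply: elementary_flat).
  move=> x; apply/is_derive_line.
  pose l (h : R) : R := c * (i == j)%:R * h + c * (coord j x - a).
  have dl : is_derive (0 : R) (1 : R) l (c * (i == j)%:R).
    have := @is_deriveD _ _ _ _ _ (0 : R) (1 : R) _ _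
      (@is_deriveZ _ _ _ id (c * (i == j)%:R) (0 : R) (1 : R) _ (is_derive_id _ _))
      (is_derive_cst (c * (coord j x - a) : R) (0 : R) (1 : R)).
    by move=> /is_derive_eq; apply; rewrite addr0 [_%:A]mulr1.
  rewrite (_ : (fun h => _) = flat n \o l); last first.
    apply/funext => h; rewrite /= coordD coord_basis3 /l; congr (flat n _); ring.
  move: (is_derive1_comp (is_derive_flat n (l 0)) dl) => /is_derive_eq; apply.
  by rewrite /l mulr0 add0r; ring.
- exists (fun x => f' x + g' x); first exact: elementaryD.
  by move=> x; exact: is_deriveD.
- exists (fun x => f x * g' x + g x * f' x).
    by apply: elementaryD; apply: elementaryM.
  by move=> x; exact: is_deriveM.
Qed.

Lemma flat_continuous n : continuous (flat n).
Proof.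
move=> t; apply: differentiable_continuous; apply/derivable1_diffP.
by have [] := is_derive_flat n t.
Qed.

Lemma elementary_continuous f : elementary f -> continuous f.
Proof.
elim=> {f} [c|n c a j|f g _ cf _ cg|f g _ cf _ cg] x.
- exact: cvg_cst.
- apply: (continuous_comp (f := fun x => c * (coord j x - a)) (g := flat n)); last exact: flat_continuous.
  by apply: cvgM; [exact: cvg_cst|apply: cvgB; [exact: coord_continuous|exact: cvg_cst]].
- by apply: cvgD; [exact: cf|exact: cg].
- by apply: cvgM; [exact: cf|exact: cg].
Qed.

Lemma smooth_elementary f : elementary f -> smooth f.
Proof.
move=> ef.
suff H s : elementary (iter_partial s f).
  move=> s; split; first exact: elementary_continuous.
  by move=> i x; have [g _ dg] := is_derive_elementary (H s) i; have [] := dg x.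
elim: s => [//|i s IH] /=.
have [g eg dg] := is_derive_elementary IH i.
rewrite (_ : (fun x => _) = g)//; apply/funext => x; have [_] := dg x; exact.
Qed.

End BumpFunctions.

(** * The lemma of du Bois-Reymond *)

Section ZeroIntegrals.
Local Open Scope ereal_scope.
Context d (T : measurableType d) (R : realType) (mu : {measure set T -> \bar R}).

(** The sets [S] over whose preimage in [E] the integral vanishes form a Dynkin system, by
    additivity for complements and by integrability for disjoint unions. Localising to [E] allows an
    [f] that is integrable only there. *)
Lemma integral_preimage_eq0 d' (T' : measurableType d') (p : T -> T')
    (G : set (set T')) (E : set T) (f : T -> \bar R) :
    measurable_fun setT p -> measurable E -> mu.-integrable E f ->
    @measurable _ T' = <<s G >> -> setI_closed G ->
    \int[mu]_(x in E) f x = 0 ->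
    (forall S, G S -> \int[mu]_(x in E `&` p @^-1` S) f x = 0) ->
  forall S, measurable S -> \int[mu]_(x in E `&` p @^-1` S) f x = 0.
Proof.
move=> mp mE intf GE GI E0 G0 S mS.
have mpre A : measurable A -> measurable (E `&` p @^-1` A).
  by move=> mA; apply: measurableI => //; rewrite -[X in measurable X]setTI; exact: mp.
have sE A : E `&` p @^-1` A `<=` E by apply: subIsetl.
rewrite GE in mS; move: S mS.
apply: (@dynkin_induction _ T' G) => //.
- by rewrite preimage_setT setIT.
- move=> A mA A0.
  have mnA := measurableC mA.
  have : \int[mu]_(x in (E `&` p @^-1` A) `|` (E `&` p @^-1` (~` A))) f x = 0.
    by rewrite -setIUr preimage_setC setUv setIT.
  rewrite integral_setU ?A0 ?add0e//; try exact: mpre.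
    apply: measurable_funS (measurable_int _ intf) => //.
    by rewrite subUset; split.
  apply/disj_setPS => x [[_ Ax] [_]]; exact.
- move=> F mF tF F0; rewrite preimage_bigcup setI_bigcupr integral_bigcup.
  + by rewrite eseries0.
  + apply/trivIsetP => i j _ _ ij.
    apply/seteqP; split => // x [[_ Fi] [_ Fj]].
    move/trivIsetP : tF => /(_ i j I I ij) /seteqP[+ _] => /(_ (p x)); exact.
  + by move=> k; exact: mpre.
  + apply: integrableS intf => //; last by move=> x [k _] [].
    by apply: bigcup_measurable => k _; exact: mpre.
Qed.

End ZeroIntegrals.

Section DuBoisReymond.
Variable R : realType.
Local Notation T1 := (measurableTypeR R).
Local Notation T2 := (T1 * T1)%type.
Local Notation T3 := (T1 * T1 * T1)%type.
Implicit Types (a b : R3 R).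

(** Half-open boxes are products of the intervals in [ocitv], which are stable under intersection
    and generate the Borel sets of the line. *)
Definition hbox a b : set T3 :=
  (`]a.1.1, b.1.1]%classic `*` `]a.1.2, b.1.2]%classic) `*` `]a.2, b.2]%classic.

Lemma hboxP a b (x : R3 R) : hbox a b x <-> forall j, coord j a < coord j x <= coord j b.
Proof.
split => [[[/= x1 x2] x3]|H].
  by case=> [[|[|[|//]]] ?]; rewrite /coord/=; move: x1 x2 x3; rewrite !in_itv.
split; [split|]; rewrite /= in_itv/=.
- exact: (H (@Ordinal 3 0 isT)).
- exact: (H (@Ordinal 3 1 isT)).
- exact: (H (@Ordinal 3 2 isT)).
Qed.

Lemma measurable_hbox a b : measurable (hbox a b).
Proof. by apply: measurableX; [apply: measurableX|]; exact: measurable_itv. Qed.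

Lemma leb3_setX (A B C : set T1) : measurable A -> measurable B -> measurable C ->
  leb3 R ((A `*` B) `*` C) = (lebesgue_measure A * lebesgue_measure B * lebesgue_measure C)%E.
Proof.
move=> mA mB mC.
have H2 := @product_measure1E _ _ T1 T1 R lebesgue_measure lebesgue_measure _ _ mA mB.
have H3 := @product_measure1E _ _ T2 T1 R (sleb2 R) lebesgue_measure _ _ (measurableX mA mB) mC.
exact: (etrans H3 (congr1 (fun e => e * _)%E H2)).
Qed.

Lemma leb3_hbox_lty a b : (leb3 R (hbox a b) < +oo)%E.
Proof.
rewrite leb3_setX; [|exact: measurable_itv..].
by rewrite !lebesgue_measure_itv/=; do 3 case: ifP => _; rewrite ?mule0 ?mul0e// -!EFinM ltry.
Qed.

(** The factors are positive for [coord j x > coord j a] and for [coord j x < coord j b + 1/(n+1)]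
    respectively. The square in the second slope makes its argument at least [n + 1] as soon as
    [coord j x <= coord j b], so that the bumps tend to the indicator of the half-open box at every
    point, the closed faces included. *)
Definition box_bump a b (n : nat) (x : R3 R) : R :=
  \prod_(j < 3) (flat 0 (n.+1%:R * (coord j x - coord j a)) *
    flat 0 (- (n.+1%:R ^+ 2) * (coord j x - (coord j b + n.+1%:R^-1)))).

Lemma flat0_le1 t : flat 0 t <= 1 :> R.
Proof.
rewrite /flat; case: ifP => // t0; rewrite expr0 mul1r -expR0 ler_expR.
by rewrite oppr_le0 invr_ge0 ltW.
Qed.

Lemma flat0_cvg1 (u : R^nat) : u @ \oo --> +oo -> (fun n => flat 0 (u n)) @ \oo --> (1 : R).
Proof.
move=> uoo.
have u0 : \forall n \near \oo, 0 < u n by move/cvgryPgt : uoo; exact.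
have cE : (fun n => expR (- (u n)^-1)) @ \oo --> (1 : R).
  rewrite -expR0 -oppr0; apply: continuous_cvg; first exact: continuous_expR.
  by apply: cvgN; apply/gtr0_cvgV0.
apply: cvg_trans cE; apply: near_eq_cvg; near=> n.
rewrite /flat ifT ?expr0 ?mul1r//; near: n; exact: u0.
Unshelve. all: by end_near. Qed.

Lemma flat0_eq0 t : t <= 0 -> flat 0 t = 0 :> R.
Proof. by rewrite /flat leNgt => /negbTE ->. Qed.

Lemma box_bump_cvg a b x : box_bump a b n x @[n --> \oo] --> (\1_(hbox a b) x : R).
Proof.
have cprod (F : nat -> 'I_3 -> R) (l : 'I_3 -> R) :
    (forall j, F n j @[n --> \oo] --> l j) ->
    \prod_(j < 3) F n j @[n --> \oo] --> \prod_(j < 3) l j.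
  move=> H; under eq_fun do rewrite !big_ord_recl big_ord0.
  by rewrite !big_ord_recl big_ord0; do 3 (apply: cvgM; first exact: H); exact: cvg_cst.
rewrite (_ : \1_(hbox a b) x = \prod_(j < 3) (coord j a < coord j x <= coord j b)%R%:R); last first.
  rewrite indicE; have [bx|nbx] := pselect (hbox a b x).
    rewrite mem_set// big1// => j _.
    by move/hboxP : bx => /(_ j) ->.
  rewrite memNset//; apply/esym/eqP/prodf_eq0.
  have [j nj] : exists j, ~ (coord j a < coord j x <= coord j b).
    by apply/existsNP => H; apply/nbx/hboxP.
  by exists j => //; case: (_ < _ <= _) nj => //; case.
apply: cprod => j.
have cn : (fun n : nat => (n.+1%:R : R)) @ \oo --> +oo.
  have := @cvgr_idn R; rewrite -(cvg_shiftS (fun n : nat => n%:R : R)); exact.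
have [ax|xa] := ltP (coord j a) (coord j x); last first.
  rewrite /= (_ : (fun n => _) = cst 0); first exact: cvg_cst.
  apply/funext => n; rewrite flat0_eq0 ?mul0r//.
  by rewrite pmulr_rle0 ?ltr0n// subr_le0.
have argE n : - (n.+1%:R ^+ 2) * (coord j x - (coord j b + n.+1%:R^-1)) =
    n.+1%:R * (n.+1%:R * (coord j b - coord j x) + 1) :> R.
  by field.
rewrite /=; have [xb|bx] := leP (coord j x) (coord j b).
  rewrite -[X in _ --> X]mulr1; apply: cvgM; apply: flat0_cvg1.
    apply/cvgryPge => A; near=> n.
    rewrite -ler_pdivrMr ?subr_gt0//; near: n.
    by move/cvgryPge : cn; exact.
  apply/cvgryPge => A; near=> n; rewrite argE; apply: (@le_trans _ _ n.+1%:R).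
    by near: n; move/cvgryPge : cn; exact.
  by rewrite ler_peMr// lerDr mulr_ge0// subr_ge0.
apply: cvg_near_cst; near=> n.
rewrite (@flat0_eq0 (- _ * _)) ?mulr0//.
rewrite argE pmulr_rle0 ?ltr0n// -lerBrDr sub0r -opprB mulrN lerN2.
rewrite -ler_pdivrMr ?subr_gt0// div1r; near: n.
by move/cvgryPge : cn; exact.
Unshelve. all: by end_near. Qed.
Lemma box_bump_ge0_le1 a b n x : 0 <= box_bump a b n x <= 1.
Proof.
apply/andP; split; first by apply: prodr_ge0 => j _; apply: mulr_ge0; exact: flat_ge0.
apply: prodr_ile1 => j _; apply/andP; split; first by apply: mulr_ge0; exact: flat_ge0.
by apply: mulr_ile1; rewrite ?flat_ge0 ?flat0_le1.
Qed.

Lemma box_bump_support a b n x :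
  box_bump a b n x != 0 -> hbox a (b + (1, 1, 1)) x.
Proof.
move=> /prodf_neq0 H; apply/hboxP => j.
have := H j isT; rewrite mulf_eq0 negb_or => /andP[f1 f2].
have t1 : coord j a < coord j x.
  rewrite ltNge; apply: contra f1 => xa.
  by rewrite flat0_eq0// pmulr_rle0 ?ltr0n// subr_le0.
rewrite t1/= coordD leNgt; apply: contra f2 => xb.
rewrite flat0_eq0// nmulr_rle0; last by rewrite oppr_lt0 exprn_gt0.
rewrite subr_ge0; apply: le_trans (ltW xb); rewrite lerD2l.
suff -> : coord j (1, 1, 1) = 1 :> R by rewrite invf_le1 ?ltr0n// ler1n.
by rewrite /coord; case: ifP => //; case: ifP.
Qed.

Lemma compact_cbox (a b : R3 R) : compact
  ((`[a.1.1, b.1.1]%classic `*` `[a.1.2, b.1.2]%classic) `*` `[a.2, b.2]%classic : set (R3 R)).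
Proof. by do 2 (apply: compact_setX; last exact: segment_compact); exact: segment_compact. Qed.

Lemma test_function_box_bump a b n : test_function (box_bump a b n).
Proof.
split.
  apply: smooth_elementary.
  rewrite (_ : box_bump a b n = fun x => \prod_(j < 3) (flat 0 (n.+1%:R * (coord j x - coord j a)) *
    flat 0 (- (n.+1%:R ^+ 2) * (coord j x - (coord j b + n.+1%:R^-1)))))//.
  under eq_fun do rewrite !big_ord_recl big_ord0.
  by repeat (apply: elementaryM || apply: elementary_cst || apply: elementary_flat).
have cK := @compact_cbox a (b + (1, 1, 1)).
have clK := compact_closed (@norm_hausdorff _ _) cK.
apply: subclosed_compact cK _; first exact: closed_closure.
move=> x clx; apply: clK; move: x clx; apply: closure_subset.
move=> x /box_bump_support [[/=]]; rewrite !in_itv/= => /andP[/ltW -> ->] /andP[/ltW -> ->] /andP[/ltW -> ->].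
by [].
Qed.

Lemma hbox_indic_Lfun2 a b : (\1_(hbox a b) : T3 -> R) \in Lfun (leb3 R) 2%:E.
Proof.
have mb := measurable_hbox a b.
apply/Lfun2P; split; first exact: measurable_indic.
rewrite (eq_integral (fun x => (\1_(hbox a b) x)%:E)) => [|x _]; last first.
  by rewrite indicE; case: (_ \in _); rewrite ?expr1n// expr0n.
by rewrite integral_indic// setIT leb3_hbox_lty.
Qed.

Lemma measurable_box_bump a b n : measurable_fun [set: T3] (box_bump a b n).
Proof.
have mc j : measurable_fun [set: T3] (coord j : T3 -> R).
  case: j => [[|[|[|//]]] ?]; rewrite /coord/=; [exact: mcoord1|exact: mcoord2|exact: mcoord3].
have mf k : measurable_fun [set: R] (@flat R k).
  by apply: continuous_measurable_fun; exact: flat_continuous.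
rewrite (_ : box_bump a b n = fun x => \prod_(j < 3) (flat 0 (n.+1%:R * (coord j x - coord j a)) *
    flat 0 (- (n.+1%:R ^+ 2) * (coord j x - (coord j b + n.+1%:R^-1)))))//.
under eq_fun do rewrite !big_ord_recl big_ord0.
by repeat (apply: measurable_funM => // || apply: (measurableT_comp (mf _)) || apply: measurable_funB => //).
Qed.

(** All the bumps live in the box enlarged by one unit, on which the square integrable [f] is
    integrable: the convergence of [box_bump] is dominated. *)
Lemma integral_hbox_eq0 (f : T3 -> R) : f \in Lfun (leb3 R) 2%:E ->
    (forall phi, test_function phi -> \int[leb3 R]_x (f x * phi x) = 0) ->
  forall a b, (\int[leb3 R]_(x in hbox a b) (f x)%:E = 0)%E.
Proof.
move=> f2 f0 a b; have mf : measurable_fun setT f by have /Lfun2P[] := f2.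
have mb := measurable_hbox.
pose F n x := (f x * box_bump a b n x)%:E.
have mF n : measurable_fun setT (F n).
  by apply/measurable_EFinP/measurable_funM => //; exact: measurable_box_bump.
have mf1 : measurable_fun setT (fun x => (f x * \1_(hbox a b) x)%:E).
  by apply/measurable_EFinP/measurable_funM => //; exact: measurable_indic.
have ig : (leb3 R).-integrable setT (fun x => `|f x * \1_(hbox a (b + (1, 1, 1))) x|%:E).
  by apply: integrable_norm; apply: ip_integrable => //; exact: hbox_indic_Lfun2.
have ip_b n : (leb3 R).-integrable setT (F n).
  apply: le_integrable ig => // x _; rewrite lee_fin normr_id !normrM ler_wpM2l//.
  have [->|/box_bump_support bx] := eqVneq (box_bump a b n x) 0.
    by rewrite normr0.
  rewrite indicE mem_set// normr1 ger0_norm; last by case/andP: (box_bump_ge0_le1 a b n x).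
  by case/andP: (box_bump_ge0_le1 a b n x).
have [] := @dominated_convergence _ _ R (leb3 R) setT measurableT F _ _ mF mf1 _ ig.
- apply: nearW => x _; apply: cvg_EFin; first by apply: nearW.
  by apply: cvgM; [exact: cvg_cst|exact: box_bump_cvg].
- apply: nearW => x n _; rewrite lee_fin !normrM ler_wpM2l//.
  have [->|/box_bump_support bx] := eqVneq (box_bump a b n x) 0.
    by rewrite normr0.
  rewrite indicE mem_set// normr1 ger0_norm; last by case/andP: (box_bump_ge0_le1 a b n x).
  by case/andP: (box_bump_ge0_le1 a b n x).
move=> _ _; rewrite (_ : (fun n => _) = cst 0%E); last first.
  apply/funext => n.
  rewrite -[LHS]fineK; last exact: integrable_fin_num.
  by have := f0 _ (test_function_box_bump a b n); rewrite /Rintegral => ->.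
move=> cv0; transitivity (\int[leb3 R]_x (f x * \1_(hbox a b) x)%:E)%E.
  rewrite [LHS]integral_mkcond; apply: eq_integral => x _.
  rewrite patchE indicE; case: ifPn => xb; first by rewrite mulr1.
  by rewrite mulr0.
apply: cvg_unique cv0 _ => //; exact: cvg_cst.
Qed.

(** Vanishing integrals pass from boxes to products of Borel sets, one side at a time, then to the
    sets generated by such products in the plane and in space. All this happens inside the bounded
    cubes [E k], because [f] need not be integrable on the whole space; the cubes exhaust it at the
    end. *)
Lemma du_bois_reymond (f : T3 -> R) : f \in Lfun (leb3 R) 2%:E ->
    (forall phi, test_function phi -> \int[leb3 R]_x (f x * phi x) = 0) ->
  {ae leb3 R, forall x, f x = 0}.
Proof.
move=> f2 f0; have Z0 := integral_hbox_eq0 f2 f0.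
have mf : measurable_fun setT f by have /Lfun2P[] := f2.
pose I k : set T1 := `]- k%:R, k%:R]%classic.
pose E k (A B C : set T1) : set T3 := ((A `&` I k) `*` (B `&` I k)) `*` (C `&` I k).
pose P k (A B C : set T1) := (\int[leb3 R]_(x in E k A B C) (f x)%:E = 0)%E.
have mI k : measurable (I k) by exact: measurable_itv.
have mE k A B C : measurable A -> measurable B -> measurable C -> measurable (E k A B C).
  by move=> *; apply: measurableX; first apply: measurableX; exact: measurableI.
have moc (A : set T1) : ocitv A -> measurable A by move=> oA; exact: sub_sigma_algebra.
have intf k (A : set T3) : measurable A -> A `<=` E k setT setT setT ->
    (leb3 R).-integrable A (EFin \o f).
  move=> mA AE; apply: (integrableS (mE k _ _ _ measurableT measurableT measurableT) mA AE).
  apply/(integrable_mkcond _ (mE k _ _ _ measurableT measurableT measurableT)).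
  have := ip_integrable f2 (hbox_indic_Lfun2 (- k%:R, - k%:R, - k%:R) (k%:R, k%:R, k%:R)).
  apply: eq_integrable => // x _; rewrite patchE /= indicE /E !setTI /hbox /=.
  by case: (_ \in _); rewrite ?mulr1// mulr0.
have EE k A B C : E k A B C `<=` E k setT setT setT by move=> x [[[? ?] [? ?]] [? ?]].
have base k A B C : ocitv A -> ocitv B -> ocitv C -> P k A B C.
  move=> oA oB oC; rewrite /P /E.
  have [[a1 b1] _ <-] := ocitvI oA (is_ocitv _ _ : ocitv (I k)).
  have [[a2 b2] _ <-] := ocitvI oB (is_ocitv _ _ : ocitv (I k)).
  have [[a3 b3] _ <-] := ocitvI oC (is_ocitv _ _ : ocitv (I k)).
  exact: (Z0 (a1, a2, a3) (b1, b2, b3)).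
have oI k : ocitv (I k) by exact: is_ocitv.
have step1 k A B C : measurable A -> ocitv B -> ocitv C -> P k A B C.
  move=> mA oB oC.
  have -> : P k A B C = (\int[leb3 R]_(x in E k (I k) B C `&` (fun x => x.1.1) @^-1` A) (f x)%:E = 0)%E.
    rewrite /P; congr (integral _ _ _ = _); apply/seteqP; rewrite /E; split=> x /=; tauto.
  apply: (@integral_preimage_eq0 _ T3 R (leb3 R) _ T1 (fun x : T3 => x.1.1) (@ocitv R : set (set T1)) (E k (I k) B C) (EFin \o f) _ _ _ _ _ _ _ A) => //.
  - exact: mcoord1.
  - by apply: mE => //; exact: moc.
  - by apply: (intf k) => //; apply: mE => //; exact: moc.
  - exact: ocitvI.
  - exact: base.
  - move=> S oS; rewrite -[RHS](base k S B C)//; congr integral.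
    by apply/seteqP; rewrite /E; split=> x /=; tauto.
have step2 k A B C : measurable A -> measurable B -> ocitv C -> P k A B C.
  move=> mA mB oC.
  have -> : P k A B C = (\int[leb3 R]_(x in E k A (I k) C `&` (fun x => x.1.2) @^-1` B) (f x)%:E = 0)%E.
    rewrite /P; congr (integral _ _ _ = _); apply/seteqP; rewrite /E; split=> x /=; tauto.
  apply: (@integral_preimage_eq0 _ T3 R (leb3 R) _ T1 (fun x : T3 => x.1.2) (@ocitv R : set (set T1)) (E k A (I k) C) (EFin \o f) _ _ _ _ _ _ _ B) => //.
  - exact: mcoord2.
  - by apply: mE => //; exact: moc.
  - by apply: (intf k) => //; apply: mE => //; exact: moc.
  - exact: ocitvI.
  - exact: step1.
  - move=> S oS; rewrite -[RHS](step1 k A S C)//; congr integral.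
    by apply/seteqP; rewrite /E; split=> x /=; tauto.
have step3 k A B C : measurable A -> measurable B -> measurable C -> P k A B C.
  move=> mA mB mC.
  have -> : P k A B C = (\int[leb3 R]_(x in E k A B (I k) `&` (fun x => x.2) @^-1` C) (f x)%:E = 0)%E.
    rewrite /P; congr (integral _ _ _ = _); apply/seteqP; rewrite /E; split=> x /=; tauto.
  apply: (@integral_preimage_eq0 _ T3 R (leb3 R) _ T1 (fun x : T3 => x.2) (@ocitv R : set (set T1)) (E k A B (I k)) (EFin \o f) _ _ _ _ _ _ _ C) => //.
  - exact: mcoord3.
  - exact: mE.
  - by apply: (intf k) => //; exact: mE.
  - exact: ocitvI.
  - exact: step2.
  - move=> S oS; rewrite -[RHS](step2 k A B S)//; congr integral.
    by apply/seteqP; rewrite /E; split=> x /=; tauto.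
have XI d1 d2 (S1 : measurableType d1) (S2 : measurableType d2) :
    setI_closed [set A `*` B | A in @measurable _ S1 & B in @measurable _ S2].
  move=> _ _ [A mA [B mB <-]] [A' mA' [B' mB' <-]]; rewrite -setXI.
  by exists (A `&` A'); [exact: measurableI|exists (B `&` B') => //; exact: measurableI].
have step4 k (X : set T2) C : measurable X -> measurable C ->
    (\int[leb3 R]_(x in E k setT setT C `&` (fun x => x.1) @^-1` X) (f x)%:E = 0)%E.
  move=> mX mC.
  apply: (@integral_preimage_eq0 _ T3 R (leb3 R) _ T2 (fun x : T3 => x.1) [set A `*` B | A in @measurable _ T1 & B in @measurable _ T1] (E k setT setT C) (EFin \o f) _ _ _ _ _ _ _ X) => //.
  - exact: measurable_fst.
  - exact: mE.
  - by apply: (intf k) => //; exact: mE.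
  - exact: measurable_prod_measurableType.
  - exact: XI.
  - exact: step3.
  - move=> _ [A mA [B mB <-]]; rewrite -[RHS](step3 k A B C)//; congr integral.
    by apply/seteqP; rewrite /E; split=> x /=; tauto.
have step5 k (X : set T3) : measurable X ->
    (\int[leb3 R]_(x in E k setT setT setT `&` id @^-1` X) (f x)%:E = 0)%E.
  move=> mX.
  apply: (@integral_preimage_eq0 _ T3 R (leb3 R) _ T3 id [set A `*` B | A in @measurable _ T2 & B in @measurable _ T1] (E k setT setT setT) (EFin \o f) _ _ _ _ _ _ _ X) => //.
  - exact: mE.
  - by apply: (intf k) => //; exact: mE.
  - exact: measurable_prod_measurableType.
  - exact: XI.
  - exact: step3.
  - move=> _ [A mA [B mB <-]]; rewrite -[RHS](step4 k A B)//; congr integral.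
    by apply/seteqP; rewrite /E; split=> x /=; tauto.
have ae_k k : {ae leb3 R, forall x, E k setT setT setT x -> f x = 0}.
  have mEk := mE k _ _ _ measurableT measurableT measurableT.
  have : ae_eq (leb3 R) (E k setT setT setT) (EFin \o f) (cst 0%E).
    apply: integral_ae_eq => //; first by apply: (intf k).
    move=> X XE mX; rewrite integral0 -[RHS](step5 k X mX); congr integral.
    by apply/esym/setIidPr.
  by apply: filterS => x /[apply] -[].
have := ae_foralln ae_k.
apply: filterS => x H.
pose K := (Num.bound `|x.1.1| + Num.bound `|x.1.2| + Num.bound `|x.2|)%N.
have bd (t : R) : (Num.bound `|t| <= K)%N -> I K t.
  move=> tK; have : `|t| < K%:R.
    by apply: (lt_le_trans (archi_boundP _)); rewrite ?ler_nat.
  by rewrite /I /= in_itv/= ltr_norml => /andP[-> /ltW].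
apply: (H K); rewrite /E /= ; split; [split|]; split => //; apply: bd; rewrite /K.
- by rewrite -addnA leq_addr.
- by rewrite addnAC leq_addl.
- by rewrite leq_addl.
Qed.

End DuBoisReymond.

(** * Test functions *)

Section TestFunctions.
Variable R : realType.
Local Notation T1 := (measurableTypeR R).
Local Notation T3 := (T1 * T1 * T1)%type.
Local Notation e_ i := (basis3 R i).
Implicit Types (phi psi : R3 R -> R) (a : R3 R).

(** An open set is the union of the boxes with rational corners that it contains, and these are
    countably many. *)
Lemma open_measurable3 (U : set (R3 R)) : open U -> measurable (U : set T3).
Proof.
move=> oU.
pose c (q : rat * rat * rat) : R3 R := (ratr q.1.1, ratr q.1.2, ratr q.2).
pose F (p : (rat * rat * rat) * (rat * rat * rat)) : set T3 :=
  if pselect (hbox (c p.1) (c p.2) `<=` U) then hbox (c p.1) (c p.2) else set0.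
rewrite (_ : U = \bigcup_p F p).
  apply: countable_bigcupT_measurable; first exact: countableP.
  by move=> p; rewrite /F; case: pselect => pU //=; exact: measurable_hbox.
apply/seteqP; split => [x Ux|x [p _]]; last by rewrite /F; case: pselect => pU //= /pU.
have [e /= e0 eU] : exists2 e : R, 0 < e & ball x e `<=` U.
  by have /nbhs_ballP[e e0 eU] := open_nbhs_nbhs (conj oU Ux); exists e.
have lo (t : R) : exists q : rat, t - e < ratr q < t.
  have /rat_in_itvoo[q] : t - e < t by rewrite gtrBl.
  by rewrite in_itv/=; exists q.
have hi (t : R) : exists q : rat, t < ratr q < t + e.
  have /rat_in_itvoo[q] : t < t + e by rewrite ltrDl.
  by rewrite in_itv/=; exists q.
have [q1 /andP[q11 q12]] := lo x.1.1; have [q2 /andP[q21 q22]] := lo x.1.2.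
have [q3 /andP[q31 q32]] := lo x.2.
have [r1 /andP[r11 r12]] := hi x.1.1; have [r2 /andP[r21 r22]] := hi x.1.2.
have [r3 /andP[r31 r32]] := hi x.2.
exists ((q1, q2, q3), (r1, r2, r3)) => //; rewrite /F.
case: pselect => pU /=; last first.
  exfalso; apply: pU => y [[/= y1 y2] y3]; apply: eU.
  move: y1 y2 y3; rewrite !in_itv/= => /andP[? ?] /andP[? ?] /andP[? ?].
  split; [split|]; rewrite /ball/= ltr_norml; apply/andP; split; lra.
by split; [split|]; rewrite /= in_itv/=; apply/andP; split => //; exact: ltW.
Qed.

Lemma continuous_measurable3 (f : R3 R -> R) : continuous f ->
  measurable_fun [set: T3] (f : T3 -> R).
Proof.
move=> /continuousP cf; apply: (measurability _ (RGenOpens.measurableE R)).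
move=> _ [_ [a [b ->] <-]]; rewrite setTI.
by apply: open_measurable3; apply: cf; exact: itv_open.
Qed.

Lemma compact_bounded_fun (K : set (R3 R)) (f : R3 R -> R) : compact K ->
  continuous f -> exists M, forall x, K x -> `|f x| <= M.
Proof.
move=> cK cf; have := continuous_compact (@continuous_subspaceT _ _ K _ cf) cK.
move=> /compact_bounded [M [_ MP]]; exists (M + 1) => x Kx.
by apply: (MP (M + 1)); [rewrite ltrDl|exists x].
Qed.

Lemma iter_partial_eq0 phi s x : ~ closure [set x | phi x != 0] x -> iter_partial s phi x = 0.
Proof.
elim: s x => [x nx|i s IH x nx] /=.
  by apply: contrapT => /eqP px; apply: nx; exact: subset_closure.
have H : \near x, iter_partial s phi x = cst 0 x.
  have : nbhs x (~` closure [set x | phi x != 0]).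
    by apply: open_nbhs_nbhs; split => //; apply: closed_openC; exact: closed_closure.
  by apply: filterS => y; exact: IH.
by rewrite (near_eq_derive (e_ i) H) derive_cst.
Qed.

Lemma iter_partial_dominated phi s : test_function phi -> exists (B : R) (k : nat),
  0 <= B /\ forall x, `|iter_partial s phi x| <= B * \1_(hbox (- k%:R, - k%:R, - k%:R) (k%:R, k%:R, k%:R)) x.
Proof.
move=> [sphi cK]; set K := closure _ in cK.
have [B BP] := compact_bounded_fun cK (sphi s).1.
have bc j := compact_bounded_fun cK (@coord_continuous R j).
have [M MP] := choice bc.
pose k := \max_(j < 3) (Num.bound `|M j|).
exists `|B|, k; split => // x.
have [Kx|nKx] := pselect (K x); last first.
  by rewrite iter_partial_eq0// normr0 mulr_ge0// indicE; case: (_ \in _).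
rewrite indicE mem_set ?mulr1; last first.
  apply/hboxP => j; have := MP j x Kx; rewrite ler_norml => /andP[l1 l2].
  have -> : coord j (- k%:R, - k%:R, - k%:R) = - k%:R :> R.
    by rewrite /coord; case: ifP => //; case: ifP.
  have -> : coord j (k%:R, k%:R, k%:R) = k%:R :> R.
    by rewrite /coord; case: ifP => //; case: ifP.
  have Mk : M j < k%:R.
    apply: (le_lt_trans (ler_norm _)); apply: (lt_le_trans (archi_boundP _)) => //.
    by rewrite ler_nat /k (leq_bigmax (F := fun j => Num.bound `|M j|)).
  apply/andP; split; lra.
apply: le_trans (BP x Kx) _; exact: ler_norm.
Qed.

Lemma measurable_iter_partial phi s : test_function phi ->
  measurable_fun [set: T3] (iter_partial s phi : T3 -> R).
Proof. by move=> [sphi _]; apply: continuous_measurable3; exact: (sphi s).1. Qed.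

Lemma Lfun2_le (u v : T3 -> R) : v \in Lfun (leb3 R) 2%:E -> measurable_fun setT u ->
  (forall x, `|u x| <= `|v x|) -> u \in Lfun (leb3 R) 2%:E.
Proof.
move=> /Lfun2P[mv iv] mu uv; apply/Lfun2P; split => //; apply: le_lt_trans iv.
apply: ge0_le_integral => //.
- by move=> x _; rewrite lee_fin sqr_ge0.
- exact/measurable_EFinP/measurable_funX.
- exact/measurable_EFinP/measurable_funX.
- move=> x _; rewrite lee_fin -[u x ^+ 2]real_normK ?num_real// -[v x ^+ 2]real_normK ?num_real//.
  by rewrite lerXn2r ?nnegrE.
Qed.

Lemma Lfun2_iter_partial phi s : test_function phi ->
  (iter_partial s phi : T3 -> R) \in Lfun (leb3 R) 2%:E.
Proof.
move=> tphi; have [B [k [B0 BP]]] := iter_partial_dominated s tphi.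
apply: (Lfun2_le (Lfun2Z B (hbox_indic_Lfun2 _ _))) (measurable_iter_partial s tphi) _.
by move=> x; apply: le_trans (BP x) _; exact: ler_norm.
Qed.

Lemma Lfun2_test phi : test_function phi -> (phi : T3 -> R) \in Lfun (leb3 R) 2%:E.
Proof. exact: (@Lfun2_iter_partial phi [::]). Qed.

Lemma iter_partial_axpy c phi psi s : smooth phi -> smooth psi ->
  iter_partial s (fun x => c * phi x + psi x)
  = fun x => c * iter_partial s phi x + iter_partial s psi x.
Proof.
move=> sphi spsi; elim: s => [//|i s IH] /=; rewrite IH; apply/funext => x.
have d1 := derivableZ (k := c) ((sphi s).2 i x).
rewrite (@deriveD _ _ _ (c *: iter_partial s phi) (iter_partial s psi) x (e_ i) d1 ((spsi s).2 i x)).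
by rewrite (deriveZ _ ((sphi s).2 i x)).
Qed.

Lemma test_function0 : test_function (fun=> 0 : R).
Proof.
split.
  by apply: smooth_elementary; exact: elementary_cst.
rewrite (_ : [set x | _] = set0); first by rewrite closure0; exact: compact0.
by apply/seteqP; split => // x /=; rewrite eqxx.
Qed.

Lemma test_function_axpy c phi psi : test_function phi -> test_function psi ->
  test_function (fun x => c * phi x + psi x).
Proof.
move=> [sphi cphi] [spsi cpsi]; split.
  move=> s; rewrite iter_partial_axpy//; split.
    move=> x; apply: cvgD; last exact: (spsi s).1.
    by apply: cvgM; [exact: cvg_cst|exact: (sphi s).1].
  move=> i x; apply: derivableD; last exact: (spsi s).2.
  by have := derivableZ (k := c) ((sphi s).2 i x).
apply: subclosed_compact (compactU cphi cpsi) _; first exact: closed_closure.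
rewrite -closureU; apply: closure_subset => x /=.
have [->|px _] := eqVneq (phi x) 0; last by left.
by rewrite mulr0 add0r; right.
Qed.

Lemma derive_shift3 (f : R3 R -> R) a (v x : R3 R) : 'D_v (fun y => f (y + a)) x = 'D_v f (x + a).
Proof.
rewrite /derive; suff -> : (fun h : R => h^-1 *: (((fun y => f (y + a)) \o shift x) (h *: v) - f (x + a))) =
   (fun h => h^-1 *: ((f \o shift (x + a)) (h *: v) - f (x + a))) by [].
by apply/funext => h /=; rewrite addrA.
Qed.

Lemma iter_partial_shift (f : R3 R -> R) a s :
  iter_partial s (fun y => f (y + a)) = fun x => iter_partial s f (x + a).
Proof.
by elim: s => [//|i s IH] /=; rewrite IH; apply/funext => x; exact: derive_shift3.
Qed.

Lemma continuous_shift3 a : continuous (fun x : R3 R => x + a).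
Proof. by move=> x; apply: cvgD; [exact: cvg_id|exact: cvg_cst]. Qed.

Lemma test_function_shift phi a : test_function phi -> test_function (fun x => phi (x + a)).
Proof.
move=> [sphi cphi]; split.
  move=> s; rewrite iter_partial_shift; split.
    move=> x; exact: (@cvg_comp _ _ _ _ _ _ _ _ (@continuous_shift3 a x) ((sphi s).1 _)).
  move=> i; change (forall x : R3 R, derivable (fun y : R3 R => iter_partial s phi (y + a)) x (e_ i)) => x; have := (sphi s).2 i (x + a); rewrite /derivable.
  suff -> : (fun h : R => h^-1 *: (((fun y => iter_partial s phi (y + a)) \o shift x) (h *: e_ i) - iter_partial s phi (x + a))) =
   (fun h => h^-1 *: ((iter_partial s phi \o shift (x + a)) (h *: e_ i) - iter_partial s phi (x + a))) by [].
  by apply/funext => h /=; rewrite addrA.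
have cK : compact ((fun x : R3 R => x - a) @` closure [set x | phi x != 0]).
  apply: continuous_compact => //; apply: continuous_subspaceT; exact: continuous_shift3.
have clK := compact_closed (@norm_hausdorff _ _) cK.
apply: subclosed_compact cK _; first exact: closed_closure.
move=> x clx; apply: clK; move: x clx; apply: closure_subset => x /= px.
exists (x + a); last by rewrite addrK.
exact: subset_closure.
Qed.

(** The mean value theorem is used twice along the [i]-th axis. The remainder is dominated by a
    fixed square integrable function, so that the error is quadratic in [h] also in the L^2 norm. *)
Lemma taylor_remainder phi i : test_function phi -> exists2 v : T3 -> R,
  v \in Lfun (leb3 R) 2%:E & forall h x, 0 <= h <= 1 ->
    `|phi (x + h *: e_ i) - phi x - h * 'D_(e_ i) phi x| <= h ^+ 2 * v x.
Proof.
move=> tphi; have [sphi _] := tphi.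
have [B [k [B0 BP]]] := iter_partial_dominated [:: i; i] tphi.
(* The second derivative is taken at [x + d e_i] with [0 <= d <= 1], hence one unit of margin around
   the support. *)
pose k1 := (k.+1)%:R : R.
exists (fun x => B * \1_(hbox (- k1, - k1, - k1) (k1, k1, k1)) x).
  exact: (Lfun2Z B (hbox_indic_Lfun2 _ _)).
move=> h x /andP[h0 h1].
have dline s y : is_derive (y : R) (1 : R) (fun t : R => iter_partial s phi (t *: e_ i + x))
    (iter_partial (i :: s) phi (y *: e_ i + x)).
  have /derivableP := (sphi s).2 i (y *: e_ i + x).
  move=> /(is_derive_line (iter_partial s phi)) [dl dv].
  have E : (fun h0 : R => h0^-1 *: (((fun t : R => iter_partial s phi (t *: e_ i + x)) \o shift y) (h0 *: (1 : R)) - iter_partial s phi (y *: e_ i + x)))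
     = (fun h0 : R => h0^-1 *: (((fun t : R => iter_partial s phi (t *: e_ i + (y *: e_ i + x))) \o shift 0) (h0 *: (1 : R)) - iter_partial s phi (0 *: e_ i + (y *: e_ i + x)))).
    apply/funext => t /=; rewrite addr0 scale0r add0r [_%:A]mulr1.
    by rewrite scalerDl -addrA.
  by apply: DeriveDef; [rewrite /derivable E|rewrite /derive E; exact: dv].
have cline s (t : R) : {within `[0, t], continuous (fun t : R => iter_partial s phi (t *: e_ i + x))}.
  apply: continuous_subspaceT => y; apply: differentiable_continuous.
  by apply/derivable1_diffP; have [] := dline s y.
have [c + Ec] := MVT_segment h0 (fun y _ => dline [::] y) (cline [::] h).
rewrite in_itv/= => /andP[c0 ch].
have [d + Ed] := MVT_segment c0 (fun y _ => dline [:: i] y) (cline [:: i] c).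
rewrite in_itv/= => /andP[d0 dc].
move: Ec Ed; rewrite /= scale0r !add0r !subr0 (addrC _ x) => Ec Ed.
rewrite Ec mulrC -mulrBr Ed normrM (ger0_norm h0) expr2 -mulrA ler_wpM2l//.
rewrite mulrC normrM (ger0_norm c0).
apply: ler_pM => //.
apply: le_trans (BP _) _; apply: ler_wpM2l => //.
have [bx|] := pselect (hbox (- k1, - k1, - k1) (k1, k1, k1) x).
  by rewrite [leRHS]indicE mem_set// indicE; case: (_ \in _).
move=> nbx; rewrite [leLHS]indicE memNset ?indicE; first by case: (_ \in _).
move=> /hboxP by_; apply: nbx; apply/hboxP => j; have := by_ j.
rewrite !coord_diag coordD coord_basis3 /k1 -natr1.
have : 0 <= d * (i == j)%:R <= 1.
  by case: (i == j); rewrite ?mulr1 ?mulr0; apply/andP; split => //; lra.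
move=> /andP[? ?] /andP[? ?]; apply/andP; split; lra.
Qed.

End TestFunctions.

(** * H^1 and difference quotients *)

Section Norm2.
Context d (T : measurableType d) (R : realType) (mu : {measure set T -> \bar R}).
Implicit Types u v : T -> R.

Definition norm2 u : R := Num.sqrt (ip mu u u).

Lemma norm2_ge0 u : 0 <= norm2 u. Proof. exact: sqrtr_ge0. Qed.

Lemma sqr_norm2 u : norm2 u ^+ 2 = ip mu u u.
Proof. by rewrite sqr_sqrtr// ip_ge0. Qed.

Lemma norm2_le u c : 0 <= c -> ip mu u u <= c ^+ 2 -> norm2 u <= c.
Proof. by move=> c0 uc; rewrite -(ger0_norm c0) -sqrtr_sqr ler_sqrt// sqr_ge0. Qed.

Lemma cauchy_schwarz_norm u v : u \in Lfun mu 2%:E -> v \in Lfun mu 2%:E ->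
  `|ip mu u v| <= norm2 u * norm2 v.
Proof.
move=> u2 v2; rewrite /norm2 -sqrtrM ?ip_ge0// -sqrtr_sqr ler_sqrt.
  exact: cauchy_schwarz.
by rewrite mulr_ge0 ?ip_ge0.
Qed.

Lemma eq_ip u u' v v' : u =1 u' -> v =1 v' -> ip mu u v = ip mu u' v'.
Proof. by move=> uu vv; apply: eq_Rintegral => x _; rewrite uu vv. Qed.

Lemma ip_le_abs u v : u \in Lfun mu 2%:E -> v \in Lfun mu 2%:E ->
  (forall x, `|u x| <= `|v x|) -> ip mu u u <= ip mu v v.
Proof.
move=> u2 v2 uv; apply: le_Rintegral => //; try exact: ip_integrable.
move=> x _; rewrite -!expr2 -[u x ^+ 2]real_normK ?num_real// -[v x ^+ 2]real_normK ?num_real//.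
by rewrite lerXn2r ?nnegrE.
Qed.

Lemma ipDr w u v : u \in Lfun mu 2%:E -> v \in Lfun mu 2%:E ->
  w \in Lfun mu 2%:E -> ip mu w (fun x => u x + v x) = ip mu w u + ip mu w v.
Proof. by move=> u2 v2 w2; rewrite !(ipC _ w) ipDl. Qed.

Lemma ipBr w u v : u \in Lfun mu 2%:E -> v \in Lfun mu 2%:E ->
  w \in Lfun mu 2%:E -> ip mu w (fun x => u x - v x) = ip mu w u - ip mu w v.
Proof. by move=> u2 v2 w2; rewrite !(ipC _ w) ipBl. Qed.

Lemma ipZr a w u : u \in Lfun mu 2%:E -> w \in Lfun mu 2%:E ->
  ip mu w (fun x => a * u x) = a * ip mu w u.
Proof. by move=> u2 w2; rewrite !(ipC _ w) ipZl. Qed.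

End Norm2.

Section WeakDerivatives.
Variable R : realType.
Local Notation T1 := (measurableTypeR R).
Local Notation T3 := (T1 * T1 * T1)%type.
Local Notation e_ i := (basis3 R i).
Local Notation mu := (leb3 R).
Local Notation L2s := (Lfun mu 2%:E).
Implicit Types (u v w g : R3 R -> R) (a : R3 R).

Lemma Lfun2_shift u a : (u : T3 -> R) \in L2s -> (fun x : T3 => u ((x : R3 R) + a)) \in L2s.
Proof.
move=> /Lfun2P[mu_ iu]; apply/Lfun2P; split; first exact: measurable_comp_shift.
have mE : measurable_fun [set: T3] (fun x : T3 => (u x ^+ 2)%:E).
  exact/measurable_EFinP/measurable_funX.
by rewrite (ge0_integral_shift a mE)// => x; rewrite lee_fin sqr_ge0.
Qed.

Lemma ip_shift u v a : (u : T3 -> R) \in L2s -> (v : T3 -> R) \in L2s ->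
  ip mu (fun x => u (x + a)) (fun x => v (x + a)) = ip mu u v.
Proof.
move=> /Lfun2P[mu_ _] /Lfun2P[mv _].
rewrite /ip -(Rintegral_shift a (f := fun x => u x * v x))//.
exact: measurable_funM.
Qed.

(** Over [n] equal steps from 0 to [h] the linear terms add up to [h * G] and the quadratic errors
    only to [h^2 D / n]. This takes the place of differentiating [L] and integrating its
    derivative. *)
Lemma small_increments_lipschitz (L : R -> R) (G D h : R) : 0 <= h ->
    (forall s t, 0 <= t <= 1 -> `|L (s + t) - L s| <= t * G + t ^+ 2 * D) ->
  `|L h - L 0| <= h * G.
Proof.
move=> h0 H; apply/ler_addgt0Pr => e e0.
pose n := (Num.bound (h + h ^+ 2 * `|D| / e)).+1.
have hn : h + h ^+ 2 * `|D| / e < n%:R.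
  apply: (lt_trans (archi_boundP _)); last by rewrite ltr_nat.
  by rewrite addr_ge0// divr_ge0 ?(ltW e0)// mulr_ge0 ?sqr_ge0.
have n0 : 0 < n%:R :> R by rewrite ltr0n.
have hD0 : 0 <= h ^+ 2 * `|D| / e by rewrite divr_ge0 ?(ltW e0)// mulr_ge0 ?sqr_ge0.
pose t := h / n%:R.
have t01 : 0 <= t <= 1.
  rewrite /t divr_ge0 ?(ltW n0)//= ler_pdivrMr// mul1r; lra.
have step k : `|L (k%:R * t) - L 0| <= k%:R * (t * G + t ^+ 2 * D).
  elim: k => [|k IH]; first by rewrite !mul0r subrr normr0.
  rewrite -natr1 mulrDl mul1r.
  rewrite (_ : _ - L 0 = (L (k%:R * t + t) - L (k%:R * t)) + (L (k%:R * t) - L 0)); last by ring.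
  apply: le_trans (ler_normD _ _) _; rewrite mulrDl mul1r addrC.
  by apply: lerD => //; exact: H.
have := step n; rewrite (_ : n%:R * t = h); last by rewrite /t; field; rewrite gt_eqF.
move=> /le_trans; apply.
have -> : n%:R * (t * G + t ^+ 2 * D) = h * G + h ^+ 2 * D / n%:R.
  by rewrite /t; field; rewrite gt_eqF.
rewrite lerD2l ler_pdivrMr//.
have : h ^+ 2 * `|D| / e * e <= n%:R * e by rewrite ler_pM2r//; lra.
rewrite divfK ?gt_eqF// (mulrC e); apply: le_trans.
by rewrite ler_wpM2l ?sqr_ge0// ler_norm.
Qed.

Lemma remainder_Lfun2 phi i : test_function phi -> exists2 B, 0 <= B &
  forall h, 0 <= h <= 1 ->
    let r := fun x => phi (x + h *: e_ i) - phi x - h * 'D_(e_ i) phi x in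
    (r : T3 -> R) \in L2s /\ norm2 mu r <= h ^+ 2 * B.
Proof.
move=> tphi; have [v v2 vP] := taylor_remainder i tphi.
exists (norm2 mu v); first exact: norm2_ge0.
move=> h h01 r.
have r2 : (r : T3 -> R) \in L2s.
  apply: Lfun2B; last by apply: Lfun2Z; exact: (Lfun2_iter_partial [:: i] tphi).
  by apply: Lfun2B; [apply: Lfun2_shift|]; exact: Lfun2_test.
split => //; apply: norm2_le; first by rewrite mulr_ge0 ?sqr_ge0 ?norm2_ge0.
rewrite exprMn sqr_norm2.
have -> : h ^+ 2 ^+ 2 * ip mu v v = ip mu (fun x => h ^+ 2 * v x) (fun x => h ^+ 2 * v x).
  by rewrite ipZl// ?Lfun2Z// ipC ipZl//; ring.
apply: ip_le_abs => //; first exact: Lfun2Z.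
by move=> x; apply: le_trans (vP _ _ h01) _; exact: ler_norm.
Qed.

Lemma weak_partial_ip u g i : weak_partial i u g <->
  forall phi, test_function phi -> ip mu u ('D_(e_ i) phi) = - ip mu g phi.
Proof. by []. Qed.

(** Equal pairings with test functions force equality almost everywhere. It is used to pass from the
    norm of a function produced by Riesz representation, or of any weak derivative, to that of the
    function of interest. *)
Lemma dbr_ip (f k : T3 -> R) : f \in L2s -> k \in L2s ->
  (forall phi, test_function phi -> ip mu f phi = ip mu k phi) -> ip mu f f = ip mu k k.
Proof.
move=> f2 k2 fk.
have : {ae mu, forall x, f x - k x = 0}.
  apply: du_bois_reymond => [|phi tphi]; first exact: Lfun2B.
  have phi2 := Lfun2_test tphi.
  by have := ipBl f2 k2 phi2; rewrite fk// subrr.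
move=> ae0; rewrite /ip /Rintegral; congr fine; apply: ae_eq_integral => //.
- exact: measurable_int (ip_integrable f2 f2).
- exact: measurable_int (ip_integrable k2 k2).
- by apply: filterS ae0 => x /eqP; rewrite subr_eq0 => /eqP -> _.
Qed.

(** By duality. Paired with a test function, the shift moves to the test function, and the pairing
    becomes an increment of [L s], whose rate of change is a pairing with [g]. The resulting bound
    [h * norm2 g * norm2 phi] is turned into a bound on the norm of the difference. *)
Lemma weak_partial_shift_le w g i h : (w : T3 -> R) \in L2s -> (g : T3 -> R) \in L2s ->
  weak_partial i w g -> 0 <= h ->
  ip mu (fun x => w (x + h *: e_ i) - w x) (fun x => w (x + h *: e_ i) - w x)
  <= h ^+ 2 * ip mu g g.
Proof.
move=> w2 g2 wg h0.
have wh2 := Lfun2_shift (h *: e_ i) w2.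
have dw2 := Lfun2B wh2 w2.
pose l phi := ip mu (fun x => w (x + h *: e_ i) - w x) phi.
have [k [k2 kC lk]] : exists k : T3 -> R, [/\ k \in L2s, ip mu k k <= h ^+ 2 * ip mu g g &
    forall phi : T3 -> R, test_function phi -> l phi = ip mu k phi].
  apply: (@riesz_representation _ T3 R mu (fun phi : T3 -> R => test_function (phi : R3 R -> R)) l).
  - by rewrite mulr_ge0 ?sqr_ge0 ?ip_ge0.
  - exact: test_function0.
  - by move=> phi; exact: Lfun2_test.
  - exact: test_function_axpy.
  - move=> a phi psi tphi tpsi; have phi2 := Lfun2_test tphi; have psi2 := Lfun2_test tpsi.
    by rewrite /l ipDr ?Lfun2Z// ipZr.
  move=> phi tphi; have phi2 := Lfun2_test tphi.
  pose L s := ip mu w (fun x => phi (x - s *: e_ i)).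
  have lL : l phi = L h - L 0.
    rewrite /l ipBl//; congr (_ - _).
      rewrite /L -(ip_shift (- (h *: e_ i)) wh2 phi2).
      by apply: eq_ip => x //; rewrite subrK.
    by apply: eq_ip => x //; rewrite scale0r subr0.
  have [B B0 BP] := remainder_Lfun2 i tphi.
  have : `|l phi| <= h * (norm2 mu g * norm2 mu phi).
    rewrite lL; apply: (small_increments_lipschitz (D := norm2 mu w * B)) => // s t t01.
    have [r2 rB] := BP t t01; move: r2 rB.
    set r := (fun x => _) => r2 rB.
    pose a : R3 R := - ((s + t) *: e_ i).
    have tpsi := test_function_shift a tphi; have psi2 := Lfun2_test tpsi.
    have dpsi2 := Lfun2_iter_partial [:: i] tpsi.
    have ra2 := Lfun2_shift a r2.
    (* Taylor expansion of [phi] at [x + a] in the step [t]; the term of first order is integrated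
       by parts and pairs [phi] with [g]. *)
    have -> : L s = ip mu w (fun x => r (x + a)) + (L (s + t) - t * ip mu g (fun x => phi (x + a))).
      have E1 := ipDr ra2 (Lfun2D psi2 (Lfun2Z t dpsi2)) w2.
      have E2 := ipDr psi2 (Lfun2Z t dpsi2) w2.
      have E3 := ipZr t dpsi2 w2.
      have E4 := (weak_partial_ip w g i).1 wg _ tpsi.
      rewrite -mulrN -[- ip mu g _]E4 -E3 -E2 -E1.
      apply: eq_ip => // x; rewrite /= derive_shift3 /r.
      rewrite (_ : x + a + t *: e_ i = x - s *: e_ i); last first.
        by rewrite /a scalerDl opprD -addrA addrNK.
      by ring.
    rewrite (_ : _ - _ = t * ip mu g (fun x => phi (x + a)) - ip mu w (fun x => r (x + a))); last by ring.
    apply: le_trans (ler_normB _ _) _; apply: lerD.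
      rewrite normrM ger0_norm; last by case/andP: t01.
      apply: ler_wpM2l; first by case/andP: t01.
      apply: le_trans (cauchy_schwarz_norm g2 psi2) _.
      by rewrite /norm2 ip_shift.
    apply: le_trans (cauchy_schwarz_norm w2 ra2) _.
    rewrite {2}/norm2 ip_shift// -/(norm2 mu r) mulrCA.
    by apply: ler_wpM2l => //; exact: norm2_ge0.
  move=> /sqr_le_norm; rewrite !exprMn !sqr_norm2 mulrA.
  by [].
by rewrite (dbr_ip dw2 k2).
Qed.

(** Difference quotients bounded in L^2 make [phi] |-> [- ip u (D_i phi)] bounded by [sqrt C] times
    the norm of [phi], after the limit in [h]. The function representing this functional is the weak
    derivative. *)
Lemma weak_partial_of_shift u i C : (u : T3 -> R) \in L2s -> 0 <= C ->
    (forall h, 0 < h <= 1 ->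
      ip mu (fun x => u (x + h *: e_ i) - u x) (fun x => u (x + h *: e_ i) - u x) <= C * h ^+ 2) ->
  exists g, [/\ (g : T3 -> R) \in L2s, weak_partial i u g & ip mu g g <= C].
Proof.
move=> u2 C0 uC.
pose l phi := - ip mu u ('D_(e_ i) phi).
have [k [k2 kC lk]] : exists k : T3 -> R, [/\ k \in L2s, ip mu k k <= C &
    forall phi : T3 -> R, test_function phi -> l phi = ip mu k phi].
  apply: (@riesz_representation _ T3 R mu (fun phi : T3 -> R => test_function (phi : R3 R -> R)) l).
  - by [].
  - exact: test_function0.
  - by move=> phi; exact: Lfun2_test.
  - exact: test_function_axpy.
  - move=> a phi psi tphi tpsi.
    have d1 := Lfun2_iter_partial [:: i] tphi; have d2 := Lfun2_iter_partial [:: i] tpsi.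
    have := iter_partial_axpy a [:: i] tphi.1 tpsi.1; rewrite /l /= => ->.
    by rewrite (ipDr (Lfun2Z a d1) d2 u2) (ipZr a d1 u2) opprD mulrN.
  move=> phi tphi; have phi2 := Lfun2_test tphi; have d2 := Lfun2_iter_partial [:: i] tphi.
  have [B B0 BP] := remainder_Lfun2 i tphi.
  have bnd h : 0 < h <= 1 ->
      `|l phi| <= Num.sqrt C * norm2 mu phi + h * (norm2 mu u * B).
    move=> /andP[h0 h1].
    have h01 : 0 <= h <= 1 by rewrite (ltW h0).
    have [r2 rB] := BP h h01; move: r2 rB; set r := (fun x => _) => r2 rB.
    have uh2 := Lfun2_shift (h *: e_ i) u2.
    have um2 := Lfun2_shift (- (h *: e_ i)) u2.
    (* Summation by parts: the forward difference of [phi] becomes the backward difference of [u],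
       up to the Taylor remainder [r]. *)
    have E : h * l phi = ip mu u r - ip mu (fun x => u (x - h *: e_ i) - u x) phi.
      rewrite (ipBl um2 u2 phi2).
      have <- : ip mu u (fun x => phi (x + h *: e_ i)) = ip mu (fun x => u (x - h *: e_ i)) phi.
        rewrite -(ip_shift (- (h *: e_ i)) u2 (Lfun2_shift (h *: e_ i) phi2)).
        by apply: eq_ip => // x; rewrite subrK.
      have ph2 := Lfun2_shift (h *: e_ i) phi2.
      rewrite /r (ipBr (Lfun2B ph2 phi2) (Lfun2Z h d2) u2) (ipBr ph2 phi2 u2) (ipZr h d2 u2).
      by rewrite /l /=; ring.
    rewrite -(ler_pM2l h0) -{1}(gtr0_norm h0) -normrM E.
    apply: le_trans (ler_normB _ _) _; rewrite mulrDr addrC; apply: lerD.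
      apply: le_trans (cauchy_schwarz_norm (Lfun2B um2 u2) phi2) _.
      rewrite mulrA ler_wpM2r ?norm2_ge0//; apply: norm2_le.
        by rewrite mulr_ge0 ?sqrtr_ge0// ltW.
      rewrite exprMn sqr_sqrtr// mulrC; have hh : 0 < h <= 1 by rewrite h0.
      apply: le_trans (uC h hh).
      rewrite -(ip_shift (h *: e_ i) (Lfun2B um2 u2) (Lfun2B um2 u2)).
      rewrite le_eqVlt; apply/orP; left; apply/eqP.
      by rewrite /ip; apply: eq_Rintegral => x _; rewrite addrK; ring.
    apply: le_trans (cauchy_schwarz_norm u2 r2) _.
    by rewrite mulrA -expr2 mulrCA; apply: ler_wpM2l => //; exact: norm2_ge0.
  have : `|l phi| <= Num.sqrt C * norm2 mu phi.
    apply/ler_addgt0Pr => e e0.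
    pose D := norm2 mu u * B + 1.
    have nB : 0 <= norm2 mu u * B by rewrite mulr_ge0 ?norm2_ge0.
    pose h := Num.min 1 (e / D).
    have h0 : 0 < h by rewrite lt_min ltr01 divr_gt0// /D; lra.
    apply: le_trans (bnd h _) _; first by rewrite h0 ge_min lexx.
    rewrite lerD2l; have : h <= e / D by rewrite ge_min lexx orbT.
    rewrite ler_pdivlMr; last by rewrite /D; lra.
    by apply: le_trans; rewrite ler_pM2l// /D; lra.
  move=> /sqr_le_norm; rewrite exprMn sqr_sqrtr// sqr_norm2.
  by [].
exists k; split => //; apply/weak_partial_ip => phi tphi.
by rewrite -lk// /l opprK.
Qed.

Lemma wpartialP u i : H1 u -> (wpartial i u : T3 -> R) \in L2s /\ weak_partial i u (wpartial i u).
Proof.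
by move=> [_ /(_ i) ex]; have := xgetPex (cst 0) ex.
Qed.

Lemma ip_wpartial_unique u i g : H1 u -> (g : T3 -> R) \in L2s -> weak_partial i u g ->
  ip mu (wpartial i u) (wpartial i u) = ip mu g g.
Proof.
move=> H1u g2 ug; have [w2 uw] := wpartialP i H1u.
apply: dbr_ip => // phi tphi; apply: oppr_inj.
by rewrite -(weak_partial_ip u _ i).1// -(weak_partial_ip u _ i).1.
Qed.

Lemma H1_shift_le u i h : H1 u -> 0 <= h ->
  ip mu (fun x => u (x + h *: e_ i) - u x) (fun x => u (x + h *: e_ i) - u x)
  <= h ^+ 2 * ip mu (wpartial i u) (wpartial i u).
Proof. by move=> Hu h0; have [w2 uw] := wpartialP i Hu; apply: weak_partial_shift_le => //; exact: Hu.1. Qed.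

Lemma H1_of_shift u (C : 'I_3 -> R) : (u : T3 -> R) \in L2s -> (forall i, 0 <= C i) ->
    (forall i h, 0 < h <= 1 ->
      ip mu (fun x => u (x + h *: e_ i) - u x) (fun x => u (x + h *: e_ i) - u x) <= C i * h ^+ 2) ->
  H1 u /\ forall i, ip mu (wpartial i u) (wpartial i u) <= C i.
Proof.
move=> u2 C0 uC.
have H i := weak_partial_of_shift u2 (C0 i) (uC i).
have Hu : H1 u by split => // i; have [g [g2 ug _]] := H i; exists g.
split => // i; have [g [g2 ug gC]] := H i.
by rewrite (ip_wpartial_unique Hu g2 ug).
Qed.

End WeakDerivatives.

(** * H^1 is contained in L^4 *)

Section WeakTypeBounds.
Variable R : realType.
Local Notation T1 := (measurableTypeR R).
Local Notation T3 := (T1 * T1 * T1)%type.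
Local Notation e_ i := (basis3 R i).
Local Notation mu := (leb3 R).
Local Notation L2s := (Lfun mu 2%:E).
Implicit Types (u v w g : R3 R -> R) (a : R3 R).

Definition cube (r : R) : set T3 := hbox (- r, - r, - r) (r, r, r).

Lemma leb3_hbox_side a r : 0 <= r ->
  leb3 R (hbox a (a + (r, r, r))) = (r ^+ 3)%:E.
Proof.
move=> r0; rewrite /hbox leb3_setX; [|exact: measurable_itv..].
rewrite !lebesgue_measure_itv/= !lte_fin !ltrDl.
move: r0; rewrite le_eqVlt => /predU1P[<-|r0].
  by rewrite ltxx mul0e mul0e expr0n.
by rewrite r0 -!EFinB -!EFinM; congr EFin; ring.
Qed.

Lemma leb3_cube r : 0 <= r -> leb3 R (cube r) = (8 * r ^+ 3)%:E.
Proof.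
move=> r0; rewrite (_ : cube r = hbox (- r, - r, - r) ((- r, - r, - r) + (2 * r, 2 * r, 2 * r))).
  by rewrite leb3_hbox_side ?mulr_ge0//; congr EFin; ring.
have H : - r + 2 * r = r by ring.
by rewrite (_ : (- r, - r, - r) + _ = (- r + 2 * r, - r + 2 * r, - r + 2 * r))// H.
Qed.

(** Where [2^k < f <= 2^(k+1)], the fourth power is at most [16^(k+1)], so the hypothesis, a weak
    L^6 bound on dyadic levels, leaves a geometric series of ratio 1/4. It serves both for functions
    in H^1 and for the inverse square of the distance. *)
Lemma layer_cake_quartic (D : set T3) (f : T3 -> R) (B : R) :
    measurable D -> measurable_fun setT f -> 0 <= B ->
    (forall k, (mu (D `&` [set x | (2 ^+ k < f x)%R]) <= (B * 64^-1 ^+ k)%:E)%E) ->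
  (\int[mu]_(x in D `&` [set x | (1 < f x)%R]) (f x ^+ 4)%:E < +oo)%E.
Proof.
move=> mD mf B0 H.
have mlev (c : R) : measurable (D `&` [set x | c < f x]).
  apply: measurableI => //.
  have := measurable_fun_ltr (measurable_cst c) mf measurableT (Y := [set true]).
  by rewrite setTI; apply.
pose s k x : \bar R := (16 ^+ k.+1 * \1_(D `&` [set x | 2 ^+ k < f x]) x)%:E.
have s0 k x : (0 <= s k x)%E by rewrite lee_fin mulr_ge0 ?exprn_ge0// indicE; case: (_ \in _).
have ms k : measurable_fun setT (s k).
  by apply/measurable_EFinP/measurable_funM => //; exact: measurable_indic.
have : (\int[mu]_x (\sum_(k <oo) s k x) <= (32 * B)%:E)%E.
  rewrite integral_nneseries//.
  apply: lime_le; first by apply: is_cvg_nneseries => n _ _; exact: integral_ge0.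
  apply: nearW => n.
  (* The bound grows by [24 * B * 4^-n] at each step, which covers the term, at most
     [16 * B * 4^-n]. *)
  suff : (\sum_(0 <= k < n) \int[mu]_x s k x <= (32 * B - 32 * B * (4^-1) ^+ n)%:E)%E.
    by move=> /le_trans; apply; rewrite lee_fin gerBl !mulr_ge0// exprn_ge0.
  elim: n => [|n IH]; first by rewrite big_geq// expr0 mulr1 subrr.
  rewrite big_nat_recr//=.
  have ->: ((32 * B - 32 * B * 4^-1 ^+ n.+1)%:E =
      (32 * B - 32 * B * 4^-1 ^+ n)%:E + (24 * B * (4^-1) ^+ n)%:E :> \bar R)%E.
    by rewrite -EFinD exprS; congr EFin; field.
  apply: leeD => //.
  under eq_integral do rewrite /s EFinM.
  rewrite ge0_integralZl_EFin ?exprn_ge0//; last exact/measurable_EFinP/measurable_indic.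
  rewrite integral_indic// setIT.
  apply: le_trans (lee_wpmul2l _ (H n)) _; first by rewrite lee_fin exprn_ge0.
  have E : 16 ^+ n * 64^-1 ^+ n = 4^-1 ^+ n :> R by rewrite -exprMn; congr (_ ^+ _); field.
  rewrite -EFinM lee_fin exprS (_ : 16 * _ * _ = 16 * B * (16 ^+ n * 64^-1 ^+ n)); last by ring.
  by rewrite E ler_wpM2r ?exprn_ge0// ler_wpM2r// ler_nat.
move=> iS; apply: (@le_lt_trans _ _ (32 * B)%:E); last by rewrite ltry.
apply: le_trans iS.
have mf1 : measurable (D `&` [set x | 1 < f x]) by exact: mlev.
have f4 : measurable_fun setT (fun x => (f x ^+ 4)%:E) by exact/measurable_EFinP/measurable_funX.
have mS : measurable_fun setT (fun x => \sum_(k <oo) s k x)%E by apply: ge0_emeasurable_sum.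
apply: (@le_trans _ _ (\int[mu]_(x in D `&` [set x | (1 < f x)%R]) (\sum_(k <oo) s k x))%E); last first.
  by apply: ge0_subset_integral => // x _; exact: nneseries_ge0.
apply: ge0_le_integral => //.
- by move=> x [_ /= f1]; rewrite lee_fin exprn_ge0// ltW// (lt_trans ltr01).
- exact: measurable_funTS.
- exact: measurable_funTS.
move=> x [Dx /= f1].
have ex : exists k, f x <= 2 ^+ k.+1.
  exists (Num.bound (f x)); have f0 := le_trans ler01 (ltW f1).
  apply: le_trans (ltW (archi_boundP f0)) _.
  by rewrite -natrX ler_nat ltnW// (ltn_trans (ltnSn _))// ltn_expl.
have [k fk kmin] := ex_minnP ex.
have kf : 2 ^+ k < f x.
  case: k fk kmin => [|k] fk kmin; first by rewrite expr0.
  by rewrite ltNge; apply/negP => /kmin; rewrite ltnn.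
apply: le_trans (nneseries_lim_ge k.+1 _) => [|j _ _]; last exact: s0.
rewrite big_nat_recr//=; apply: le_trans (leeDr _ _); last exact: sume_ge0.
rewrite /s lee_fin indicE mem_set// mulr1.
have -> : 16 ^+ k.+1 = (2 ^+ k.+1) ^+ 4 :> R.
  by rewrite -exprM mulnC exprM; congr (_ ^+ _); ring.
by rewrite lerXn2r ?nnegrE ?exprn_ge0// ltW// (lt_trans ltr01).
Qed.

Lemma norm2D u v : (u : T3 -> R) \in L2s -> (v : T3 -> R) \in L2s ->
  norm2 mu (fun x => u x + v x) <= norm2 mu u + norm2 mu v.
Proof.
move=> u2 v2; apply: norm2_le; first by rewrite addr_ge0 ?norm2_ge0.
have E1 := ipDl u2 v2 (Lfun2D u2 v2); have E2 := ipDr u2 v2 u2; have E3 := ipDr u2 v2 v2.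
have E4 := ipC mu v u; rewrite E1 E2 E3 E4.
rewrite sqrrD !sqr_norm2; have := cauchy_schwarz_norm u2 v2.
by rewrite ler_norml => /andP[_]; lra.
Qed.

Lemma R3_basis (x : R3 R) : x = x.1.1 *: e_ (@Ordinal 3 0 isT) +
  x.1.2 *: e_ (@Ordinal 3 1 isT) + x.2 *: e_ (@Ordinal 3 2 isT).
Proof.
case: x => [[x1 x2] x3]; rewrite /basis3 /=.
have E (a b c a' b' c' : R) : ((a, b, c) : R3 R) + (a', b', c') = (a + a', b + b', c + c') by [].
have Z (t a b c : R) : t *: ((a, b, c) : R3 R) = (t * a, t * b, t * c) by [].
by rewrite !Z !E !mulr1 !mulr0 !addr0 !add0r.
Qed.

(** Go from [x] to [x + xi] along the three axes: each leg costs at most [r * sqrt G] in norm, hence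
    the factor 9 after squaring. *)
Lemma shift_sub_cube u G r (xi : R3 R) : (u : T3 -> R) \in L2s -> 0 <= G -> 0 <= r ->
    (forall i h, 0 <= h ->
      ip mu (fun x => u (x + h *: e_ i) - u x) (fun x => u (x + h *: e_ i) - u x) <= h ^+ 2 * G) ->
    (forall j, 0 <= coord j xi <= r) ->
  ip mu (fun x => u (x + xi) - u x) (fun x => u (x + xi) - u x) <= 9 * r ^+ 2 * G.
Proof.
move=> u2 G0 r0 uG xir.
pose i0 := @Ordinal 3 0 isT; pose i1 := @Ordinal 3 1 isT; pose i2 := @Ordinal 3 2 isT.
pose D a (b : R3 R) := fun x : R3 R => u (x + a + b) - u (x + a).
have D2 a b : (D a b : T3 -> R) \in L2s.
  apply: Lfun2B; last exact: Lfun2_shift.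
  rewrite /D; under eq_fun do rewrite -addrA.
  exact: (Lfun2_shift (a + b) u2).
have Dn a i h : 0 <= h <= r -> norm2 mu (D a (h *: e_ i)) <= r * Num.sqrt G.
  move=> /andP[h0 hr]; have rs0 : 0 <= r * Num.sqrt G by rewrite mulr_ge0 ?sqrtr_ge0.
  apply: norm2_le => //.
  have E : ip mu (D a (h *: e_ i)) (D a (h *: e_ i)) =
      ip mu (fun x => u (x + h *: e_ i) - u x) (fun x => u (x + h *: e_ i) - u x).
    have d2 : ((fun x => u (x + h *: e_ i) - u x) : T3 -> R) \in L2s.
      by apply: Lfun2B => //; exact: Lfun2_shift.
    rewrite -(ip_shift a d2 d2).
    by apply: eq_ip => x; rewrite /D.
  rewrite E; apply: le_trans (uG i h h0) _; rewrite exprMn sqr_sqrtr//.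
  by rewrite ler_wpM2r// lerXn2r ?nnegrE.
have xi0 : 0 <= xi.1.1 <= r := xir i0.
have xi1 : 0 <= xi.1.2 <= r := xir i1.
have xi2 : 0 <= xi.2 <= r := xir i2.
pose a1 := xi.1.1 *: e_ i0; pose a2 := xi.1.2 *: e_ i1; pose a3 := xi.2 *: e_ i2.
have n1 := Dn 0 i0 _ xi0; have n2 := Dn a1 i1 _ xi1; have n3 := Dn (a1 + a2) i2 _ xi2.
have F2 : ((fun x => D 0 a1 x + D a1 a2 x) : T3 -> R) \in L2s by apply: Lfun2D.
have tri : norm2 mu (fun x => u (x + xi) - u x) <= 3 * r * Num.sqrt G.
  have -> : (fun x : T3 => u ((x : R3 R) + xi) - u x) = fun x => D 0 a1 x + D a1 a2 x + D (a1 + a2) a3 x.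
    apply/funext => x; rewrite /D addr0 [in LHS](R3_basis xi) -/i0 -/i1 -/i2 -/a1 -/a2 -/a3 !addrA.
    by ring.
  apply: le_trans (norm2D F2 (D2 _ _)) _.
  apply: le_trans (lerD (norm2D (D2 _ _) (D2 _ _)) n3) _.
  apply: le_trans (lerD (lerD n1 n2) (lexx _)) _; lra.
rewrite -sqr_norm2.
have -> : 9 * r ^+ 2 * G = (3 * r * Num.sqrt G) ^+ 2 by rewrite !exprMn sqr_sqrtr//; ring.
by rewrite lerXn2r ?nnegrE ?norm2_ge0// !mulr_ge0 ?sqrtr_ge0.
Qed.

Lemma measurable_lt_set (f g : T3 -> R) : measurable_fun setT f -> measurable_fun setT g ->
  measurable [set x | f x < g x].
Proof.
move=> mf mg; have := measurable_fun_ltr mf mg measurableT (Y := [set true]).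
by rewrite setTI; apply.
Qed.

Lemma measurable_le_set (f g : T3 -> R) : measurable_fun setT f -> measurable_fun setT g ->
  measurable [set x | f x <= g x].
Proof.
move=> mf mg; have := measurable_fun_ler mf mg measurableT (Y := [set true]).
by rewrite setTI; apply.
Qed.

(* If [|u x| > 2 l] and [|u (x + xi)| <= l] then [(u (x + xi) - u x)^2 >= l^2].
   Averaging over [xi] in a cube of side [r], with [r^3] twice the measure of
   [|u| > l], bounds the measure of [|u| > 2 l] by a multiple of [r^2 / l^2]. *)
Lemma weak_type_sobolev u G : (u : T3 -> R) \in L2s -> 0 <= G ->
    (forall i h, 0 <= h ->
      ip mu (fun x => u (x + h *: e_ i) - u x) (fun x => u (x + h *: e_ i) - u x) <= h ^+ 2 * G) ->
  exists2 B, 0 <= B &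
    forall k, (mu [set x : T3 | (2 ^+ k < `|u x|)%R] <= (B * 64^-1 ^+ k)%:E)%E.
Proof.
move=> u2 G0 uG; have /Lfun2P[mu_ _] := u2.
pose m := ip mu u u; have m0 : 0 <= m := ip_ge0 _ _.
(* The part [2 * m + 1] gives the bound at [k = 0] by Chebyshev's inequality, and 2304 = 18 * 128
   closes the induction: 18 comes from the averaging, 128 from the factor 1/64 and the half in the
   bound. *)
pose rho := 2304 * G + 2 * m + 1.
have rho1 : 1 <= rho by rewrite /rho; lra.
have rho0 : 0 <= rho by lra.
pose lev k := [set x : T3 | 2 ^+ k < `|u x|].
have mabs : measurable_fun setT (fun x : T3 => `|u x|) by exact: measurableT_comp.
have mlev k : measurable (lev k) by apply: measurable_lt_set => //; exact: measurable_cst.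
exists (rho ^+ 3 / 2); first by rewrite divr_ge0// exprn_ge0.
elim=> [|k IH]; rewrite -/(lev _).
  rewrite expr0 mulr1.
  apply: (@le_trans _ _ m%:E); last first.
    rewrite lee_fin; have : rho * 1 <= rho * rho ^+ 2.
      by rewrite ler_wpM2l// expr_ge1.
    by rewrite -exprS /rho; lra.
  rewrite /m -(ip_sqrE u2) -[lev 0%N]setIT -integral_indic//.
  apply: ge0_le_integral => //.
  - exact/measurable_EFinP/measurable_indic.
  - exact/measurable_EFinP/measurable_funX.
  move=> x _; rewrite lee_fin indicE; have [|_] := boolP (x \in lev 0%N); last exact: sqr_ge0.
  rewrite inE /lev /= expr0 => x1; rewrite -[u x ^+ 2]real_normK ?num_real//.
  by rewrite expr_ge1// ltW.
pose r := rho * 4^-1 ^+ k.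
have r0 : 0 < r by rewrite mulr_gt0 ?exprn_gt0//; lra.
have r3 : r ^+ 3 = rho ^+ 3 * 64^-1 ^+ k.
  by rewrite exprMn -exprM mulnC exprM; congr (_ * _ ^+ _); field.
pose Q := hbox (0, 0, 0) ((0, 0, 0) + (r, r, r)).
have mQ : measurable Q by exact: measurable_hbox.
have muQ : mu Q = (r ^+ 3)%:E by rewrite leb3_hbox_side// ltW.
pose F (p : T3 * T3) : \bar R :=
  (\1_Q p.1 * (u ((p.2 : R3 R) + p.1) - u p.2) ^+ 2)%:E.
have mF : measurable_fun setT F.
  apply/measurable_EFinP/measurable_funM.
    exact: (measurableT_comp (measurable_indic mQ) measurable_fst).
  apply/measurable_funX/measurable_funB; last exact: (measurableT_comp mu_ measurable_snd).
  exact: (measurableT_comp mu_ (measurable_add3 measurable_snd measurable_fst)).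
have F0 p : (0 <= F p)%E by rewrite lee_fin mulr_ge0 ?sqr_ge0.
have upper : (\int[mu]_xi \int[mu]_x F (xi, x) <= (9 * r ^+ 2 * G * r ^+ 3)%:E)%E.
  rewrite EFinM -muQ -[Q]setIT -integral_indic// -ge0_integralZl_EFin//; last 2 first.
  - exact/measurable_EFinP/measurable_indic.
  - by rewrite !mulr_ge0 ?sqr_ge0.
  apply: ge0_le_integral => //.
  - by move=> xi _; exact: integral_ge0.
  - exact: measurable_integral3.
  - apply: measurable_funeM; exact/measurable_EFinP/measurable_indic.
  move=> xi _; rewrite /F /= indicE; have [xiQ|_] := boolP (xi \in Q); last first.
    by rewrite mule0; under eq_integral do rewrite mul0r; rewrite integral0.
  under eq_integral do rewrite mul1r.
  have d2 : ((fun x => u (x + xi) - u x) : T3 -> R) \in L2s.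
    by apply: Lfun2B => //; exact: Lfun2_shift.
  rewrite (ip_sqrE d2) mule1 lee_fin.
  apply: shift_sub_cube => //; first exact: ltW.
  move=> j; have /hboxP/(_ j) := set_mem xiQ; rewrite add0r.
  by rewrite !coord_diag => /andP[/ltW -> ->].
have lower : (((4 ^+ k * (r ^+ 3 / 2))%:E * mu (lev k.+1)) <= \int[mu]_xi \int[mu]_x F (xi, x))%E.
  rewrite tonelli3//= -[lev _]setIT -integral_indic// -ge0_integralZl_EFin//; last 2 first.
  - exact/measurable_EFinP/measurable_indic.
  - by rewrite !mulr_ge0 ?exprn_ge0 ?divr_ge0 ?exprn_ge0// ltW.
  apply: ge0_le_integral => //.
  - by move=> x _; rewrite -EFinM lee_fin mulr_ge0// !mulr_ge0 ?exprn_ge0// ltW.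
  - apply: measurable_funeM; exact/measurable_EFinP/measurable_indic.
  - have mF' : measurable_fun setT (F \o (fun p => (p.2, p.1))).
      by apply: measurableT_comp => //; exact: measurable_fun_pair.
    by apply: (@measurable_integral3 R _ _ (F \o (fun p => (p.2, p.1))) mF') => p; exact: F0.
  move=> x _; rewrite indicE; have [xA|_] := boolP (x \in lev k.+1); last first.
    by rewrite mule0; exact: integral_ge0.
  rewrite mule1.
  pose Z := [set xi : T3 | `|u ((x : R3 R) + xi)| <= 2 ^+ k].
  have mux : measurable_fun [set: T3] (fun xi : T3 => `|u ((x : R3 R) + xi)|).
    under eq_fun do rewrite addrC.
    exact: (measurable_comp_shift (x : R3 R) mabs).
  have mZ : measurable Z by apply: measurable_le_set => //; exact: measurable_cst.
  (* Outside [Z] the translate of [x] lands in [lev k], whose measure is by induction at most half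
     the volume of [Q]. So at least half of [Q] is in [Z]. *)
  have muZC : (mu (Q `\` Z) <= (r ^+ 3 / 2)%:E)%E.
    apply: (@le_trans _ _ (mu ((fun y : R3 R => y + x) @^-1` lev k))).
      apply: le_measure; rewrite ?inE.
      - exact: measurableD.
      - by rewrite -[X in measurable X]setTI; apply: measurable_shift3.
      - by move=> xi [_ /= /negP]; rewrite -ltNge addrC.
    by rewrite leb3_translation// r3 mulrAC.
  have muZ : ((r ^+ 3 / 2)%:E <= mu (Q `&` Z))%E.
    rewrite -(leeD2lE (x := (r ^+ 3 / 2)%:E))// -EFinD -splitr -muQ.
    by rewrite (measureDI mu mQ mZ); exact: leeD2r.
  apply: (@le_trans _ _ ((4 ^+ k)%:E * mu (Q `&` Z))%E).
    by rewrite EFinM; apply: lee_wpmul2l => //; rewrite lee_fin exprn_ge0.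
  rewrite -[Q `&` Z]setIT -integral_indic//; last exact: measurableI.
  have mQZ : measurable_fun setT (fun y : T3 => (\1_(Q `&` Z) y : R)%:E).
    exact/measurable_EFinP/measurable_indic/measurableI.
  rewrite -ge0_integralZl_EFin ?exprn_ge0//.
  apply: ge0_le_integral => //.
  - exact: measurable_funeM.
  - exact: (measurableT_comp mF (pair2_measurable x)).
  move=> xi _; rewrite /F /= -EFinM lee_fin indicI /=.
  rewrite mulrCA; apply: ler_wpM2l => //; rewrite indicE.
  have [|_] := boolP (xi \in Z); last by rewrite mulr0 sqr_ge0.
  rewrite inE /Z /= mulr1 => uz; move: xA; rewrite inE /lev /= exprS => ux.
  have -> : (4 : R) ^+ k = (2 ^+ k) ^+ 2 by rewrite -exprM mulnC exprM; congr (_ ^+ _); ring.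
  rewrite -[leRHS]real_normK ?num_real//; apply: sqr_le_norm.
  have p0 : 0 <= (2 : R) ^+ k by rewrite exprn_ge0.
  have := lerB_dist (u x) (u ((x : R3 R) + xi)); rewrite (ger0_norm p0) distrC; lra.
have levfin : mu (lev k.+1) \is a fin_num.
  rewrite ge0_fin_numE//; apply: le_lt_trans (ltry (rho ^+ 3 / 2 * 64^-1 ^+ k)).
  apply: le_trans IH; apply: le_measure; rewrite ?inE; [exact: mlev..|].
  move=> x; rewrite /lev /=; apply: le_lt_trans; rewrite exprS.
  by rewrite ler_peMl// ?exprn_ge0// ler1n.
have := le_trans lower upper; rewrite -(fineK levfin) -EFinM !lee_fin.
set al := fine _.
have r30 : 0 < r ^+ 3 by rewrite exprn_gt0.
pose q : R := 4^-1 ^+ k; have q0 : 0 < q by rewrite exprn_gt0.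
have q4 : 4 ^+ k * q = 1 by rewrite -exprMn divff// expr1n.
have q64 : q ^+ 3 = 64^-1 ^+ k.
  by rewrite -exprM mulnC exprM; congr (_ ^+ _); field.
have rE : r = rho * q by [].
have E1 : 4 ^+ k * (r ^+ 3 / 2) * al = r ^+ 3 * (4 ^+ k * al / 2) by ring.
have E2 : 9 * r ^+ 2 * G * r ^+ 3 = r ^+ 3 * (9 * r ^+ 2 * G) by ring.
rewrite E1 E2 ler_pM2l// => H.
have H2 : al <= 18 * r ^+ 2 * G * q.
  have -> : al = 4 ^+ k * al / 2 * (2 * q).
    by transitivity (4 ^+ k * q * al); [rewrite q4 mul1r|field].
  have -> : 18 * r ^+ 2 * G * q = 9 * r ^+ 2 * G * (2 * q) by ring.
  by rewrite ler_wpM2r// mulr_ge0// ltW.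
apply: le_trans H2 _; rewrite rE [_ ^+ k.+1]exprS -q64.
have -> : 18 * (rho * q) ^+ 2 * G * q = q ^+ 3 * (rho ^+ 2 * (18 * G)) by ring.
have -> : rho ^+ 3 / 2 * (64^-1 * q ^+ 3) = q ^+ 3 * (rho ^+ 2 * (rho / 128)) by field.
have q3 : 0 <= q ^+ 3 by rewrite exprn_ge0// ltW.
by apply: ler_wpM2l => //; apply: ler_wpM2l; rewrite ?sqr_ge0// /rho; lra.
Qed.

(** The dyadic levels control the set where [|u| > 1]; elsewhere [u^4 <= u^2]. *)
Lemma H1_quartic_lty u : H1 u -> (\int[mu]_x (u x ^+ 4)%:E < +oo)%E.
Proof.
move=> Hu; have u2 := Hu.1; have /Lfun2P[mu_ iu] := u2.
pose G := \sum_(i < 3) ip mu (wpartial i u) (wpartial i u).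
have G0 : 0 <= G by apply: sumr_ge0 => i _; exact: ip_ge0.
have [|B B0 HB] := weak_type_sobolev u2 G0.
  move=> i h h0; apply: le_trans (H1_shift_le i Hu h0) _.
  rewrite ler_wpM2l ?sqr_ge0// /G (bigD1 i)//= lerDl.
  by apply: sumr_ge0 => j _; exact: ip_ge0.
have mabs : measurable_fun setT (fun x : T3 => `|u x|) by exact: measurableT_comp.
have m4 : measurable_fun setT (fun x : T3 => (`|u x| ^+ 4)%:E).
  exact/measurable_EFinP/measurable_funX.
pose A : set T3 := [set x | 1 < `|u x|].
have large : (\int[mu]_(x in A) (`|u x| ^+ 4)%:E < +oo)%E.
  have {1}-> : A = setT `&` A by rewrite setTI.
  by apply: (layer_cake_quartic measurableT mabs B0) => k; rewrite setTI.
have mA : measurable A by apply: measurable_lt_set => //; exact: measurable_cst.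
have mu2 : measurable_fun setT (fun x : T3 => (u x ^+ 2)%:E).
  exact/measurable_EFinP/measurable_funX.
have E4 x : u x ^+ 4 = `|u x| ^+ 4 by rewrite -[4%N]/(2 * 2)%N !exprM real_normK ?num_real.
under eq_integral do rewrite E4.
rewrite -(setUv A) ge0_integral_setU//; last 3 first.
- exact: measurableC.
- exact: measurable_funTS.
- by rewrite disj_set2E setICr.
rewrite lte_add_pinfty//; apply: le_lt_trans iu.
apply: (@le_trans _ _ (\int[mu]_(x in ~` A) (u x ^+ 2)%:E)%E).
  apply: ge0_le_integral => //.
  - exact: measurableC.
  - exact: measurable_funTS.
  - exact: measurable_funTS.
  move=> x /= /negP; rewrite -leNgt => ux; rewrite lee_fin -[leRHS]real_normK ?num_real//.
  by rewrite ler_wiXn2l.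
apply: ge0_subset_integral => //; first exact: measurableC.
by move=> x _; rewrite lee_fin sqr_ge0.
Qed.

End WeakTypeBounds.

(** * The Coulomb kernel *)

Section CoulombKernel.
Variable R : realType.
Local Notation T1 := (measurableTypeR R).
Local Notation T3 := (T1 * T1 * T1)%type.
Local Notation mu := (leb3 R).
Implicit Types (x y a : R3 R).

Lemma measurable_fun_sqrt d (T : measurableType d) (f : T -> R) :
  measurable_fun setT f -> (forall t, 0 <= f t) -> measurable_fun setT (fun t => Num.sqrt (f t)).
Proof.
move=> mf f0; under eq_fun do rewrite -powR12_sqrt//.
exact: (measurableT_comp (measurable_powR _) mf).
Qed.

Lemma measurable_fun_inv d (T : measurableType d) (f : T -> R) :
  measurable_fun setT f -> (forall t, 0 <= f t) -> measurable_fun setT (fun t => (f t)^-1).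
Proof.
move=> mf f0; under eq_fun do rewrite -powR_inv1//.
exact: (measurableT_comp (measurable_powR _) mf).
Qed.

Lemma enorm_ge0 x : 0 <= enorm x. Proof. exact: sqrtr_ge0. Qed.

Lemma sqr_enorm x : enorm x ^+ 2 = x.1.1 ^+ 2 + x.1.2 ^+ 2 + x.2 ^+ 2.
Proof. by rewrite sqr_sqrtr// !addr_ge0 ?sqr_ge0. Qed.

Lemma enormN x : enorm (- x) = enorm x.
Proof. by rewrite /enorm /= !sqrrN. Qed.

Lemma enormB x y : enorm (x - y) = enorm (y - x).
Proof. by rewrite -enormN opprB. Qed.

Lemma enorm_triangle x y : enorm (x + y) <= enorm x + enorm y.
Proof.
rewrite -(@ler_pXn2r _ 2)// ?nnegrE ?addr_ge0 ?enorm_ge0// sqrrD !sqr_enorm /=.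
have cs : x.1.1 * y.1.1 + x.1.2 * y.1.2 + x.2 * y.2 <= enorm x * enorm y.
  apply: le_trans (ler_norm _) _.
  rewrite -(@ler_pXn2r _ 2)// ?nnegrE ?mulr_ge0 ?enorm_ge0// real_normK ?num_real//.
  rewrite exprMn !sqr_enorm -subr_ge0.
  rewrite (_ : _ - _ = (x.1.1 * y.1.2 - x.1.2 * y.1.1) ^+ 2 +
    (x.1.1 * y.2 - x.2 * y.1.1) ^+ 2 + (x.1.2 * y.2 - x.2 * y.1.2) ^+ 2); last by ring.
  by rewrite !addr_ge0 ?sqr_ge0.
move: cs; move: (enorm x * enorm y) => p; case: x y => [[x1 x2] x3] [[y1 y2] y3] /= cs.
rewrite -subr_ge0 (_ : _ - _ = 2 * (p - (x1 * y1 + x2 * y2 + x3 * y3))); last by ring.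
by rewrite mulr_ge0// subr_ge0.
Qed.

Lemma coord_le_enorm j x : `|coord j x| <= enorm x.
Proof.
rewrite -sqrtr_sqr; apply: ler_wsqrtr; rewrite /coord.
have := sqr_ge0 x.1.1; have := sqr_ge0 x.1.2; have := sqr_ge0 x.2.
by case: ifP => _; [|case: ifP => _]; lra.
Qed.

Lemma enorm_le_cube r x : 0 <= r -> (forall j, `|coord j x| <= r) -> enorm x <= 2 * r.
Proof.
move=> r0 H.
rewrite -(@ler_pXn2r _ 2)// ?nnegrE ?enorm_ge0 ?mulr_ge0// sqr_enorm.
have h1 := sqr_le_norm (H (@Ordinal 3 0 isT)).
have h2 := sqr_le_norm (H (@Ordinal 3 1 isT)).
have h3 := sqr_le_norm (H (@Ordinal 3 2 isT)).
move: h1 h2 h3 (sqr_ge0 r); rewrite /coord /= exprMn; lra.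
Qed.

Lemma measurable_enorm : measurable_fun [set: T3] (fun x : T3 => enorm x).
Proof.
apply: measurable_fun_sqrt => [|x]; last by rewrite !addr_ge0 ?sqr_ge0.
by apply: measurable_funD; [apply: measurable_funD|]; apply: measurable_funX;
  [exact: mcoord1|exact: mcoord2|exact: mcoord3].
Qed.

Lemma measurable_ker : measurable_fun [set: T3] (fun x : T3 => (enorm x)^-1).
Proof. by apply: measurable_fun_inv => [|x]; [exact: measurable_enorm|exact: enorm_ge0]. Qed.

Lemma ker_ge0 x : 0 <= (enorm x)^-1. Proof. by rewrite invr_ge0 enorm_ge0. Qed.

Lemma enorm_eq0 x : enorm x = 0 -> x = 0.
Proof.
move=> x0; have c j : coord j x = 0.
  by apply/eqP; rewrite -normr_le0 -x0 coord_le_enorm.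
case: x x0 c => [[x1 x2] x3] _ c.
by rewrite (c (@Ordinal 3 0 isT) : x1 = 0) (c (@Ordinal 3 1 isT) : x2 = 0) (c (@Ordinal 3 2 isT) : x3 = 0).
Qed.

Lemma leb3_set1 (a : T3) : mu [set a] = 0%E.
Proof.
rewrite (_ : [set a] = ([set a.1.1] `*` [set a.1.2]) `*` [set a.2]).
  by rewrite leb3_setX// lebesgue_measure_set1 !mul0e.
apply/seteqP; split => [x -> //|[[x1 x2] x3] [[/= -> ->] ->]].
by case: a => [[]].
Qed.

Lemma ae_neq (a : T3) : {ae mu, forall x : T3, x <> a}.
Proof.
exists [set a]; split; [|exact: leb3_set1|].
  rewrite (_ : [set a] = ([set a.1.1] `*` [set a.1.2]) `*` [set a.2]).
    by apply: measurableX; [apply: measurableX|]; exact: measurable_set1.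
  apply/seteqP; split => [x -> //|[[x1 x2] x3] [[/= -> ->] ->]].
  by case: a => [[]].
by move=> x /= /contrapT.
Qed.

Lemma cube_enorm r x : enorm x < r -> cube r x.
Proof.
move=> xr; apply/hboxP => j; have := le_lt_trans (coord_le_enorm j x) xr.
by rewrite !coord_diag ltr_norml => /andP[-> /ltW].
Qed.

Lemma enorm_cube r x : 0 <= r -> cube r x -> enorm x <= 2 * r.
Proof.
move=> r0 /hboxP xr; apply: enorm_le_cube => // j; have := xr j.
by rewrite !coord_diag ler_norml => /andP[/ltW -> ->].
Qed.


(** The square of the kernel on the unit ball, where it is singular; it is integrable in dimension
    three. *)
Definition kappa x : R := if 1 < (enorm x)^-1 then (enorm x)^-1 ^+ 2 else 0.

Lemma kappa_ge0 x : 0 <= kappa x. Proof. by rewrite /kappa; case: ifP => // _; exact: sqr_ge0. Qed.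

Lemma ker_le_kappa x : (enorm x)^-1 <= 1 + kappa x.
Proof.
rewrite /kappa; case: ifP => [k1|/negbT]; last by rewrite -leNgt addr0.
by rewrite expr2; nra.
Qed.

(** Off the unit ball the kernel is at most 1; inside, the product is at most the sum of the
    squares. With [h = u^2] the right-hand side is integrable for [u] in L^2 and L^4, uniformly in
    the position of the singularity. *)
Lemma mul_ker_le (h : R) x : 0 <= h -> h / enorm x <= h + h ^+ 2 + kappa x.
Proof.
move=> h0; rewrite /kappa; case: ifP => [k1|/negbT].
  by move: (enorm x)^-1 k1 => k k1; have := sqr_ge0 (h - k); have := sqr_ge0 h; rewrite sqrrB; nra.
by rewrite -leNgt addr0 => k1; have := ler_wpM2l h0 k1; have := sqr_ge0 h; lra.
Qed.

Lemma measurable_kappa : measurable_fun [set: T3] (fun x : T3 => kappa x).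
Proof.
apply: measurable_fun_ifT; [|exact: measurable_funX measurable_ker|exact: measurable_cst].
exact: measurable_fun_ltr (measurable_cst _) measurable_ker.
Qed.

(** [kappa] is the fourth power of [f], the inverse square root of the distance, where [f > 1]. The
    level [f > 2^k] lies in a cube of half-side [4^-k], of volume [8 * 64^-k], as the layer cake
    argument requires. *)
Lemma integral_kappa_lty : (\int[mu]_x (kappa x)%:E < +oo)%E.
Proof.
pose f (x : T3) := Num.sqrt (enorm x)^-1.
have mf : measurable_fun setT f.
  by apply: measurable_fun_sqrt => [|x]; [exact: measurable_ker|exact: ker_ge0].
have /(layer_cake_quartic measurableT mf (ler0n _ 8)) : forall k,
    (mu (setT `&` [set x | (2 ^+ k < f x)%R]) <= (8 * 64^-1 ^+ k)%:E)%E.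
  move=> k; rewrite setTI.
  have -> : (64^-1 : R) ^+ k = (4^-1 ^+ k) ^+ 3.
    by rewrite -exprM mulnC exprM; congr (_ ^+ _); field.
  have q0 : 0 < (4^-1 : R) ^+ k by rewrite exprn_gt0.
  rewrite -leb3_cube ?(ltW q0)//; apply: le_measure; rewrite ?inE.
  - by apply: measurable_lt_set => //; exact: measurable_cst.
  - exact: measurable_hbox.
  move=> x /=; rewrite /f => fx; apply: cube_enorm.
  have : (2 ^+ k) ^+ 2 < (enorm x)^-1.
    rewrite -[ltRHS]sqr_sqrtr ?ker_ge0//.
    by rewrite ltrXn2r// ?nnegrE ?sqrtr_ge0 ?exprn_ge0.
  have -> : ((2 : R) ^+ k) ^+ 2 = 4 ^+ k by rewrite -exprM mulnC exprM; congr (_ ^+ _); ring.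
  move=> H; have k0 : 0 < (enorm x)^-1 by apply: le_lt_trans H; rewrite exprn_ge0.
  by rewrite exprVn -[ltLHS]invrK ltf_pV2// posrE// exprn_gt0.
rewrite setTI integral_mkcond; apply: le_lt_trans.
apply: ge0_le_integral => //.
- by move=> x _; rewrite lee_fin kappa_ge0.
- by apply/measurable_EFinP; exact: measurable_kappa.
- apply/(measurable_restrictT _ _).1 => //.
  + by apply: measurable_lt_set => //; exact: measurable_cst.
  + by apply: measurable_funTS; apply/measurable_EFinP; exact: measurable_funX.
move=> x _; rewrite patchE /kappa; case: ifPn => [k1|_]; last first.
  by case: ifP => //; rewrite lee_fin exprn_ge0// sqrtr_ge0.
have s4 : f x ^+ 4 = (enorm x)^-1 ^+ 2 by rewrite -[4%N]/(2 * 2)%N exprM sqr_sqrtr ?ker_ge0.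
rewrite ifT ?s4// inE /= -(@ltr_pXn2r _ 4)// ?nnegrE ?sqrtr_ge0// s4 expr1n.
by rewrite -(expr1n _ 2) ltrXn2r// nnegrE ker_ge0.
Qed.

End CoulombKernel.

(** * The averaging weight and its Coulomb potential *)

Section WeightedKernel.
Variable R : realType.
Local Notation T1 := (measurableTypeR R).
Local Notation T3 := (T1 * T1 * T1)%type.
Local Notation mu := (leb3 R).
Local Notation ball_ r := [set x : T3 | (enorm (x : R3 R) < r)%R].
Local Notation kerE := (fun x : T3 => ((enorm (x : R3 R))^-1)%:E).
Implicit Types (x y xi : R3 R).

Lemma lebesgue_measure_opp (A : set T1) : measurable A ->
  lebesgue_measure ((fun x : R => - x) @^-1` A) = lebesgue_measure A.
Proof.
move=> mA.
have mo : measurable_fun [set: T1] (fun x : T1 => - (x : R) : T1).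
  exact: (measurable_funN (@measurable_id _ R setT)).
pose m' := pushforward (@lebesgue_measure R) (fun x : T1 => - (x : R) : T1).
apply/esym; apply: (@lebesgue_measure_unique _ m') => // _ [[x y]] _ <-.
have E : (fun z : R => - z) @^-1` `]x, y]%classic = `[- y, - x[%classic.
  by apply/seteqP; split => z /=; rewrite !in_itv/= lerNl ltrNr andbC.
transitivity (lebesgue_measure `[- y, - x[%classic); last by rewrite -E.
rewrite !lebesgue_measure_itv/= !lte_fin ltrN2.
by case: ifPn => // _; rewrite -!EFinD; congr EFin; ring.
Qed.

Lemma leb3_opp (A : set T3) : measurable A -> mu ((fun x : R3 R => - x) @^-1` A) = mu A.
Proof.
move=> mA.
have mo : measurable_fun [set: T1] (fun x : T1 => - (x : R) : T1).
  exact: (measurable_funN (@measurable_id _ R setT)).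
rewrite -[RHS](@product_measure1_preserving R _ _ (T1 * T1)%type T1 (sleb2 R) (@lebesgue_measure R)
  (fun p => (- p.1, - p.2)) (fun t => - t))//.
- apply/measurable_fun_pairP; split; first exact: (measurableT_comp mo measurable_fst).
  exact: (measurableT_comp mo measurable_snd).
- apply: (@product_measure1_preserving R _ _ T1 T1 lebesgue_measure lebesgue_measure
    (fun t => - t) (fun t => - t)) => //; exact: lebesgue_measure_opp.
- exact: lebesgue_measure_opp.
Qed.

Lemma ge0_integral_opp (f : T3 -> \bar R) : measurable_fun setT f -> (forall x, 0 <= f x)%E ->
  (\int[mu]_x f (- (x : R3 R))%R = \int[mu]_x f x)%E.
Proof.
move=> mf f0; have mo := measurable_opp3 (@measurable_id _ T3 setT).
have := @ge0_integral_pushforward _ _ T3 T3 R _ mo mu setT f measurableT mf (in1W f0).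
rewrite preimage_setT => <-.
by apply: eq_measure_integral => A mA _; exact: leb3_opp.
Qed.

Lemma integral_ker_ball_lty (A : R) :
  (\int[mu]_(x in (ball_ A)) ((enorm (x : R3 R))^-1)%:E < +oo)%E.
Proof.
have mball (r : R) : measurable (ball_ r).
  by apply: measurable_lt_set; [exact: measurable_enorm|exact: measurable_cst].
apply: (@le_lt_trans _ _ (\int[mu]_(x in (ball_ A)) (1%:E + (kappa x)%:E))%E).
  apply: ge0_le_integral => //.
  - by move=> x _; rewrite lee_fin ker_ge0.
  - by apply: measurable_funTS; apply/measurable_EFinP; exact: measurable_ker.
  - apply: measurable_funTS; apply: emeasurable_funD => //.
    by apply/measurable_EFinP; exact: measurable_kappa.
  by move=> x _; rewrite -EFinD lee_fin; exact: ker_le_kappa.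
rewrite ge0_integralD//; last 2 first.
- by move=> x _; rewrite lee_fin kappa_ge0.
- by apply: measurable_funTS; apply/measurable_EFinP; exact: measurable_kappa.
rewrite lte_add_pinfty//.
  rewrite integral_cst// mul1e; have [A0|A0] := leP 0 A; last first.
    rewrite (_ : (ball_ A) = set0) ?measure0//.
    apply/seteqP; split => // x /= xA; have := lt_trans xA A0.
    by rewrite ltNge enorm_ge0.
  apply: (@le_lt_trans _ _ (mu (cube A))); last by rewrite leb3_cube// ltry.
  by apply: le_measure; rewrite ?inE//; [exact: measurable_hbox|move=> x; exact: cube_enorm].
apply: le_lt_trans (integral_kappa_lty R); apply: ge0_subset_integral => //.
- by apply/measurable_EFinP; exact: measurable_kappa.
- by move=> x _; rewrite lee_fin kappa_ge0.
Qed.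

(* The averaging weight at the length scale [n]. Being Lipschitz, it compares
   with its translates without any estimate on the volume of thin shells. *)
Definition tent (n : R) x : R := Num.max 0 (1 - enorm x / n).

Lemma tent_ge0 n x : 0 <= tent n x. Proof. by rewrite le_max lexx. Qed.

Lemma tent_le1 n x : 0 <= n -> tent n x <= 1.
Proof. by move=> n0; rewrite ge_max ler01 gerBl divr_ge0 ?enorm_ge0. Qed.

Lemma measurable_tent n : measurable_fun [set: T3] (fun x : T3 => tent n x).
Proof.
apply: measurable_maxr => //; apply: measurable_funB => //.
by apply: measurable_funM => //; exact: measurable_enorm.
Qed.

Lemma tent_outside n x : 0 < n -> n <= enorm x -> tent n x = 0.
Proof. by move=> n0 nx; apply/max_idPl; rewrite subr_le0 ler_pdivlMr// mul1r. Qed.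

Lemma tentN n x : tent n (- x) = tent n x. Proof. by rewrite /tent enormN. Qed.

Lemma tent_mono n x y : 0 < n -> enorm x <= enorm y -> tent n y <= tent n x.
Proof.
move=> n0 xy; rewrite /tent ge_max le_max lexx /= le_max; apply/orP; right.
by rewrite lerD2l lerN2 ler_wpM2r// invr_ge0 ltW.
Qed.

Lemma tent_shift n x xi : 0 < n -> tent n x - enorm xi / n <= tent n (x + xi).
Proof.
move=> n0; rewrite lerBlDr {1}/tent ge_max; apply/andP; split.
  by rewrite addr_ge0 ?tent_ge0// divr_ge0 ?enorm_ge0// ltW.
rewrite -lerBlDr /tent le_max; apply/orP; right.
rewrite -addrA -opprD lerD2l lerN2 -mulrDl.
by rewrite ler_wpM2r ?invr_ge0 ?(ltW n0)// enorm_triangle.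
Qed.

Lemma measurable_ker_sub xi : measurable_fun [set: T3] (fun y : T3 => (enorm (xi - (y : R3 R)))^-1).
Proof.
have -> : (fun y : T3 => (enorm (xi - (y : R3 R)))^-1) = (fun y : T3 => (enorm ((y : R3 R) - xi))^-1).
  by apply/funext => y; rewrite enormB.
have := measurable_comp_shift (- xi) (measurable_ker (R := R)); exact.
Qed.

Definition tent_pot n xi : \bar R := (\int[mu]_y (tent n y / enorm (xi - y))%:E)%E.

Lemma measurable_tent_ker n : measurable_fun [set: T3] (fun y : T3 => (tent n y / enorm (y : R3 R))%:E).
Proof.
apply/measurable_EFinP; apply: measurable_funM; [exact: measurable_tent|exact: measurable_ker].
Qed.

Lemma tent_ker_ge0 n x y : (0 <= (tent n x / enorm y)%:E)%E.
Proof. by rewrite lee_fin mulr_ge0 ?tent_ge0 ?ker_ge0. Qed.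

Lemma tent_potE n xi : tent_pot n xi = (\int[mu]_y (tent n ((y : R3 R) + xi) / enorm (y : R3 R))%:E)%E.
Proof.
rewrite /tent_pot -(ge0_integral_shift xi).
- by apply: eq_integral => y _; rewrite opprD addrCA subrr addr0 enormN.
- apply/measurable_EFinP; apply: measurable_funM; first exact: measurable_tent.
  exact: measurable_ker_sub.
- by move=> y; exact: tent_ker_ge0.
Qed.


Lemma tent_potN n xi : tent_pot n (- xi) = tent_pot n xi.
Proof.
rewrite [RHS]tent_potE tent_potE.
rewrite -(@ge0_integral_opp (fun y : T3 => (tent n ((y : R3 R) + xi) / enorm (y : R3 R))%:E)).
- by apply: eq_integral => y _; rewrite enormN -tentN opprD opprK.
- apply/measurable_EFinP; apply: measurable_funM; last exact: measurable_ker.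
  exact: (measurable_comp_shift xi (measurable_tent n)).
- by move=> y; exact: tent_ker_ge0.
Qed.

Definition ball_pot (r : R) : \bar R :=
  (\int[mu]_(x in (ball_ r)) ((enorm (x : R3 R))^-1)%:E)%E.

Lemma ball_pot_ge0 r : (0 <= ball_pot r)%E.
Proof. by apply: integral_ge0 => x _; rewrite lee_fin ker_ge0. Qed.

Lemma ball_pot_fin r : ball_pot r \is a fin_num.
Proof. by rewrite ge0_fin_numE ?ball_pot_ge0//; exact: integral_ker_ball_lty. Qed.

Lemma measurable_eball (r : R) : measurable (ball_ r).
Proof. by apply: measurable_lt_set; [exact: measurable_enorm|exact: measurable_cst]. Qed.

Lemma measurable_ker_restrict (r : R) : measurable_fun [set: T3]
  (kerE \_ (ball_ r)).
Proof.
apply: (measurable_restrictT kerE (measurable_eball r)).1.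
by apply: measurable_funTS; apply/measurable_EFinP; exact: measurable_ker.
Qed.

Lemma ker_restrict_ge0 (r : R) x :
  (0 <= (kerE \_ (ball_ r)) x)%E.
Proof. by rewrite patchE; case: ifP => // _; rewrite lee_fin ker_ge0. Qed.

Lemma ball_potE (r : R) : ball_pot r = (\int[mu]_x
  (kerE \_ (ball_ r)) x)%E.
Proof. exact: integral_mkcond. Qed.

Lemma tent_pot0 n : tent_pot n 0 = (\int[mu]_y (tent n y / enorm (y : R3 R))%:E)%E.
Proof. by rewrite tent_potE; apply: eq_integral => y _; rewrite addr0. Qed.

Lemma tent_pot0_le n : 0 < n -> (tent_pot n 0%R <= ball_pot n)%E.
Proof.
move=> n0; rewrite tent_pot0 ball_potE.
apply: ge0_le_integral => //.
- by move=> x _; exact: tent_ker_ge0.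
- exact: measurable_tent_ker.
- exact: measurable_ker_restrict.
move=> x _; rewrite patchE; case: ifPn => [_|].
  by rewrite lee_fin ler_piMl ?ker_ge0// tent_le1// ltW.
by rewrite notin_setE /= => /negP; rewrite -leNgt => nx; rewrite (tent_outside n0 nx) mul0r.
Qed.

Lemma tent_pot0_fin n : 0 < n -> tent_pot n 0 \is a fin_num.
Proof.
move=> n0; rewrite ge0_fin_numE; first exact: le_lt_trans (tent_pot0_le n0) (integral_ker_ball_lty n).
by apply: integral_ge0 => x _; exact: tent_ker_ge0.
Qed.

(* Both factors are nonincreasing functions of the Euclidean norm, so
   [(tent (y + xi) - tent y) (1/|y + xi| - 1/|y|) >= 0] off the singularities. *)
Lemma tent_pot_le n xi : 0 < n -> (tent_pot n xi <= tent_pot n 0%R)%E.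
Proof.
move=> n0.
have mt (a b : R3 R) : measurable_fun [set: T3]
    (fun y : T3 => (tent n ((y : R3 R) + a) / enorm ((y : R3 R) + b))%:E).
  apply/measurable_EFinP; apply: measurable_funM.
    exact: (measurable_comp_shift a (measurable_tent n)).
  by have := measurable_comp_shift b (@measurable_ker R).
have mt' (p q c d : R3 R) : measurable_fun [set: T3]
    (fun y : T3 => (tent n ((y : R3 R) + p) / enorm ((y : R3 R) + q))%:E +
                   (tent n ((y : R3 R) + c) / enorm ((y : R3 R) + d))%:E)%E.
  by apply: emeasurable_funD; exact: mt.
(* Each of the two potentials is written in two ways, so that twice their difference is the integral
   of the product of differences. *)
have E1 : tent_pot n xi = (\int[mu]_y (tent n ((y : R3 R) + xi) / enorm ((y : R3 R) + 0))%:E)%E.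
  by rewrite tent_potE; apply: eq_integral => y _; rewrite addr0.
have E2 : tent_pot n xi = (\int[mu]_y (tent n ((y : R3 R) + 0) / enorm ((y : R3 R) + xi))%:E)%E.
  by rewrite -tent_potN /tent_pot; apply: eq_integral => y _; rewrite addr0 -opprD enormN addrC.
have E3 : tent_pot n 0 = (\int[mu]_y (tent n ((y : R3 R) + xi) / enorm ((y : R3 R) + xi))%:E)%E.
  by rewrite tent_pot0 -(ge0_integral_shift xi (measurable_tent_ker n))// => y; exact: tent_ker_ge0.
have E4 : tent_pot n 0 = (\int[mu]_y (tent n ((y : R3 R) + 0) / enorm ((y : R3 R) + 0))%:E)%E.
  by rewrite tent_pot0; apply: eq_integral => y _; rewrite addr0.
have : (tent_pot n xi + tent_pot n xi <= tent_pot n 0%R + tent_pot n 0%R)%E.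
  rewrite {1}E1 E2 {1}E3 E4 -!ge0_integralD//; try by move=> y _; exact: tent_ker_ge0.
  apply: ae_ge0_le_integral => //.
  - by move=> y _; rewrite adde_ge0 ?tent_ker_ge0.
  - by move=> y _; rewrite adde_ge0 ?tent_ker_ge0.
  apply: filterS2 (ae_neq (0 : R3 R)) (ae_neq (- xi)) => y y0 yxi _.
  rewrite -!EFinD lee_fin !addr0.
  have p0 : 0 < enorm y by rewrite lt_neqAle enorm_ge0 andbT eq_sym; apply/eqP => /enorm_eq0.
  have p1 : 0 < enorm (y + xi).
    rewrite lt_neqAle enorm_ge0 andbT eq_sym; apply/eqP => /enorm_eq0 /eqP.
    by rewrite addr_eq0 => /eqP.
  rewrite -subr_ge0.
  rewrite (_ : _ - _ = (tent n (y + xi) - tent n y) * ((enorm (y + xi))^-1 - (enorm y)^-1)); last by ring.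
  have [le|/ltW le] := leP (enorm (y + xi)) (enorm y).
    by rewrite mulr_ge0// subr_ge0; [exact: tent_mono|rewrite lef_pV2].
  by rewrite mulr_le0// subr_le0; [exact: tent_mono|rewrite lef_pV2].
rewrite -(fineK (tent_pot0_fin n0)); case: (tent_pot n xi) => [t| |]//; last by move=> _; rewrite leNye.
by rewrite -!EFinD !lee_fin; lra.
Qed.

(** The tent has Lipschitz constant [1/n], and the loss under translation has to be paid only where
    [tent n] is nonzero, inside the ball of radius [n]. *)
Lemma tent_pot_ge n xi : 0 < n ->
  (tent_pot n 0%R <= tent_pot n xi + (enorm xi / n)%:E * ball_pot n)%E.
Proof.
move=> n0; have e0 : 0 <= enorm xi / n by rewrite divr_ge0 ?enorm_ge0// ltW.
have mK := measurable_ker_restrict n; have K0 := ker_restrict_ge0 n.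
have mt : measurable_fun [set: T3] (fun y : T3 => (tent n ((y : R3 R) + xi) / enorm (y : R3 R))%:E).
  apply/measurable_EFinP; apply: measurable_funM; last exact: measurable_ker.
  exact: (measurable_comp_shift xi (measurable_tent n)).
rewrite tent_pot0 tent_potE ball_potE -ge0_integralZl_EFin//.
rewrite -ge0_integralD//; last 3 first.
- by move=> y _; exact: tent_ker_ge0.
- by move=> y _; rewrite mule_ge0.
- exact: measurable_funeM.
apply: ge0_le_integral => //.
- by move=> y _; exact: tent_ker_ge0.
- exact: measurable_tent_ker.
- by apply: emeasurable_funD => //; exact: measurable_funeM.
move=> y _; rewrite patchE; case: ifPn => [_|].
  rewrite -EFinM -EFinD lee_fin -mulrDl ler_wpM2r ?ker_ge0// -lerBlDr.
  exact: tent_shift.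
rewrite notin_setE /= => /negP; rewrite -leNgt => ny.
by rewrite (tent_outside n0 ny) mul0r mule0 adde0 tent_ker_ge0.
Qed.

Lemma cube_tent_ge n x : 0 < n -> cube (n / 4) x -> 2^-1 <= tent n x.
Proof.
move=> n0; have n4 : 0 <= n / 4 by rewrite divr_ge0// ltW.
move=> /(enorm_cube n4) H.
rewrite /tent le_max; apply/orP; right; rewrite lerBrDr -lerBrDl.
by rewrite ler_pdivrMr//; lra.
Qed.

(** On the cube of half-side [n/4], of volume [n^3 / 8], the tent is at least 1/2 and the kernel at
    least [2/n]. *)
Lemma tent_pot0_ge n : 0 < n -> ((n ^+ 2 / 8)%:E <= tent_pot n 0%R)%E.
Proof.
move=> n0; have mQ : measurable (cube (n / 4)) := measurable_hbox _ _.
have n4 : 0 <= n / 4 by rewrite divr_ge0// ltW.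
have -> : (n ^+ 2 / 8)%:E = ((n^-1)%:E * mu (cube (n / 4)))%E.
  by rewrite leb3_cube// -EFinM; congr EFin; field; rewrite gt_eqF.
have n'0 : 0 <= n^-1 by rewrite invr_ge0 ltW.
rewrite -[cube _]setIT -integral_indic// -ge0_integralZl_EFin//; last first.
  exact/measurable_EFinP/measurable_indic.
rewrite tent_pot0; apply: ae_ge0_le_integral => //.
- by move=> x _; rewrite -EFinM lee_fin mulr_ge0.
- apply: measurable_funeM; exact/measurable_EFinP/measurable_indic.
- by move=> x _; exact: tent_ker_ge0.
- exact: measurable_tent_ker.
apply: filterS (ae_neq (0 : R3 R)) => x x0 _; rewrite -EFinM lee_fin indicE.
have [/set_mem xQ|_] := boolP (x \in _); last by rewrite mulr0 mulr_ge0 ?tent_ge0 ?ker_ge0.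
have p0 : 0 < enorm x by rewrite lt_neqAle enorm_ge0 andbT eq_sym; apply/eqP => /enorm_eq0.
rewrite mulr1 -[leLHS]mulr1.
have -> : n^-1 * 1 = 2^-1 * (n / 2)^-1 by field; rewrite gt_eqF.
apply: ler_pM => //; [by rewrite invr_ge0 divr_ge0// ltW|exact: cube_tent_ge|].
rewrite lef_pV2 ?posrE ?divr_gt0//.
by have := enorm_cube n4 xQ; lra.
Qed.

Lemma integral_tent_ge n : 0 < n -> ((n ^+ 3 / 16)%:E <= \int[mu]_x (tent n x)%:E)%E.
Proof.
move=> n0; have mQ : measurable (cube (n / 4)) := measurable_hbox _ _.
have n4 : 0 <= n / 4 by rewrite divr_ge0// ltW.
have -> : (n ^+ 3 / 16)%:E = ((2^-1)%:E * mu (cube (n / 4)))%E.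
  by rewrite leb3_cube// -EFinM; congr EFin; field.
rewrite -[cube _]setIT -integral_indic// -ge0_integralZl_EFin//; last first.
  exact/measurable_EFinP/measurable_indic.
apply: ge0_le_integral => //.
- apply: measurable_funeM; exact/measurable_EFinP/measurable_indic.
- by apply/measurable_EFinP; exact: measurable_tent.
move=> x _; rewrite -EFinM lee_fin indicE.
have [/set_mem xQ|_] := boolP (x \in _); last by rewrite mulr0 tent_ge0.
by rewrite mulr1; exact: cube_tent_ge.
Qed.

(** Beyond the radius [A] the kernel is at most [1/A]. The true order is [n^2], but a multiple of
    [n^3] as small as desired, by the choice of [A], is enough for both comparisons below and
    requires no exact integration. *)
Lemma ball_pot_le n A : 0 < n -> 0 < A -> (ball_pot n <= ball_pot A + (8 * n ^+ 3 / A)%:E)%E.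
Proof.
move=> n0 A0; have mQ : measurable (cube n) := measurable_hbox _ _.
have A'0 : 0 <= A^-1 by rewrite invr_ge0 ltW.
have mK := measurable_ker_restrict; have K0 := ker_restrict_ge0.
have mI : measurable_fun [set: T3] (fun x : T3 => ((A^-1)%:E * (\1_(cube n) x : R)%:E)%E).
  apply: measurable_funeM; exact/measurable_EFinP/measurable_indic.
have -> : (8 * n ^+ 3 / A)%:E = (\int[mu]_x ((A^-1)%:E * (\1_(cube n) x : R)%:E))%E.
  rewrite ge0_integralZl_EFin//; last exact/measurable_EFinP/measurable_indic.
  by rewrite integral_indic// setIT leb3_cube ?(ltW n0)// -EFinM mulrC.
rewrite !ball_potE -ge0_integralD//; last first.
  by move=> x _; rewrite -EFinM lee_fin mulr_ge0.
apply: ge0_le_integral => //.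
  by apply: emeasurable_funD.
move=> x _; rewrite patchE; case: ifPn => [|_]; last first.
  by rewrite adde_ge0// -EFinM lee_fin mulr_ge0.
rewrite inE /= => /cube_enorm xQ; rewrite indicE mem_set// mule1 patchE.
case: ifPn => [_|]; first by rewrite -EFinD lee_fin lerDl.
rewrite notin_setE /= => /negP; rewrite -leNgt => Ax.
by rewrite add0e lee_fin lef_pV2// posrE// (lt_le_trans A0).
Qed.

End WeightedKernel.

(** * Averaging over translations *)

Section Averaging.
Variable R : realType.
Local Notation T1 := (measurableTypeR R).
Local Notation T3 := (T1 * T1 * T1)%type.
Local Notation mu := (leb3 R).

Lemma ge0_le_integralT (F G : T3 -> \bar R) : measurable_fun setT F -> measurable_fun setT G ->
  (forall x, 0 <= F x)%E -> (forall x, F x <= G x)%E -> (\int[mu]_x F x <= \int[mu]_x G x)%E.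
Proof.
by move=> mF mG F0 FG; apply: ge0_le_integral => // x _; exact: le_trans (F0 x) (FG x).
Qed.

Lemma ge0_integralZ_real (c : R) (g : T3 -> R) : 0 <= c -> measurable_fun setT g ->
  (forall x, 0 <= g x) -> (\int[mu]_x (c * g x)%:E = c%:E * \int[mu]_x (g x)%:E)%E.
Proof.
move=> c0 mg g0; have mE : measurable_fun setT (EFin \o g) by exact/measurable_EFinP.
by rewrite -(@ge0_integralZl_EFin _ _ _ mu setT measurableT (EFin \o g)) => // x _; rewrite lee_fin.
Qed.

Lemma ge0_integralZ_ext (c : R) (F : T3 -> \bar R) : 0 <= c -> measurable_fun setT F ->
  (forall x, 0 <= F x)%E -> (\int[mu]_x (c%:E * F x) = c%:E * \int[mu]_x F x)%E.
Proof. by move=> c0 mF F0; rewrite ge0_integralZl_EFin. Qed.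

Variables (f h : T3 -> R) (a b : R).
Hypotheses (mf : measurable_fun setT f) (mh : measurable_fun setT h).
Hypotheses (f0 : forall x, 0 <= f x) (h0 : forall x, 0 <= h x).
Hypotheses (fa : (\int[mu]_x (f x)%:E = a%:E)%E) (hb : (\int[mu]_x (h x)%:E = b%:E)%E).

Definition overlap (y : R3 R) : \bar R := (\int[mu]_x (f ((x : R3 R) + y)%R * h x)%:E)%E.

(** Interaction of [f] with [h] moved by [y]. The change of variable has already been made, here and
    in [attraction]: [y] occurs in the kernel alone, so that averaging over [y] replaces the kernel
    by the potential of the tent. *)
Definition cross_coulomb (y : R3 R) : \bar R :=
  (\int[mu]_x \int[mu]_z (f x * h z / enorm ((x : R3 R) - z - y)%R)%:E)%E.

Definition attraction (r y : R3 R) : \bar R :=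
  (\int[mu]_z (h z / enorm ((z : R3 R) + y - r)%R)%:E)%E.

Let mfE : measurable_fun setT (EFin \o f). Proof. exact/measurable_EFinP. Qed.
Let mhE : measurable_fun setT (EFin \o h). Proof. exact/measurable_EFinP. Qed.
Let a0 : 0 <= a. Proof. by rewrite -lee_fin -fa; apply: integral_ge0 => x _; rewrite lee_fin. Qed.
Let b0 : 0 <= b. Proof. by rewrite -lee_fin -hb; apply: integral_ge0 => x _; rewrite lee_fin. Qed.

Lemma measurable_tentE n : measurable_fun [set: T3] (fun y : T3 => (tent n y)%:E).
Proof. by apply/measurable_EFinP; exact: measurable_tent. Qed.

Let mO : measurable_fun setT (fun p : T3 * T3 => (f ((p.2 : R3 R) + p.1)%R * h p.2)%:E).
Proof.
apply/measurable_EFinP/measurable_funM; last exact: (measurableT_comp mh measurable_snd).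
exact: (measurableT_comp mf (measurable_add3 measurable_snd measurable_fst)).
Qed.

Lemma overlap_ge0 y : (0 <= overlap y)%E.
Proof. by apply: integral_ge0 => x _; rewrite lee_fin mulr_ge0. Qed.

Lemma measurable_overlap : measurable_fun [set: T3] overlap.
Proof. by apply: (measurable_integral3 mO) => p; rewrite lee_fin mulr_ge0. Qed.

(** Bound the tent by 1 and integrate over [y] first, which gives the mass of [f] whatever [x] is.
    The bound does not grow with [n]. *)
Lemma integral_tent_overlap n : 0 < n ->
  (\int[mu]_y ((tent n y)%:E * overlap y) <= (a * b)%:E)%E.
Proof.
move=> n0; apply: (@le_trans _ _ (\int[mu]_y overlap y)%E).
  apply: ge0_le_integralT.
  - by apply: emeasurable_funM; [exact: measurable_tentE|exact: measurable_overlap].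
  - exact: measurable_overlap.
  - by move=> y; rewrite mule_ge0 ?overlap_ge0// lee_fin tent_ge0.
  move=> y; rewrite -[leRHS]mul1e; apply: lee_wpmul2r; first exact: overlap_ge0.
  by rewrite lee_fin tent_le1// ltW.
have E : (\int[mu]_y overlap y = \int[mu]_x \int[mu]_y (f ((x : R3 R) + y)%R * h x)%:E)%E.
  by rewrite /overlap (tonelli3 mO)// => p; rewrite lee_fin mulr_ge0.
rewrite E EFinM -hb -ge0_integralZ_ext//.
have mO' : measurable_fun setT (fun p : T3 * T3 => (f ((p.1 : R3 R) + p.2)%R * h p.1)%:E).
  apply/measurable_EFinP/measurable_funM; last exact: (measurableT_comp mh measurable_fst).
  exact: (measurableT_comp mf (measurable_add3 measurable_fst measurable_snd)).
apply: ge0_le_integralT.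
- by apply: (measurable_integral3 mO') => p; rewrite lee_fin mulr_ge0.
- exact: measurable_funeM.
- by move=> x; apply: integral_ge0 => y _; rewrite lee_fin mulr_ge0.
move=> x; rewrite -fa -(ge0_integral_shift (x : R3 R) mfE) /=; last by move=> y; rewrite lee_fin.
rewrite muleC -ge0_integralZ_real//; last exact: (measurable_comp_shift (x : R3 R) mf).
by rewrite le_eqVlt; apply/orP; left; apply/eqP; apply: eq_integral => y _; rewrite mulrC addrC.
Qed.

Let mC : measurable_fun setT (fun p : (T3 * T3) * T3 =>
  (f p.1.2 * h p.2 / enorm ((p.1.2 : R3 R) - p.2 - p.1.1)%R)%:E).
Proof.
have m1 : measurable_fun setT (fun p : (T3 * T3) * T3 => p.1.2) := measurableT_comp measurable_snd measurable_fst.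
have m2 : measurable_fun setT (fun p : (T3 * T3) * T3 => p.1.1) := measurableT_comp measurable_fst measurable_fst.
apply/measurable_EFinP/measurable_funM.
  by apply: measurable_funM; [exact: measurableT_comp|exact: (measurableT_comp mh measurable_snd)].
exact: (measurableT_comp (@measurable_ker R) (measurable_sub3 (measurable_sub3 m1 measurable_snd) m2)).
Qed.

Lemma cross_coulomb_ge0 y : (0 <= cross_coulomb y)%E.
Proof.
by apply: integral_ge0 => x _; apply: integral_ge0 => z _; rewrite lee_fin !mulr_ge0// ker_ge0.
Qed.

Lemma measurable_cross_coulomb : measurable_fun [set: T3] cross_coulomb.
Proof.
have mI : measurable_fun setT (fun q : T3 * T3 =>
    \int[mu]_z (f q.2 * h z / enorm ((q.2 : R3 R) - z - q.1)%R)%:E)%E.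
  by apply: (measurable_integral3 mC) => p; rewrite lee_fin !mulr_ge0// ker_ge0.
apply: (measurable_integral3 mI) => q; apply: integral_ge0 => z _.
by rewrite lee_fin !mulr_ge0// ker_ge0.
Qed.

(** With the integral over [y] innermost, the kernel becomes [tent_pot n (x - z)], which is largest
    at the centre; the masses of [f] and [h] then factor out. *)
Lemma integral_tent_cross n : 0 < n ->
  (\int[mu]_y ((tent n y)%:E * cross_coulomb y) <= (a * b)%:E * tent_pot n 0%R)%E.
Proof.
move=> n0.
have k0 (x y z : T3) : 0 <= f x * h z / enorm ((x : R3 R) - z - y) by rewrite !mulr_ge0// ker_ge0.
pose F (y x z : T3) := (tent n y * (f x * h z / enorm ((x : R3 R) - z - y)))%:E.
have F0 y x z : (0 <= F y x z)%E by rewrite lee_fin mulr_ge0// tent_ge0.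
have mF d (T : measurableType d) (t1 t2 t3 : T -> T3) : measurable_fun setT t1 ->
    measurable_fun setT t2 -> measurable_fun setT t3 ->
    measurable_fun setT (fun t => F (t1 t) (t2 t) (t3 t)).
  move=> m1 m2 m3; apply/measurable_EFinP/measurable_funM.
    exact: (measurableT_comp (measurable_tent n) m1).
  have /measurable_EFinP := measurableT_comp mC (measurable_fun_pair (measurable_fun_pair m1 m2) m3).
  exact.
have mC1 (y x : T3) : measurable_fun [set: T3] (fun z : T3 => f x * h z / enorm ((x : R3 R) - z - y)).
  apply/measurable_EFinP.
  exact: (measurableT_comp mC (pair1_measurable (y, x))).
have E1 : (\int[mu]_y ((tent n y)%:E * cross_coulomb y) = \int[mu]_y \int[mu]_x \int[mu]_z F y x z)%E.
  apply: eq_integral => y _; rewrite -ge0_integralZ_ext ?tent_ge0//; last 2 first.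
  - have mI : measurable_fun setT (fun q : T3 * T3 => (f q.1 * h q.2 / enorm ((q.1 : R3 R) - q.2 - y)%R)%:E).
      exact: (measurableT_comp mC (measurable_fun_pair (measurable_fun_pair (measurable_cst y) measurable_fst) measurable_snd)).
    by apply: (measurable_integral3 mI) => p; rewrite lee_fin k0.
  - by move=> x; apply: integral_ge0 => z _; rewrite lee_fin k0.
  by apply: eq_integral => x _; rewrite -ge0_integralZ_real ?tent_ge0//.
have mF2 : measurable_fun setT (fun q : T3 * T3 => \int[mu]_z F q.1 q.2 z)%E.
  apply: (@measurable_integral3 R _ _ (fun p : (T3 * T3) * T3 => F p.1.1 p.1.2 p.2)) => //.
  apply: mF => //; [exact: (measurableT_comp measurable_fst measurable_fst)|
    exact: (measurableT_comp measurable_snd measurable_fst)].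
have mF3 : measurable_fun setT (fun q : T3 * T3 => \int[mu]_y F y q.1 q.2)%E.
  apply: (@measurable_integral3 R _ _ (fun p : (T3 * T3) * T3 => F p.2 p.1.1 p.1.2)) => //.
  apply: mF => //; [exact: (measurableT_comp measurable_fst measurable_fst)|
    exact: (measurableT_comp measurable_snd measurable_fst)].
have E2 : (\int[mu]_y \int[mu]_x \int[mu]_z F y x z = \int[mu]_x \int[mu]_z \int[mu]_y F y x z)%E.
  have G0 (q : T3 * T3) : (0 <= \int[mu]_z F q.1 q.2 z)%E by exact: integral_ge0.
  apply: etrans (tonelli3 mF2 G0) _; apply: eq_integral => x _ /=.
  have mFx := mF _ _ _ _ _ measurable_fst (measurable_cst x) measurable_snd.
  exact: (tonelli3 mFx (fun q => F0 q.1 x q.2)).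
have E3 x z : (\int[mu]_y F y x z = (f x * h z)%:E * tent_pot n ((x : R3 R) - z)%R)%E.
  have mg : measurable_fun [set: T3] (fun y : T3 => tent n y / enorm ((x : R3 R) - z - y)).
    by apply: measurable_funM; [exact: measurable_tent|exact: measurable_ker_sub].
  have g0 (y : T3) : 0 <= tent n y / enorm ((x : R3 R) - z - y) by rewrite mulr_ge0 ?tent_ge0 ?ker_ge0.
  apply: etrans (ge0_integralZ_real (mulr_ge0 (f0 x) (h0 z)) mg g0).
  by apply: eq_integral => y _; rewrite /F; congr EFin; rewrite mulrCA.
rewrite E1 E2; have S0 : (0 <= tent_pot n 0%R)%E by apply: integral_ge0 => y _; exact: tent_ker_ge0.
have Sf := tent_pot0_fin n0; have PS0 xi : (tent_pot n xi <= tent_pot n 0%R)%E by exact: tent_pot_le.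
move: PS0 S0; rewrite -(fineK Sf).
set S := fine _ => PS; rewrite lee_fin => S0.
have E4 x : (\int[mu]_z (f x * S * h z)%:E = (b * S * f x)%:E)%E.
  rewrite (ge0_integralZ_real (mulr_ge0 (f0 x) S0) mh h0) hb -EFinM; congr EFin.
  by rewrite mulrC -mulrA [f x * S]mulrC mulrA.
have bS : 0 <= b * S by rewrite mulr_ge0.
apply: (@le_trans _ _ (\int[mu]_x (b * S * f x)%:E)%E).
  apply: ge0_le_integralT.
  - apply: (measurable_integral3 mF3) => q; exact: integral_ge0.
  - by apply/measurable_EFinP; exact: measurable_funM.
  - by move=> x; apply: integral_ge0 => z _; exact: integral_ge0.
  move=> x; rewrite -E4; apply: ge0_le_integralT.
  - exact: (measurableT_comp mF3 (pair1_measurable x)).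
  - by apply/measurable_EFinP; exact: measurable_funM.
  - by move=> z; exact: integral_ge0.
  move=> z; rewrite E3 mulrAC (EFinM (f x * h z)); apply: lee_wpmul2l; first by rewrite lee_fin mulr_ge0.
  exact: PS.
rewrite (ge0_integralZ_real bS mf f0) fa -!EFinM lee_fin.
by rewrite le_eqVlt; apply/orP; left; apply/eqP; rewrite mulrC mulrA.
Qed.

Let mT r : measurable_fun setT (fun p : T3 * T3 => (h p.2 / enorm ((p.2 : R3 R) + p.1 - r)%R)%:E).
Proof.
apply/measurable_EFinP/measurable_funM; first exact: (measurableT_comp mh measurable_snd).
exact: (measurableT_comp (@measurable_ker R) (measurable_sub3 (measurable_add3 measurable_snd measurable_fst) (measurable_cst (r : T3)))).
Qed.

Lemma attraction_ge0 r y : (0 <= attraction r y)%E.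
Proof. by apply: integral_ge0 => z _; rewrite lee_fin !mulr_ge0// ker_ge0. Qed.

Lemma measurable_attraction r : measurable_fun [set: T3] (attraction r).
Proof. by apply: (measurable_integral3 (mT r)) => p; rewrite lee_fin mulr_ge0// ker_ge0. Qed.

Lemma integral_tent_attraction n r : 0 < n ->
  (\int[mu]_y ((tent n y)%:E * attraction r y) = \int[mu]_z ((h z)%:E * tent_pot n (r - (z : R3 R))%R))%E.
Proof.
move=> n0; pose F (p : T3 * T3) := (tent n p.1 * (h p.2 / enorm ((p.2 : R3 R) + p.1 - r)))%:E.
have mF : measurable_fun setT F.
  apply/measurable_EFinP/measurable_funM; first exact: (measurableT_comp (measurable_tent n) measurable_fst).
  by have /measurable_EFinP := mT r.
have F0 p : (0 <= F p)%E by rewrite lee_fin !mulr_ge0 ?tent_ge0 ?ker_ge0.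
have mT1 (y : T3) : measurable_fun [set: T3] (fun z : T3 => h z / enorm ((z : R3 R) + y - r)).
  by apply/measurable_EFinP; exact: (measurableT_comp (mT r) (pair1_measurable y)).
transitivity (\int[mu]_y \int[mu]_z F (y, z))%E.
  apply: eq_integral => y _; rewrite -ge0_integralZ_real ?tent_ge0// => z.
  by rewrite mulr_ge0// ker_ge0.
rewrite tonelli3//; apply: eq_integral => z _.
have mg : measurable_fun [set: T3] (fun y : T3 => tent n y / enorm (r - (z : R3 R) - y)).
  by apply: measurable_funM; [exact: measurable_tent|exact: measurable_ker_sub].
have g0 (y : T3) : 0 <= tent n y / enorm (r - (z : R3 R) - y) by rewrite mulr_ge0 ?tent_ge0 ?ker_ge0.
apply: etrans (ge0_integralZ_real (h0 z) mg g0).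
apply: eq_integral => y _; rewrite /F /=; congr EFin; rewrite mulrCA -enormN.
by congr (_ * (_ / enorm _)); rewrite opprB opprD addrA.
Qed.

End Averaging.

(** * Existence of favourable translations *)

Section FavourableTranslation.
Variable R : realType.
Local Notation T1 := (measurableTypeR R).
Local Notation T3 := (T1 * T1 * T1)%type.
Local Notation mu := (leb3 R).
Variables (f h : T3 -> R) (a b C : R).
Hypotheses (mf : measurable_fun setT f) (mh : measurable_fun setT h).
Hypotheses (f0 : forall x, 0 <= f x) (h0 : forall x, 0 <= h x).
Hypotheses (fa : (\int[mu]_x (f x)%:E = a%:E)%E) (hb : (\int[mu]_x (h x)%:E = b%:E)%E).
Hypothesis C0 : 0 <= C.

Let a0 : 0 <= a. Proof. by rewrite -lee_fin -fa; apply: integral_ge0 => x _; rewrite lee_fin. Qed.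
Let b0 : 0 <= b. Proof. by rewrite -lee_fin -hb; apply: integral_ge0 => x _; rewrite lee_fin. Qed.
Let ab0 : 0 <= a * b. Proof. exact: mulr_ge0. Qed.

(** The cost of gluing, with [f] and [h] the squares of the two functions: [C] will be [Crep], from
    the powers, and the second term is the mutual Coulomb energy. *)
Definition repulsion (y : R3 R) : \bar R := (C%:E * overlap f h y + cross_coulomb f h y)%E.

(** Both existence proofs below go by contradiction: a function [G] that never exceeds the repulsion
    has an average at most linear in the potential of the tent at its centre. *)
Lemma tent_average_le n (G : R3 R -> \bar R) : 0 < n -> measurable_fun [set: T3] G ->
    (forall y, 0 <= G y)%E -> (forall y, G y <= repulsion y)%E ->
  (\int[mu]_y ((tent n y)%:E * G y) <= (C * (a * b) + a * b * fine (tent_pot n 0%R))%:E)%E.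
Proof.
move=> n0 mG G0 GU.
have t0 y : (0 <= (tent n y)%:E)%E by rewrite lee_fin tent_ge0.
have mo := measurable_overlap mf mh f0 h0; have mc := measurable_cross_coulomb mf mh f0 h0.
have o0 := overlap_ge0 f0 h0; have c0 := cross_coulomb_ge0 f0 h0.
have mt := @measurable_tentE R n.
have mto : measurable_fun [set: T3] (fun y : T3 => (tent n y)%:E * overlap f h y)%E.
  exact: emeasurable_funM.
have mtc : measurable_fun [set: T3] (fun y : T3 => (tent n y)%:E * cross_coulomb f h y)%E.
  exact: emeasurable_funM.
apply: (@le_trans _ _ (\int[mu]_y (C%:E * ((tent n y)%:E * overlap f h y) +
    (tent n y)%:E * cross_coulomb f h y))%E).
  apply: ge0_le_integralT.
  - exact: emeasurable_funM.
  - by apply: emeasurable_funD => //; exact: measurable_funeM.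
  - by move=> y; rewrite mule_ge0.
  move=> y; rewrite muleCA -ge0_muleDr ?mule_ge0//; exact: lee_wpmul2l.
rewrite ge0_integralD//; last 3 first.
- by move=> y _; rewrite !mule_ge0.
- exact: measurable_funeM.
- by move=> y _; rewrite mule_ge0.
rewrite ge0_integralZ_ext//; last by move=> y; rewrite mule_ge0.
rewrite EFinD; apply: leeD.
  rewrite EFinM; apply: lee_wpmul2l => //.
  exact: (integral_tent_overlap mf mh f0 h0 fa hb n0).
have := integral_tent_cross mf mh f0 h0 fa hb n0.
by rewrite (EFinM (a * b)) (fineK (tent_pot0_fin n0)).
Qed.

Lemma tent_pot0_fine_le n A : 0 < n -> 0 < A ->
  fine (tent_pot n (0 : R3 R)) <= fine (ball_pot A) + 8 * n ^+ 3 / A.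
Proof.
move=> n0 A0; rewrite -lee_fin EFinD (fineK (tent_pot0_fin n0)) (fineK (ball_pot_fin A)).
exact: le_trans (tent_pot0_le n0) (ball_pot_le n0 A0).
Qed.

(** A repulsion of at least [eps] everywhere would have an average of order [eps n^3], the mass of
    the tent, whereas the average grows only like its potential. *)
Lemma exists_small_repulsion (eps : R) : 0 < eps -> exists y, (repulsion y < eps%:E)%E.
Proof.
move=> eps0; apply: contrapT => H.
have {}H y : (eps%:E <= repulsion y)%E.
  by rewrite leNgt; apply/negP => yl; apply: H; exists y.
(* The average exceeds [eps n^3 / 16]. The choice of [A] keeps the cubic part of the upper bound
   below [eps n^3 / 32], and that of [n] keeps the constant part [c] below the other half. *)
pose A := 1 + 256 * (a * b) / eps.
have A0 : 0 < A.
  by apply: ltr_pwDl => //; apply: divr_ge0; [exact: mulr_ge0|exact: ltW].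
pose k := fine (ball_pot A : \bar R).
have k0 : 0 <= k.
  by rewrite fine_ge0// ball_pot_ge0.
pose c := C * (a * b) + a * b * k.
have c0 : 0 <= c by rewrite addr_ge0 ?mulr_ge0.
pose n := 1 + 32 * c / eps.
have n1 : 1 <= n by rewrite lerDl divr_ge0 ?mulr_ge0// ltW.
have n0 : 0 < n by apply: lt_le_trans n1.
have := @tent_average_le n (cst eps%:E) n0 (measurable_cst _) (fun=> ltW eps0) H.
under eq_integral do rewrite muleC.
rewrite (ge0_integralZ_ext (ltW eps0)); last 2 first.
- exact: measurable_tentE.
- by move=> y; rewrite lee_fin tent_ge0.
move=> up; have lo : ((eps * (n ^+ 3 / 16))%:E <= (C * (a * b) + a * b * fine (tent_pot n 0%R))%:E)%E.
  apply: le_trans up; rewrite EFinM; apply: lee_wpmul2l; first by rewrite lee_fin ltW.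
  exact: integral_tent_ge.
move: lo; rewrite lee_fin; apply/negP; rewrite -ltNge.
have S := tent_pot0_fine_le n0 A0.
have S' : a * b * fine (tent_pot n (0 : R3 R)) <= a * b * k + 8 * (a * b) / A * n ^+ 3.
  by apply: le_trans (ler_wpM2l ab0 S) _; rewrite le_eqVlt -/k; apply/orP; left; apply/eqP; ring.
have S2 : 8 * (a * b) / A <= eps / 32.
  by rewrite ler_pdivrMr// /A mulrDr mulr1 (_ : eps / 32 * _ = 8 * (a * b)) ?lerDr ?divr_ge0// ?ltW//; field; rewrite gt_eqF.
have n3 : n <= n ^+ 3 by rewrite ler_eXnr.
have n30 : 0 <= n ^+ 3 by rewrite exprn_ge0// ltW.
have S3 := ler_wpM2r n30 S2.
have S4 : c < eps / 32 * n.
  by rewrite /n mulrDr mulr1 (_ : eps / 32 * _ = c) ?ltr_pwDl ?divr_gt0//; field; rewrite gt_eqF.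
have S5 : eps / 32 * n <= eps / 32 * n ^+ 3 by rewrite ler_wpM2l// divr_ge0// ltW.
by move: S' S3 S4 S5; rewrite /c; lra.
Qed.

(** For [|z| <= d] the potential at [r - z] differs from that at the centre by a bounded multiple of
    [ball_pot n / n]; the mass of [h] beyond [d] is given up. *)
Lemma attraction_average_ge n d r : 0 < n -> 0 <= d ->
  ((fine (tent_pot n 0%R))%:E * \int[mu]_(z in [set z : T3 | (enorm (z : R3 R) <= d)%R]) (h z)%:E
   <= \int[mu]_z ((h z)%:E * tent_pot n (r - (z : R3 R))%R)
      + ((enorm r + d) / n * fine (ball_pot n) * b)%:E)%E.
Proof.
move=> n0 d0; have Sf := tent_pot0_fin n0; set S := fine _.
have S0 : 0 <= S by rewrite fine_ge0//; apply: integral_ge0 => y _; exact: tent_ker_ge0.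
set q := fine (ball_pot n).
have qE : (ball_pot n = q%:E)%E by rewrite fineK// ball_pot_fin.
have q0 : 0 <= q.
  by rewrite fine_ge0// ball_pot_ge0.
have c0 : 0 <= (enorm r + d) / n * q by rewrite mulr_ge0// divr_ge0 ?addr_ge0 ?enorm_ge0// ltW.
have mD : measurable [set z : T3 | enorm (z : R3 R) <= d].
  by apply: measurable_le_set; [exact: measurable_enorm|exact: measurable_cst].
have mhE : measurable_fun setT (EFin \o h) by exact/measurable_EFinP.
have mP : measurable_fun [set: T3] (fun z : T3 => tent_pot n (r - (z : R3 R))).
  have mF : measurable_fun setT (fun p : T3 * T3 => (tent n p.2 / enorm (r - (p.1 : R3 R) - p.2))%:E).
    apply/measurable_EFinP/measurable_funM; first exact: (measurableT_comp (measurable_tent n) measurable_snd).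
    exact: (measurableT_comp (@measurable_ker R) (measurable_sub3 (measurable_sub3 (measurable_cst (r : T3)) measurable_fst) measurable_snd)).
  by apply: (measurable_integral3 mF) => p; exact: tent_ker_ge0.
have P0 z : (0 <= tent_pot n z)%E by apply: integral_ge0 => y _; exact: tent_ker_ge0.
have mhD : measurable_fun [set: T3] ((EFin \o h) \_ [set z : T3 | enorm (z : R3 R) <= d]).
  by apply: (measurable_restrictT (EFin \o h) mD).1; exact: measurable_funTS.
have hD0 z : (0 <= ((EFin \o h) \_ [set z : T3 | (enorm (z : R3 R) <= d)%R]) z)%E.
  by rewrite patchE; case: ifP => // _; rewrite lee_fin.
rewrite integral_mkcond -ge0_integralZ_ext// EFinM -hb -ge0_integralZ_ext//.
rewrite -ge0_integralD//; last 4 first.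
- by move=> z _; rewrite mule_ge0// lee_fin.
- exact: emeasurable_funM.
- by move=> z _; rewrite -EFinM lee_fin mulr_ge0.
- exact: measurable_funeM.
apply: ge0_le_integralT.
- exact: measurable_funeM.
- by apply: emeasurable_funD; [exact: emeasurable_funM|exact: measurable_funeM].
- by move=> z; rewrite mule_ge0// lee_fin.
move=> z; rewrite patchE; case: ifPn => [|_]; last first.
  by rewrite mule0 adde_ge0// ?mule_ge0// lee_fin// mulr_ge0.
rewrite inE /= => zd.
rewrite [X in (_ <= _ + X)%E]muleC [leLHS]muleC -ge0_muleDr ?lee_fin//.
apply: lee_wpmul2l; first by rewrite lee_fin.
have := tent_pot_ge (r - (z : R3 R)) n0; rewrite -(fineK Sf) -/S qE => /le_trans; apply.
apply: leeD2l; rewrite -EFinM lee_fin ler_wpM2r// ler_wpM2r ?invr_ge0 ?(ltW n0)//.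
by apply: le_trans (enorm_triangle _ _) _; rewrite enormN lerD2l.
Qed.

Lemma mass_in_ball (b' : R) : b' < b -> exists2 d, 0 <= d &
  (b'%:E < \int[mu]_(z in [set z : T3 | (enorm (z : R3 R) <= d)%R]) (h z)%:E)%E.
Proof.
move=> b'b; pose F (n : nat) := [set z : T3 | enorm (z : R3 R) <= n%:R].
have mF n : measurable (F n).
  by apply: measurable_le_set; [exact: measurable_enorm|exact: measurable_cst].
have ndF : nondecreasing_seq F.
  by move=> m n mn; apply/subsetPset => z /= /le_trans; apply; rewrite ler_nat.
have := @ge0_nondecreasing_set_cvg_integral _ T3 R F (EFin \o h) mu ndF mF.
have -> : \bigcup_i F i = setT.
  apply/seteqP; split => // z _; exists (Num.bound (enorm (z : R3 R))) => //=.
  exact: ltW (archi_boundP (enorm_ge0 z)).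
have hE : (\int[mu]_x (EFin \o h) x)%E = b%:E := hb.
rewrite hE => cv; apply: contrapT => H.
have le n : (\int[mu]_(x in F n) (EFin \o h) x <= b'%:E)%E.
  by rewrite leNgt; apply/negP => lt; apply: H; exists n%:R.
have : (b%:E <= b'%:E)%E.
  apply: (cvge_le (f := fun n => (\int[mu]_(x in F n) (EFin \o h) x)%E) (F := \oo)).
    by apply: nearW.
  apply: cv => [n|n z _]; last by rewrite /= lee_fin.
  by apply: measurable_funTS; exact/measurable_EFinP.
by rewrite lee_fin leNgt b'b.
Qed.

(** In the averaged inequality the potential [S] at the centre has coefficient [a b] on the side of
    the repulsion and [Z bd] on that of the attraction, where [bd] is the mass of [h] in a large
    ball. Since [a < Z], the radius can be chosen with [Z bd > a b]. All other terms are bounded or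
    a small multiple of [n^2], while [S >= n^2 / 8]. *)
Lemma exists_attraction_gt_repulsion (K : nat) (alpha : 'I_K -> R) (r : 'I_K -> R3 R) :
    (forall k, 0 < alpha k) -> a < \sum_k alpha k -> 0 < b ->
  exists y, (repulsion y < \sum_k (alpha k)%:E * attraction h (r k) y)%E.
Proof.
move=> al0 aZ bgt0; apply: contrapT => H.
have {}H y : (\sum_k (alpha k)%:E * attraction h (r k) y <= repulsion y)%E.
  by rewrite leNgt; apply/negP => yl; apply: H; exists y.
set Z := \sum_k alpha k in aZ.
have Z0 : 0 < Z by apply: le_lt_trans aZ.
(* The threshold [a b / Z] is below the full mass [b] exactly because [a < Z]. *)
have [d d0] : exists2 d, 0 <= d &
    ((a * b / Z)%:E < \int[mu]_(z in [set z : T3 | (enorm (z : R3 R) <= d)%R]) (h z)%:E)%E.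
  by apply: mass_in_ball; rewrite ltr_pdivrMr// mulrC ltr_pM2l.
set bdE := (\int[mu]_(z in _) _)%E => bdlt.
have bdfin : bdE \is a fin_num.
  rewrite ge0_fin_numE; last by apply: integral_ge0 => z _; rewrite lee_fin.
  apply: (@le_lt_trans _ _ b%:E); last exact: ltry.
  rewrite -hb; apply: ge0_subset_integral => //.
  - by apply: measurable_le_set; [exact: measurable_enorm|exact: measurable_cst].
  - exact/measurable_EFinP.
  - by move=> z _; rewrite lee_fin.
pose bd := fine bdE; have bdE' : bdE = bd%:E by rewrite fineK.
move: bdlt; rewrite bdE' lte_fin ltr_pdivrMr// => bdlt.
pose gam := Z * bd - a * b; have gam0 : 0 < gam by rewrite subr_gt0 (mulrC Z).
pose L := \sum_k alpha k * (enorm (r k) + d) * b.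
have L0 : 0 <= L.
  by apply: sumr_ge0 => k _; rewrite !mulr_ge0 ?addr_ge0 ?enorm_ge0// ltW.
(* The gain [gam * S] is at least [gam n^2 / 8]. One half absorbs the quadratic part [8 L n^2 / A]
   of the error, the other the constant [c], by the choice of [n]. *)
pose A := 1 + 128 * L / gam.
have A0 : 0 < A by rewrite ltr_pwDl// divr_ge0 ?mulr_ge0// ltW.
pose kA := fine (ball_pot A : \bar R).
have kA0 : 0 <= kA.
  by rewrite fine_ge0// ball_pot_ge0.
pose c := C * (a * b) + L * kA.
have c0 : 0 <= c by rewrite addr_ge0 ?mulr_ge0.
pose n := 1 + 16 * c / gam.
have n1 : 1 <= n by rewrite lerDl divr_ge0 ?mulr_ge0// ltW.
have n0 : 0 < n by apply: lt_le_trans n1.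
have Sf := tent_pot0_fin n0; pose S := fine (tent_pot n (0 : R3 R)).
have Slo : n ^+ 2 / 8 <= S by rewrite -lee_fin /S (fineK Sf) tent_pot0_ge.
pose q := fine (ball_pot n : \bar R).
have qle : q <= kA + 8 * n ^+ 3 / A.
  by rewrite -lee_fin EFinD !fineK ?ball_pot_fin//; exact: ball_pot_le.
have q0 : 0 <= q.
  by rewrite fine_ge0// ball_pot_ge0.
have att0 := attraction_ge0 h0.
have matt := measurable_attraction mh h0.
have tent_att k : (\int[mu]_y ((tent n y)%:E * ((alpha k)%:E * attraction h (r k) y)) =
    (alpha k)%:E * \int[mu]_z ((h z)%:E * tent_pot n (r k - (z : R3 R))%R))%E.
  rewrite -integral_tent_attraction//; under eq_integral do rewrite muleCA.
  rewrite ge0_integralZ_ext//; first exact: ltW.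
  - by apply: emeasurable_funM; [exact: measurable_tentE|exact: matt].
  - by move=> y; rewrite mule_ge0// lee_fin tent_ge0.
have up : (\int[mu]_y ((tent n y)%:E * \sum_k (alpha k)%:E * attraction h (r k) y) <=
    (C * (a * b) + a * b * S)%:E)%E.
  apply: tent_average_le => //.
  - by apply: emeasurable_sum => k; apply: measurable_funeM; exact: matt.
  - by move=> y; apply: sume_ge0 => k _; rewrite mule_ge0// lee_fin ltW.
have up2 : (\sum_k (alpha k)%:E * \int[mu]_z ((h z)%:E * tent_pot n (r k - (z : R3 R))%R) <=
    (C * (a * b) + a * b * S)%:E)%E.
  apply: le_trans up; under eq_bigr do rewrite -tent_att.
  rewrite -ge0_integral_sum//; last 2 first.
  - move=> k; apply: emeasurable_funM; first exact: measurable_tentE.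
    by apply: measurable_funeM; exact: matt.
  - by move=> k y _; rewrite !mule_ge0// lee_fin ?tent_ge0// ltW.
  rewrite le_eqVlt; apply/orP; left; apply/eqP; apply: eq_integral => y _.
  by rewrite ge0_sume_distrr// => k _; rewrite mule_ge0// lee_fin ltW.
have lo k : ((alpha k * (S * bd))%:E <= (alpha k)%:E * \int[mu]_z ((h z)%:E * tent_pot n (r k - (z : R3 R))%R) +
    (alpha k * (enorm (r k) + d) * b * (q / n))%:E)%E.
  have := attraction_average_ge (r k) n0 d0; rewrite -/bdE bdE' -/S -/q -EFinM.
  have al0' : (0 <= (alpha k)%:E)%E by rewrite lee_fin ltW.
  have rd : 0 <= (enorm (r k) + d) / n * q * b.
    by do 2!apply: mulr_ge0 => //; apply: divr_ge0; [rewrite addr_ge0 ?enorm_ge0|exact: ltW].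
  move=> /(lee_wpmul2l al0'); rewrite -EFinM ge0_muleDr//; last first.
    apply: integral_ge0 => z _; rewrite mule_ge0 ?lee_fin//.
    by apply: integral_ge0 => y _; exact: tent_ker_ge0.
  move=> /le_trans; apply; rewrite -EFinM le_eqVlt; apply/orP; left; apply/eqP.
  by congr (_ + _%:E)%E; ring.
have fin : Z * (S * bd) <= C * (a * b) + a * b * S + L * (q / n).
  rewrite -lee_fin EFinD; apply: le_trans (leeD2r _ up2).
  rewrite /Z /L !mulr_suml -!sumEFin -big_split /=; exact: lee_sum.
move: fin; apply/negP; rewrite -ltNge.
have q1 : L * (q / n) <= L * kA + gam / 16 * n ^+ 2.
  have h1 : q / n <= kA + 8 / A * n ^+ 2.
    rewrite ler_pdivrMr//; apply: le_trans qle _.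
    have -> : (kA + 8 / A * n ^+ 2) * n = kA * n + 8 * n ^+ 3 / A by ring.
    by rewrite lerD2r ler_peMr.
  have h2 : L * (8 / A) <= gam / 16.
    rewrite mulrA ler_pdivrMr//; have -> : gam / 16 * A = gam / 16 + L * 8.
      by rewrite /A; field; rewrite gt_eqF.
    by rewrite lerDr divr_ge0// ltW.
  apply: le_trans (ler_wpM2l L0 h1) _; rewrite [L * (_ + _)]mulrDr lerD2l mulrA.
  by rewrite ler_wpM2r ?sqr_ge0.
have g1 : gam * (n ^+ 2 / 8) <= gam * S by rewrite ler_wpM2l// ltW.
have n2 : gam / 16 * n <= gam / 16 * n ^+ 2.
  by rewrite ler_wpM2l ?divr_ge0// ?(ltW gam0)// ler_eXnr.
have n3 : c < gam / 16 * n.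
  by rewrite /n mulrDr mulr1 (_ : gam / 16 * _ = c) ?ltr_pwDl ?divr_gt0//; field; rewrite gt_eqF.
have E1 : Z * (S * bd) = gam * S + a * b * S by rewrite /gam; ring.
rewrite E1; move: q1 g1 n2 n3; rewrite /c.
set X1 := gam * S; set X2 := L * (q / n); set X3 := n ^+ 2; set X4 := gam * (_ / 8).
have -> : X4 = gam / 16 * X3 + gam / 16 * X3 by rewrite /X4 /X3; field.
set X5 := gam / 16 * X3; set X6 := gam / 16 * n; set X7 := L * kA; set X8 := C * (a * b).
lra.
Qed.

End FavourableTranslation.

(** * The trial function *)

Section Nonlinearity.
Variable R : realType.

(* Here [al], [be], [ga] stand for [|w|^(2/3)], [|v|^(2/3)], [|z|^(2/3)] with
   [z^2 = w^2 + v^2]. Put [X := ga^4 - al^4 - be^4]. Then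
   [ga^5 - al^5 - be^5 <= 2 ga X] and [X <= 2 al^3 be^3 / ga^2], so that the
   difference is at most [(2 c1 ga - c2) X]: this is negative unless
   [ga > c2 / (2 c1)], and in that case at most [8 c1^2 / c2 al^3 be^3]. *)
Lemma cubic_mixture_le (c1 c2 al be ga : R) : 0 < c1 -> 0 < c2 ->
    0 <= al -> 0 <= be -> 0 <= ga -> ga ^+ 3 = al ^+ 3 + be ^+ 3 ->
  c1 * ga ^+ 5 - c2 * ga ^+ 4 <= c1 * al ^+ 5 - c2 * al ^+ 4 + (c1 * be ^+ 5 - c2 * be ^+ 4)
    + 8 * c1 ^+ 2 / c2 * (al ^+ 3 * be ^+ 3).
Proof.
move=> c10 c20 al0 be0 ga0 E.
have al3 : 0 <= al ^+ 3 by exact: exprn_ge0.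
have be3 : 0 <= be ^+ 3 by exact: exprn_ge0.
have alga : al <= ga by rewrite -(@ler_pXn2r _ 3)// E lerDl.
have bega : be <= ga by rewrite -(@ler_pXn2r _ 3)// E lerDr.
pose X := al ^+ 3 * (ga - al) + be ^+ 3 * (ga - be).
have X0 : 0 <= X by rewrite addr_ge0 ?mulr_ge0 ?subr_ge0.
have E4 : ga ^+ 4 = al ^+ 4 + be ^+ 4 + X.
  by rewrite (exprS ga 3) E /X; ring.
have E5 : ga ^+ 5 <= al ^+ 5 + be ^+ 5 + 2 * ga * X.
  have -> : ga ^+ 5 = ga ^+ 2 * (al ^+ 3 + be ^+ 3) by rewrite -E; ring.
  rewrite -subr_ge0 (_ : _ - _ = al ^+ 3 * (ga - al) ^+ 2 + be ^+ 3 * (ga - be) ^+ 2).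
    by apply: addr_ge0; apply: mulr_ge0; rewrite ?sqr_ge0.
  by rewrite /X; ring.
have D : c1 * ga ^+ 5 - c2 * ga ^+ 4 <= c1 * al ^+ 5 - c2 * al ^+ 4 + (c1 * be ^+ 5 - c2 * be ^+ 4)
    + (2 * c1 * ga - c2) * X.
  have := ler_wpM2l (ltW c10) E5; rewrite E4.
  rewrite (_ : c1 * (al ^+ 5 + be ^+ 5 + 2 * ga * X) = c1 * al ^+ 5 + c1 * be ^+ 5 + 2 * c1 * ga * X); last by ring.
  rewrite (_ : c2 * (al ^+ 4 + be ^+ 4 + X) = c2 * al ^+ 4 + c2 * be ^+ 4 + c2 * X); last by ring.
  rewrite mulrBl; move: (c1 * ga ^+ 5) (c1 * al ^+ 5) (c1 * be ^+ 5) (2 * c1 * ga * X) (c2 * X) (c2 * al ^+ 4) (c2 * be ^+ 4) => *; lra.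
apply: le_trans D _; rewrite lerD2l.
have C0 : 0 <= 8 * c1 ^+ 2 / c2 by rewrite divr_ge0 ?mulr_ge0 ?sqr_ge0// ltW.
have [gale|galt] := leP (2 * c1 * ga) c2.
  apply: (@le_trans _ _ 0); last by apply: mulr_ge0 => //; exact: mulr_ge0.
  by rewrite mulr_le0_ge0// subr_le0.
have g0 : 0 < ga.
  by rewrite lt_neqAle ga0 andbT; apply/eqP => g0; move: galt; rewrite -g0 mulr0 ltNge (ltW c20).
have X2 : X * ga ^+ 2 <= 2 * (al ^+ 3 * be ^+ 3).
  have h1 : (ga - al) * ga ^+ 2 <= be ^+ 3.
    have -> : be ^+ 3 = (ga - al) * (ga ^+ 2 + ga * al + al ^+ 2).
      by rewrite -[LHS](addKr (al ^+ 3)) -E; ring.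
    by rewrite ler_wpM2l ?subr_ge0// -addrA lerDl addr_ge0 ?mulr_ge0 ?sqr_ge0.
  have h2 : (ga - be) * ga ^+ 2 <= al ^+ 3.
    have -> : al ^+ 3 = (ga - be) * (ga ^+ 2 + ga * be + be ^+ 2).
      by rewrite -[LHS](addrK (be ^+ 3)) -E; ring.
    by rewrite ler_wpM2l ?subr_ge0// -addrA lerDl addr_ge0 ?mulr_ge0 ?sqr_ge0.
  have -> : X * ga ^+ 2 = al ^+ 3 * ((ga - al) * ga ^+ 2) + be ^+ 3 * ((ga - be) * ga ^+ 2).
    by rewrite /X; ring.
  apply: le_trans (lerD (ler_wpM2l al3 h1) (ler_wpM2l be3 h2)) _.
  by rewrite [be ^+ 3 * _]mulrC [leRHS]mulr_natl mulr2n.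
set Y := al ^+ 3 * be ^+ 3 in X2 *; have Y0 : 0 <= Y by exact: mulr_ge0.
apply: (@le_trans _ _ (2 * c1 * ga * X)); first by rewrite ler_wpM2r// gerBl ltW.
have -> : 2 * c1 * ga * X = 2 * c1 * (X * ga ^+ 2) / ga by field; rewrite gt_eqF.
rewrite ler_pdivrMr//.
have h3 : 2 * c1 * (X * ga ^+ 2) <= 4 * c1 * Y.
  have -> : 4 * c1 * Y = 2 * c1 * (2 * Y) by ring.
  by rewrite ler_wpM2l// mulr_ge0// ltW.
apply: le_trans h3 _.
have -> : 8 * c1 ^+ 2 / c2 * Y * ga = 4 * c1 * Y * (2 * c1 * ga / c2) by field; rewrite gt_eqF.
rewrite ler_peMr// ?mulr_ge0// ?(ltW c10)//.
by rewrite ler_pdivlMr// mul1r ltW.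
Qed.

Definition nlin (c1 c2 t : R) : R := c1 * `|t| `^ (10 / 3) - c2 * `|t| `^ (8 / 3).

Lemma powR_third (t : R) (n : nat) : (`|t| `^ (2 / 3)) ^+ n = `|t| `^ (2 / 3 * n%:R).
Proof. by rewrite -powR_mulrn ?powR_ge0// [RHS]powRrM. Qed.

Lemma nlin_mixture_le c1 c2 s t : 0 < c1 -> 0 < c2 ->
  nlin c1 c2 (Num.sqrt (s ^+ 2 + t ^+ 2))
  <= nlin c1 c2 s + nlin c1 c2 t + 8 * c1 ^+ 2 / c2 * (s ^+ 2 * t ^+ 2).
Proof.
move=> c10 c20.
have E3 (x : R) : (`|x| `^ (2 / 3)) ^+ 3 = x ^+ 2.
  by rewrite powR_third (_ : 2 / 3 * 3%:R = 2%:R) ?powR_mulrn ?real_normK ?num_real//; field.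
have E4 (x : R) : `|x| `^ (8 / 3) = (`|x| `^ (2 / 3)) ^+ 4.
  by rewrite powR_third; congr (_ `^ _); field.
have E5 (x : R) : `|x| `^ (10 / 3) = (`|x| `^ (2 / 3)) ^+ 5.
  by rewrite powR_third; congr (_ `^ _); field.
rewrite /nlin !E4 !E5 -(E3 s) -(E3 t).
apply: cubic_mixture_le; rewrite ?powR_ge0//.
by rewrite !E3 sqr_sqrtr// addr_ge0 ?sqr_ge0.
Qed.

Lemma powR_le_quartic (t p : R) : 2 <= p <= 4 -> `|t| `^ p <= t ^+ 2 + t ^+ 4.
Proof.
move=> /andP[p2 p4]; have E2 : t ^+ 2 = `|t| ^+ 2 by rewrite real_normK ?num_real.
have E4 : t ^+ 4 = `|t| ^+ 4 by rewrite -[4%N]/(2 * 2)%N !exprM E2.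
rewrite E2 E4; have s0 := normr_ge0 t; move: `|t| s0 => s s0.
have [s1|s1] := leP s 1.
  apply: (@le_trans _ _ (s ^+ 2)); last by rewrite lerDl exprn_ge0.
  have [->|sn0] := eqVneq s 0; first by rewrite powR0 ?sqr_ge0// gt_eqF//; lra.
  by rewrite -powR_mulrn//; apply: ger_powR => //; rewrite lt_neqAle eq_sym sn0 s0.
apply: (@le_trans _ _ (s ^+ 4)); last by rewrite lerDr sqr_ge0.
by rewrite -powR_mulrn// ler_powR// ltW.
Qed.

(** The reverse triangle inequality in the plane. Applied pointwise to the increments of [mixture],
    it replaces the chain rule and gives the subadditivity of the kinetic energy. *)
Lemma sqrt_mixture_contract (a b c d : R) :
  (Num.sqrt (a ^+ 2 + b ^+ 2) - Num.sqrt (c ^+ 2 + d ^+ 2)) ^+ 2 <= (a - c) ^+ 2 + (b - d) ^+ 2.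
Proof.
have p2 : Num.sqrt (a ^+ 2 + b ^+ 2) ^+ 2 = a ^+ 2 + b ^+ 2 by rewrite sqr_sqrtr// addr_ge0 ?sqr_ge0.
have q2 : Num.sqrt (c ^+ 2 + d ^+ 2) ^+ 2 = c ^+ 2 + d ^+ 2 by rewrite sqr_sqrtr// addr_ge0 ?sqr_ge0.
have cs : a * c + b * d <= Num.sqrt (a ^+ 2 + b ^+ 2) * Num.sqrt (c ^+ 2 + d ^+ 2).
  apply: le_trans (ler_norm _) _.
  rewrite -(@ler_pXn2r _ 2)// ?nnegrE ?mulr_ge0 ?sqrtr_ge0// real_normK ?num_real//.
  rewrite exprMn p2 q2 -subr_ge0 (_ : _ - _ = (a * d - b * c) ^+ 2); last by ring.
  exact: sqr_ge0.
move: p2 q2 cs; move: (Num.sqrt _) (Num.sqrt _) => q p p2 q2 cs.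
rewrite -subr_ge0 (_ : _ - _ = 2 * (p * q - (a * c + b * d)) + (a ^+ 2 + b ^+ 2 - p ^+ 2) + (c ^+ 2 + d ^+ 2 - q ^+ 2)).
  by rewrite p2 q2 !subrr !addr0 mulr_ge0// subr_ge0.
by ring.
Qed.

End Nonlinearity.

Section TrialFunction.
Variable R : realType.
Local Notation T1 := (measurableTypeR R).
Local Notation T3 := (T1 * T1 * T1)%type.
Local Notation e_ i := (basis3 R i).
Local Notation mu := (leb3 R).
Local Notation L2s := (Lfun mu 2%:E).
Implicit Types (u v w : R3 R -> R) (y : R3 R).

Definition mixture w v y : R3 R -> R := fun x => Num.sqrt (w x ^+ 2 + v (x - y) ^+ 2).

Lemma sqr_mixture w v y x : mixture w v y x ^+ 2 = w x ^+ 2 + v (x - y) ^+ 2.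
Proof. by rewrite sqr_sqrtr// addr_ge0 ?sqr_ge0. Qed.

Lemma mixture_Lfun2 w v y : (w : T3 -> R) \in L2s -> (v : T3 -> R) \in L2s ->
  (mixture w v y : T3 -> R) \in L2s.
Proof.
move=> w2 v2; have /Lfun2P[mw iw] := w2; have /Lfun2P[mv iv] := Lfun2_shift (- y) v2.
have mw2 : measurable_fun setT (fun x : T3 => w x ^+ 2) by exact: measurable_funX.
have mv2 : measurable_fun setT (fun x : T3 => v ((x : R3 R) - y) ^+ 2) by exact: measurable_funX.
apply/Lfun2P; split.
  apply: measurable_fun_sqrt => [|x]; last by rewrite addr_ge0 ?sqr_ge0.
  exact: measurable_funD.
under eq_integral do rewrite sqr_mixture EFinD.
rewrite ge0_integralD//; first exact: lte_add_pinfty.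
all: try (by move=> x _; rewrite lee_fin sqr_ge0).
all: by apply/measurable_EFinP.
Qed.

Definition kinetic u : R := \sum_(i < 3) ip mu (wpartial i u) (wpartial i u).

Lemma H1_mixture w v y : H1 w -> H1 v ->
  H1 (mixture w v y) /\ kinetic (mixture w v y) <= kinetic w + kinetic v.
Proof.
move=> Hw Hv; have w2 := Hw.1; have v2 := Hv.1.
pose C i := ip mu (wpartial i w) (wpartial i w) + ip mu (wpartial i v) (wpartial i v).
have C0 i : 0 <= C i by rewrite addr_ge0 ?ip_ge0.
have z2 := mixture_Lfun2 y w2 v2.
have [i h /andP[h0 _]|Hz zC] := @H1_of_shift R (mixture w v y) C z2 C0.
  pose dw (x : T3) := w ((x : R3 R) + h *: e_ i) - w x.
  pose dv (x : T3) := v ((x : R3 R) + h *: e_ i) - v x.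
  have dw2 : dw \in L2s by apply: Lfun2B => //; exact: Lfun2_shift.
  have dv2 : dv \in L2s by apply: Lfun2B => //; exact: Lfun2_shift.
  have dvy2 := Lfun2_shift (- y) dv2.
  have dz2 : ((fun x : T3 => mixture w v y ((x : R3 R) + h *: e_ i) - mixture w v y x) : T3 -> R) \in L2s.
    by apply: Lfun2B => //; exact: Lfun2_shift.
  have hw := H1_shift_le i Hw (ltW h0); have hv := H1_shift_le i Hv (ltW h0).
  apply: (@le_trans _ _ (ip mu dw dw + ip mu dv dv)); last first.
    by apply: le_trans (lerD hw hv) _; rewrite -mulrDr mulrC.
  rewrite -(ip_shift (- y) dv2 dv2) /ip -RintegralD//; try exact: ip_integrable.
  apply: le_Rintegral => //; first exact: ip_integrable.
    exact: (integrableD measurableT (ip_integrable dw2 dw2) (ip_integrable dvy2 dvy2)).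
  move=> x _; rewrite -!expr2 /mixture /dw /dv.
  have -> : (x : R3 R) - y + h *: e_ i = (x : R3 R) + h *: e_ i - y by rewrite addrAC.
  exact: sqrt_mixture_contract.
by split=> //; rewrite /kinetic -big_split /=; apply: ler_sum => i _; exact: zC.
Qed.

Lemma H1_scale t u : H1 u -> H1 (fun x => t * u x).
Proof.
move=> Hu; have u2 := Hu.1.
pose C i := t ^+ 2 * ip mu (wpartial i u) (wpartial i u).
have C0 i : 0 <= C i by rewrite mulr_ge0 ?sqr_ge0 ?ip_ge0.
have [//|//] := @H1_of_shift R (fun x => t * u x) C (Lfun2Z t u2) C0.
move=> i h /andP[h0 _].
have d2 : ((fun x : T3 => u ((x : R3 R) + h *: e_ i) - u x) : T3 -> R) \in L2s.
  by apply: Lfun2B => //; exact: Lfun2_shift.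
have E : (fun x : T3 => t * u ((x : R3 R) + h *: e_ i) - t * u x) =
    (fun x : T3 => t * (u ((x : R3 R) + h *: e_ i) - u x)).
  by apply/funext => x; rewrite mulrBr.
rewrite E (ipZl _ d2 (Lfun2Z t d2)) (ipZr _ d2 d2) mulrA -expr2 /C -mulrA ler_wpM2l ?sqr_ge0// mulrC.
exact: H1_shift_le (ltW h0).
Qed.

Lemma quartic_integrable u : H1 u -> mu.-integrable setT (fun x : T3 => (u x ^+ 4)%:E).
Proof.
move=> Hu; have /Lfun2P[mu_ _] := Hu.1; apply/integrableP; split.
  exact/measurable_EFinP/measurable_funX.
apply: le_lt_trans (H1_quartic_lty Hu); apply: ge0_le_integral => //.
- apply: measurableT_comp => //; exact/measurable_EFinP/measurable_funX.
- exact/measurable_EFinP/measurable_funX.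
move=> x _; rewrite abse_EFin lee_fin ger0_norm// -[4%N]/(2 * 2)%N exprM; exact: sqr_ge0.
Qed.

Lemma sqr_integrable u : (u : T3 -> R) \in L2s -> mu.-integrable setT (fun x : T3 => (u x ^+ 2)%:E).
Proof. exact: Lfun2_integrable_sqr. Qed.

Lemma powR_integrable u p : 2 <= p <= 4 -> H1 u -> mu.-integrable setT (fun x : T3 => (`|u x| `^ p)%:E).
Proof.
move=> p24 Hu; have /Lfun2P[mu_ _] := Hu.1.
apply: (le_integrable measurableT _ _ (integrableD measurableT (sqr_integrable Hu.1) (quartic_integrable Hu))).
  apply/measurable_EFinP; apply: (measurableT_comp (measurable_powR p)).
  exact: measurableT_comp.
move=> x _ /=; rewrite lee_fin ger0_norm ?powR_ge0//.
by apply: le_trans (ler_norm _); exact: powR_le_quartic.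
Qed.

Lemma nlin_integrable c1 c2 u : H1 u -> mu.-integrable setT (fun x : T3 => (nlin c1 c2 (u x))%:E).
Proof.
move=> Hu.
have p1 : 2 <= (10 / 3 : R) <= 4 by rewrite ler_pdivlMr ?ler_pdivrMr -?natrM ?ler_nat.
have p2 : 2 <= (8 / 3 : R) <= 4 by rewrite ler_pdivlMr ?ler_pdivrMr -?natrM ?ler_nat.
apply: (integrableB measurableT (integrableZl measurableT c1 (powR_integrable p1 Hu))
  (integrableZl measurableT c2 (powR_integrable p2 Hu))).
Qed.

End TrialFunction.

(** * The energy of the trial function *)

Section CoulombEnergy.
Variable R : realType.
Local Notation T1 := (measurableTypeR R).
Local Notation T3 := (T1 * T1 * T1)%type.
Local Notation mu := (leb3 R).
Implicit Types (f h : T3 -> R) (u : R3 R -> R) (y : R3 R).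

Definition coul f h : \bar R :=
  (\int[mu]_x \int[mu]_z (f x * h z / enorm ((x : R3 R) - z)%R)%:E)%E.

Lemma coul_ge0 f h : (forall x, 0 <= f x) -> (forall x, 0 <= h x) -> (0 <= coul f h)%E.
Proof.
move=> f0 h0; apply: integral_ge0 => x _; apply: integral_ge0 => z _.
by rewrite lee_fin !mulr_ge0// ker_ge0.
Qed.

Lemma measurable_coul_kernel f h : measurable_fun setT f -> measurable_fun setT h ->
  measurable_fun setT (fun p : T3 * T3 => (f p.1 * h p.2 / enorm ((p.1 : R3 R) - p.2))%:E).
Proof.
move=> mf mh; apply/measurable_EFinP/measurable_funM.
  by apply: measurable_funM; [exact: (measurableT_comp mf measurable_fst)|
    exact: (measurableT_comp mh measurable_snd)].
exact: (measurableT_comp (@measurable_ker R) (measurable_sub3 measurable_fst measurable_snd)).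
Qed.

Lemma coulC f h : measurable_fun setT f -> measurable_fun setT h ->
  (forall x, 0 <= f x) -> (forall x, 0 <= h x) -> coul f h = coul h f.
Proof.
move=> mf mh f0 h0; rewrite /coul.
have k0 (p : T3 * T3) : (0 <= (f p.1 * h p.2 / enorm ((p.1 : R3 R) - p.2))%:E)%E.
  by rewrite lee_fin !mulr_ge0// ker_ge0.
apply: etrans (tonelli3 (measurable_coul_kernel mf mh) k0) _.
apply: eq_integral => x _; apply: eq_integral => z _ /=.
by rewrite enormB [f z * _]mulrC.
Qed.

Lemma coulDl f1 f2 h : measurable_fun setT f1 -> measurable_fun setT f2 -> measurable_fun setT h ->
    (forall x, 0 <= f1 x) -> (forall x, 0 <= f2 x) -> (forall x, 0 <= h x) ->
  coul (fun x => f1 x + f2 x) h = (coul f1 h + coul f2 h)%E.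
Proof.
move=> m1 m2 mh f10 f20 h0; rewrite /coul.
have k1 (p : T3 * T3) : (0 <= (f1 p.1 * h p.2 / enorm ((p.1 : R3 R) - p.2))%:E)%E.
  by rewrite lee_fin !mulr_ge0// ker_ge0.
have k2 (p : T3 * T3) : (0 <= (f2 p.1 * h p.2 / enorm ((p.1 : R3 R) - p.2))%:E)%E.
  by rewrite lee_fin !mulr_ge0// ker_ge0.
have mk1 := measurable_coul_kernel m1 mh; have mk2 := measurable_coul_kernel m2 mh.
rewrite -ge0_integralD//; last 4 first.
- by move=> x _; apply: integral_ge0 => z _; exact: (k1 (x, z)).
- exact: (measurable_integral3 mk1).
- by move=> x _; apply: integral_ge0 => z _; exact: (k2 (x, z)).
- exact: (measurable_integral3 mk2).
apply: eq_integral => x _; rewrite -ge0_integralD//; last 4 first.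
- by move=> z _; exact: (k1 (x, z)).
- exact: (measurableT_comp mk1 (pair1_measurable x)).
- by move=> z _; exact: (k2 (x, z)).
- exact: (measurableT_comp mk2 (pair1_measurable x)).
by apply: eq_integral => z _; rewrite -EFinD -!mulrDl.
Qed.

Lemma coul_cross f h y : measurable_fun setT h -> (forall x, 0 <= f x) -> (forall x, 0 <= h x) ->
  coul f (fun x => h ((x : R3 R) - y)) = cross_coulomb f h y.
Proof.
move=> mh f0 h0; apply: eq_integral => x _.
have m : measurable_fun [set: T3] (fun z : T3 => (f x * h ((z : R3 R) - y) / enorm ((x : R3 R) - z))%:E).
  apply/measurable_EFinP/measurable_funM; last exact: measurable_ker_sub.
  by apply: measurable_funM => //; exact: (measurable_comp_shift (- y) mh).
rewrite -(ge0_integral_shift y m) => [|z]; last by rewrite lee_fin !mulr_ge0// ker_ge0.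
by apply: eq_integral => z _; rewrite addrK opprD addrA.
Qed.

Lemma coul_shift f h y : measurable_fun setT f -> measurable_fun setT h ->
    (forall x, 0 <= f x) -> (forall x, 0 <= h x) ->
  coul (fun x => f ((x : R3 R) - y)) (fun x => h ((x : R3 R) - y)) = coul f h.
Proof.
move=> mf mh f0 h0; have mfy := measurable_comp_shift (- y) mf.
apply: etrans (coul_cross y mh (fun x => f0 ((x : R3 R) - y)) h0) _; rewrite /cross_coulomb.
pose G (x : T3) := (\int[mu]_z (f ((x : R3 R) - y) * h z / enorm ((x : R3 R) - z - y)%R)%:E)%E.
have mk : measurable_fun setT (fun p : T3 * T3 => (f ((p.1 : R3 R) - y) * h p.2 / enorm ((p.1 : R3 R) - p.2 - y))%:E).
  apply/measurable_EFinP/measurable_funM.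
    by apply: measurable_funM; [exact: (measurableT_comp mfy measurable_fst)|
      exact: (measurableT_comp mh measurable_snd)].
  exact: (measurableT_comp (@measurable_ker R) (measurable_sub3 (measurable_sub3 measurable_fst measurable_snd) (measurable_cst (y : T3)))).
have mG : measurable_fun setT G.
  by apply: (measurable_integral3 mk) => p; rewrite lee_fin !mulr_ge0// ker_ge0.
have G0 x : (0 <= G x)%E by apply: integral_ge0 => z _; rewrite lee_fin !mulr_ge0// ker_ge0.
rewrite -[LHS](ge0_integral_shift y mG G0); apply: eq_integral => x _.
by apply: eq_integral => z _; rewrite addrK (addrAC (x : R3 R)) addrK.
Qed.

(** By [mul_ker_le] with [h = u^2], the potential generated by [u^2] is bounded by a constant [c]
    independent of the point; it remains to integrate against [f]. *)
Lemma coul_lty f u : measurable_fun setT f -> (forall x, 0 <= f x) ->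
    (\int[mu]_x (f x)%:E < +oo)%E -> H1 u -> (coul f (fun x => (u x ^+ 2)%R) < +oo)%E.
Proof.
move=> mf f0 foo Hu; have /Lfun2P[mu_ iu2] := Hu.1; have iu4 := H1_quartic_lty Hu.
have mh : measurable_fun setT (fun x : T3 => u x ^+ 2) by exact: measurable_funX.
have m4 : measurable_fun setT (fun x : T3 => (u x ^+ 2) ^+ 2) by exact: measurable_funX.
pose c := (\int[mu]_x (u x ^+ 2)%:E + \int[mu]_x ((u x ^+ 2) ^+ 2)%:E + \int[mu]_x (kappa (x : R3 R))%:E)%E.
have coo : (c < +oo)%E.
  have ik := integral_kappa_lty R.
  have i4 : (\int[mu]_x ((u x ^+ 2) ^+ 2)%:E < +oo)%E.
    by under eq_integral do rewrite -exprM; exact: iu4.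
  by apply: lte_add_pinfty => //; apply: lte_add_pinfty.
have c0 : (0 <= c)%E.
  by apply: adde_ge0; [apply: adde_ge0|]; apply: integral_ge0 => x _; rewrite lee_fin ?sqr_ge0 ?kappa_ge0.
have cf : c \is a fin_num by rewrite ge0_fin_numE.
have inner (x : T3) : (\int[mu]_z (u z ^+ 2 / enorm ((x : R3 R) - z)%R)%:E <= c)%E.
  have mk : measurable_fun setT (fun z : T3 => (kappa ((z : R3 R) - x))%:E).
    by apply/measurable_EFinP; have := measurable_comp_shift (- (x : R3 R)) (@measurable_kappa R).
  have -> : c = (\int[mu]_z ((u z ^+ 2)%:E + ((u z ^+ 2) ^+ 2)%:E + (kappa ((z : R3 R) - x)%R)%:E))%E.
    rewrite !ge0_integralD//; try (by move=> z _; rewrite ?adde_ge0// lee_fin ?sqr_ge0 ?kappa_ge0);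
      try (by apply/measurable_EFinP); last first.
      by apply: emeasurable_funD; exact/measurable_EFinP.
    congr (_ + _ + _)%E; apply/esym; apply: (ge0_integral_shift (- (x : R3 R)) (f := fun z : T3 => (kappa (z : R3 R))%:E)).
      by apply/measurable_EFinP; exact: measurable_kappa.
    by move=> z; rewrite lee_fin kappa_ge0.
  apply: ge0_le_integralT.
  - apply/measurable_EFinP/measurable_funM => //; exact: measurable_ker_sub.
  - by apply: emeasurable_funD => //; apply: emeasurable_funD; exact/measurable_EFinP.
  - by move=> z; rewrite lee_fin mulr_ge0 ?sqr_ge0 ?ker_ge0.
  move=> z; rewrite -!EFinD lee_fin enormB; exact: mul_ker_le (sqr_ge0 _).
have fk (p q : T3) : 0 <= f p * u q ^+ 2 / enorm ((p : R3 R) - q).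
  by apply: mulr_ge0; [apply: mulr_ge0; rewrite ?sqr_ge0|exact: ker_ge0].
apply: (@le_lt_trans _ _ (\int[mu]_x ((fine c)%:E * (f x)%:E))%E).
  apply: ge0_le_integralT.
  - apply: (measurable_integral3 (measurable_coul_kernel mf mh)) => p.
    by rewrite lee_fin fk.
  - by apply: measurable_funeM; exact/measurable_EFinP.
  - by move=> x; apply: integral_ge0 => z _; rewrite lee_fin fk.
  move=> x; rewrite fineK// muleC.
  apply: (@le_trans _ _ ((f x)%:E * \int[mu]_z (u z ^+ 2 / enorm ((x : R3 R) - z)%R)%:E)%E).
    rewrite -ge0_integralZ_real//.
    + by rewrite le_eqVlt; apply/orP; left; apply/eqP; apply: eq_integral => z _; rewrite mulrA.
    + by apply: measurable_funM => //; exact: measurable_ker_sub.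
    + by move=> z; rewrite mulr_ge0 ?sqr_ge0 ?ker_ge0.
  by apply: lee_wpmul2l; [rewrite lee_fin|exact: inner].
have mfE : measurable_fun setT (EFin \o f) by exact/measurable_EFinP.
have fc0 : 0 <= fine c by exact: fine_ge0.
by rewrite (ge0_integralZ_ext (F := EFin \o f))// lte_mul_pinfty.
Qed.

End CoulombEnergy.

Section EnergyOfMixture.
Variables (R : realType) (c1 c2 : R).
Hypotheses (c1_gt0 : 0 < c1) (c2_gt0 : 0 < c2).
Local Notation T1 := (measurableTypeR R).
Local Notation T3 := (T1 * T1 * T1)%type.
Local Notation mu := (leb3 R).
Local Notation L2s := (Lfun mu 2%:E).
Local Notation integrable f := (mu.-integrable setT (EFin \o (f : T3 -> R))).
Implicit Types (u v w V : R3 R -> R) (y : R3 R).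

Definition sqf u (x : T3) : R := u x ^+ 2.

(** Real-valued form of [energy], equal to it once [V u^2] is integrable, in which the four
    contributions can be compared separately. *)
Definition finite_energy V u : R :=
  kinetic u + \int[mu]_x nlin c1 c2 (u x) - \int[mu]_x (V x * u x ^+ 2)
  + 1 / 2 * fine (coul (sqf u) (sqf u)).

Lemma sqf_ge0 u x : 0 <= sqf u x. Proof. exact: sqr_ge0. Qed.

Lemma measurable_sqf u : H1 u -> measurable_fun setT (sqf u).
Proof. by move=> Hu; have /Lfun2P[mu_ _] := Hu.1; exact: measurable_funX. Qed.

Lemma integral_sqf u : H1 u -> (\int[mu]_x (sqf u x)%:E = (ip mu u u)%:E)%E.
Proof. by move=> Hu; exact: ip_sqrE Hu.1. Qed.

Lemma coul_sqf_fin u v : H1 u -> H1 v -> coul (sqf u) (sqf v) \is a fin_num.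
Proof.
move=> Hu Hv; rewrite ge0_fin_numE; last by apply: coul_ge0 => x; exact: sqf_ge0.
apply: coul_lty => //; first exact: measurable_sqf.
  by move=> x; exact: sqf_ge0.
by rewrite integral_sqf// ltry.
Qed.

Lemma sum3 (F : 'I_3 -> R) : \sum_(i < 3) F i =
  F (@Ordinal 3 0 isT) + F (@Ordinal 3 1 isT) + F (@Ordinal 3 2 isT).
Proof.
rewrite !big_ord_recr big_ord0 /= add0r.
by congr (F _ + F _ + F _); exact: val_inj.
Qed.

Lemma gradsqE u : gradsq u = (fun x => wpartial (@Ordinal 3 0 isT) u x ^+ 2 +
  wpartial (@Ordinal 3 1 isT) u x ^+ 2 + wpartial (@Ordinal 3 2 isT) u x ^+ 2).
Proof. by apply/funext => x; exact: sum3. Qed.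

Lemma gradsq_integral u : H1 u -> integrable (gradsq u) /\ \int[mu]_x gradsq u x = kinetic u.
Proof.
move=> Hu; have i2 i : integrable (fun x => wpartial i u x ^+ 2).
  exact: sqr_integrable (wpartialP i Hu).1.
pose i01 := integrableD measurableT (i2 (@Ordinal 3 0 isT)) (i2 (@Ordinal 3 1 isT)).
rewrite gradsqE; split; first exact: (integrableD measurableT i01 (i2 _)).
rewrite RintegralD// RintegralD// /kinetic sum3.
have E i : \int[mu]_x (wpartial i u x ^+ 2) = ip mu (wpartial i u) (wpartial i u).
  by apply: eq_Rintegral => x _; rewrite expr2.
by congr (_ + _ + _); exact: E.
Qed.

Lemma energyE V u : H1 u -> integrable (fun x => V x * u x ^+ 2) ->
  energy c1 c2 V u = (finite_energy V u)%:E.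
Proof.
move=> Hu iV; have [ig eg] := gradsq_integral Hu; have ih := nlin_integrable c1 c2 Hu.
have igh : integrable (fun x => gradsq u x + nlin c1 c2 (u x)) by exact: (integrableD measurableT ig ih).
have igV : integrable (fun x => gradsq u x + nlin c1 c2 (u x) - V x * u x ^+ 2).
  exact: (integrableB measurableT igh iV).
rewrite /energy /finite_energy EFinD (EFinM (1 / 2)) (fineK (coul_sqf_fin Hu Hu)); congr (_ + _)%E.
rewrite -eg -RintegralD// -RintegralB// /Rintegral fineK; last exact: integrable_fin_num.
by apply: eq_integral => x _; rewrite /nlin addrA.
Qed.

Lemma integrable_shift (g : T3 -> R) y : integrable g -> integrable (fun x => g ((x : R3 R) - y)).
Proof.
move=> /integrableP[mg ig]; apply/integrableP; split; first exact: (measurable_comp_shift (- y) mg).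
have ma : measurable_fun setT (fun x : T3 => `|(g x)%:E|)%E by exact: measurableT_comp.
have := ge0_integral_shift (- y) ma (fun x => abse_ge0 _) => /= ->.
exact: ig.
Qed.

Lemma mass_mixture w v y a b : H1 w -> H1 v -> mass w = a%:E -> mass v = b%:E ->
  mass (mixture w v y) = (a + b)%:E.
Proof.
move=> Hw Hv wa vb; rewrite /mass; under eq_integral do rewrite sqr_mixture EFinD.
have mw := measurable_sqf Hw; have mv := measurable_sqf Hv.
rewrite ge0_integralD//; first last.
- by apply/measurable_EFinP; exact: (measurable_comp_shift (- y) mv).
- by move=> x _; rewrite lee_fin sqr_ge0.
- exact/measurable_EFinP.
- by move=> x _; rewrite lee_fin sqr_ge0.
rewrite EFinD; congr (_ + _)%E; first exact: wa.
have mvE : measurable_fun setT (EFin \o sqf v) by exact/measurable_EFinP.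
rewrite -vb; apply: (ge0_integral_shift (- y) mvE) => x.
by rewrite lee_fin sqf_ge0.
Qed.

(** The constant of [nlin_mixture_le]. *)
Definition Crep : R := 8 * c1 ^+ 2 / c2.

Lemma Crep_ge0 : 0 <= Crep.
Proof. by rewrite divr_ge0 ?mulr_ge0 ?sqr_ge0// ltW. Qed.

Lemma overlap_integrable w v y : H1 w -> H1 v ->
  integrable (fun x => w x ^+ 2 * v ((x : R3 R) - y) ^+ 2).
Proof.
move=> Hw Hv.
apply: (le_integrable measurableT _ _ (integrableD measurableT (quartic_integrable Hw)
  (integrable_shift y (quartic_integrable Hv)))).
  apply/measurable_EFinP/measurable_funM; first exact: measurable_sqf.
  exact: (measurable_comp_shift (- y) (measurable_sqf Hv)).
move=> x _ /=; rewrite lee_fin ger0_norm; last by rewrite mulr_ge0 ?sqr_ge0.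
apply: le_trans (ler_norm _); move: (w x) (v _) => s t.
have := sqr_ge0 (s ^+ 2 - t ^+ 2); rewrite sqrrB -!exprM => H.
have s0 : 0 <= s ^+ 2 * t ^+ 2 by apply: mulr_ge0; exact: sqr_ge0.
by move: H; rewrite -mulr_natr; move: s0; move: (s ^+ 2 * t ^+ 2) (s ^+ (2 * 2)) (t ^+ (2 * 2)) => *; lra.
Qed.

Lemma overlapE w v y : H1 w -> H1 v ->
  overlap (sqf w) (sqf v) y = (\int[mu]_x (w x ^+ 2 * v ((x : R3 R) - y) ^+ 2))%:E.
Proof.
move=> Hw Hv; have iv := overlap_integrable y Hw Hv.
rewrite /Rintegral fineK; last exact: integrable_fin_num.
have m : measurable_fun setT (EFin \o (fun x : T3 => w x ^+ 2 * v ((x : R3 R) - y) ^+ 2)).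
  by have /integrableP[] := iv.
rewrite -(ge0_integral_shift y m) => [|x]; last by rewrite lee_fin mulr_ge0 ?sqr_ge0.
by apply: eq_integral => x _; rewrite /= addrK.
Qed.

Lemma cross_coulomb_fin w v y : H1 w -> H1 v -> cross_coulomb (sqf w) (sqf v) y \is a fin_num.
Proof.
move=> Hw Hv; rewrite -coul_cross; [|exact: measurable_sqf|exact: sqf_ge0|exact: sqf_ge0].
rewrite coulC; [|exact: measurable_sqf| |exact: sqf_ge0|move=> x; exact: sqf_ge0]; last first.
  exact: (measurable_comp_shift (- y) (measurable_sqf Hv)).
rewrite ge0_fin_numE; last by apply: coul_ge0 => x; exact: sqf_ge0.
have mv : measurable_fun [set: T3] (fun x : T3 => sqf v ((x : R3 R) - y)).
  exact: (measurable_comp_shift (- y) (measurable_sqf Hv)).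
apply: (coul_lty mv) => //; first by move=> x; exact: sqf_ge0.
have mvE : measurable_fun setT (EFin \o sqf v) by apply/measurable_EFinP; exact: measurable_sqf.
rewrite (ge0_integral_shift (- y) mvE) => [|x]; last by rewrite lee_fin sqf_ge0.
by rewrite integral_sqf// ltry.
Qed.

Lemma repulsion_fin w v y : H1 w -> H1 v -> repulsion (sqf w) (sqf v) Crep y \is a fin_num.
Proof.
by move=> Hw Hv; rewrite /repulsion fin_numD cross_coulomb_fin// andbT overlapE// -EFinM.
Qed.

Lemma nlin_mixture_integral_le w v y : H1 w -> H1 v ->
  \int[mu]_x nlin c1 c2 (mixture w v y x) <= \int[mu]_x nlin c1 c2 (w x) + \int[mu]_x nlin c1 c2 (v x)
    + Crep * \int[mu]_x (w x ^+ 2 * v ((x : R3 R) - y) ^+ 2).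
Proof.
move=> Hw Hv; have [Hz _] := H1_mixture y Hw Hv.
have iw := nlin_integrable c1 c2 Hw; have iv := nlin_integrable c1 c2 Hv.
have ivy := integrable_shift y iv; have io := overlap_integrable y Hw Hv.
have iCo : integrable (fun x => Crep * (w x ^+ 2 * v ((x : R3 R) - y) ^+ 2)).
  exact: (integrableZl measurableT Crep io).
have iwv : integrable (fun x => nlin c1 c2 (w x) + nlin c1 c2 (v ((x : R3 R) - y))).
  exact: (integrableD measurableT iw ivy).
have mv : measurable_fun setT (fun x : T3 => nlin c1 c2 (v x)).
  by have /integrableP[/measurable_EFinP] := iv.
rewrite -[X in _ + X + _](Rintegral_shift (- y) mv) -RintegralD// -RintegralZl// -RintegralD//.
apply: le_Rintegral => //.
- exact: nlin_integrable.
- exact: (integrableD measurableT iwv iCo).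
by move=> x _; exact: nlin_mixture_le.
Qed.

(** Bilinear expansion. The mutual term occurs twice, which the factor 1/2 of the energy turns into
    a single [cross_coulomb]. *)
Lemma coul_mixture w v y : H1 w -> H1 v ->
  coul (sqf (mixture w v y)) (sqf (mixture w v y)) =
  (coul (sqf w) (sqf w) + coul (sqf v) (sqf v) +
   (cross_coulomb (sqf w) (sqf v) y + cross_coulomb (sqf w) (sqf v) y))%E.
Proof.
move=> Hw Hv; have mw := measurable_sqf Hw; have mv := measurable_sqf Hv.
pose vy (x : T3) := sqf v ((x : R3 R) - y).
have mvy : measurable_fun setT vy by exact: (measurable_comp_shift (- y) mv).
have vy0 x : 0 <= vy x by exact: sqf_ge0.
have w0 := sqf_ge0 w; have v0 := sqf_ge0 v.
pose s (x : T3) := sqf w x + vy x.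
have ms : measurable_fun setT s by exact: measurable_funD.
have s0 x : 0 <= s x by rewrite addr_ge0.
have -> : sqf (mixture w v y) = s by apply/funext => x; exact: sqr_mixture.
rewrite (coulDl mw mvy ms w0 vy0 s0) (coulC mw ms w0 s0) (coulC mvy ms vy0 s0).
rewrite (coulDl mw mvy mw w0 vy0 w0) (coulDl mw mvy mvy w0 vy0 vy0).
rewrite (coulC mvy mw vy0 w0) (coul_cross y mv w0 v0) (coul_shift y mv mv v0 v0).
have := coul_sqf_fin Hw Hw; have := coul_sqf_fin Hv Hv; have := cross_coulomb_fin y Hw Hv.
move: (coul _ _) (coul _ _) (cross_coulomb _ _ _) => [p| |] [q| |] [t| |]// _ _ _.
by rewrite -!EFinD; congr EFin; ring.
Qed.

(** The potential and Coulomb terms of the glued function are computed exactly; only the kinetic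
    energy and the powers contribute inequalities. *)
Lemma mixture_energy_le V w v y : H1 w -> H1 v ->
    integrable (fun x => V x * w x ^+ 2) -> integrable (fun x => V x * v ((x : R3 R) - y) ^+ 2) ->
  finite_energy V (mixture w v y) <= finite_energy V w + finite_energy (cst 0) v
    + fine (repulsion (sqf w) (sqf v) Crep y) - \int[mu]_x (V x * v ((x : R3 R) - y) ^+ 2).
Proof.
move=> Hw Hv iw iv; have [_ kin] := H1_mixture y Hw Hv.
have nl := nlin_mixture_integral_le y Hw Hv.
have pot : \int[mu]_x (V x * mixture w v y x ^+ 2) =
    \int[mu]_x (V x * w x ^+ 2) + \int[mu]_x (V x * v ((x : R3 R) - y) ^+ 2).
  by rewrite -RintegralD//; apply: eq_Rintegral => x _; rewrite sqr_mixture mulrDr.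
have pot0 : \int[mu]_x ((cst 0 : R3 R -> R) x * v x ^+ 2) = 0.
  by rewrite /Rintegral integral0_eq// => x _; rewrite mul0r.
set t := fine (cross_coulomb (sqf w) (sqf v) y).
have cE : fine (coul (sqf (mixture w v y)) (sqf (mixture w v y))) =
    fine (coul (sqf w) (sqf w)) + fine (coul (sqf v) (sqf v)) + (t + t).
  rewrite (coul_mixture y Hw Hv) /t.
  have := coul_sqf_fin Hw Hw; have := coul_sqf_fin Hv Hv; have := cross_coulomb_fin y Hw Hv.
  by move: (coul (sqf w) _) (coul (sqf v) _) (cross_coulomb _ _ _) => [p| |] [q| |] [s| |].
have rE : fine (repulsion (sqf w) (sqf v) Crep y) =
    Crep * \int[mu]_x (w x ^+ 2 * v ((x : R3 R) - y) ^+ 2) + t.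
  rewrite /repulsion (overlapE y Hw Hv) /t; have := cross_coulomb_fin y Hw Hv.
  by move: (cross_coulomb _ _ _) => [s| |].
have comb (k1 k2 k3 n1 n2 n3 o p q c d e : R) : k3 <= k1 + k2 -> n3 <= n1 + n2 + o ->
    k3 + n3 - (p + q) + 1 / 2 * (c + d + (e + e)) <=
    k1 + n1 - p + 1 / 2 * c + (k2 + n2 - 0 + 1 / 2 * d) + (o + e) - q.
  by clear; lra.
have E1 : finite_energy V (mixture w v y) = kinetic (mixture w v y) +
    \int[mu]_x nlin c1 c2 (mixture w v y x) -
    (\int[mu]_x (V x * w x ^+ 2) + \int[mu]_x (V x * v ((x : R3 R) - y) ^+ 2)) +
    1 / 2 * (fine (coul (sqf w) (sqf w)) + fine (coul (sqf v) (sqf v)) + (t + t)).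
  by congr (_ + _ - _ + _ * _).
have E2 : finite_energy (cst 0) v = kinetic v + \int[mu]_x nlin c1 c2 (v x) - 0 +
    1 / 2 * fine (coul (sqf v) (sqf v)).
  by congr (_ + _ - _ + _ * _).
by rewrite E1 E2 rE; exact: comb.
Qed.

End EnergyOfMixture.

(** * Binding *)

Lemma add_half_step (F : realFieldType) (p q t k e : F) :
  p <= q + t + e / 2 -> p + k + e / 2 <= q + (k + t) + e.
Proof. lra. Qed.

Lemma add_half_gap (F : realFieldType) (p q k t : F) :
  p < q + k -> p + t + (q + k - p) / 2 < q + (k + t).
Proof. lra. Qed.

Section Binding.
Variables (R : realType) (c1 c2 : R).
Hypotheses (c1_gt0 : 0 < c1) (c2_gt0 : 0 < c2).
Local Notation T1 := (measurableTypeR R).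
Local Notation T3 := (T1 * T1 * T1)%type.
Local Notation mu := (leb3 R).
Local Notation integrable f := (mu.-integrable setT (EFin \o (f : T3 -> R))).
Implicit Types (u v w : R3 R -> R) (y : R3 R).
Variables (V : R3 R -> R) (K : nat) (alpha : 'I_K -> R) (r : 'I_K -> R3 R).
Hypotheses (mV : measurable_fun setT (V : T3 -> R)) (alpha_gt0 : forall k, 0 < alpha k).
Hypothesis V_ge_TF : forall x, V_TF alpha r x <= V x.

Lemma V_TF_ge0 x : 0 <= V_TF alpha r x.
Proof. by apply: sumr_ge0 => k _; rewrite mulr_ge0 ?ker_ge0// ltW. Qed.

Lemma V_ge0 x : 0 <= V x. Proof. exact: le_trans (V_TF_ge0 x) (V_ge_TF x). Qed.

Lemma attraction_sum_le v y : H1 v -> integrable (fun x => V x * v ((x : R3 R) - y) ^+ 2) ->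
  (\sum_k (alpha k)%:E * attraction (sqf v) (r k) y <=
   (\int[mu]_x (V x * v ((x : R3 R) - y) ^+ 2))%:E)%E.
Proof.
move=> Hv iV; rewrite /Rintegral fineK; last exact: integrable_fin_num.
have mv := measurable_sqf Hv; have mvy := measurable_comp_shift (- y) mv.
have mk k : measurable_fun [set: T3] (fun x : T3 => (enorm ((x : R3 R) - r k))^-1).
  by have := measurable_comp_shift (- (r k)) (@measurable_ker R).
have mg k : measurable_fun [set: T3] (fun x : T3 => alpha k * (sqf v ((x : R3 R) - y) / enorm ((x : R3 R) - r k))).
  by apply: measurable_funM => //; exact: measurable_funM.
have g0 k (x : T3) : 0 <= alpha k * (sqf v ((x : R3 R) - y) / enorm ((x : R3 R) - r k)).
  by apply: mulr_ge0; [exact: ltW|apply: mulr_ge0; [exact: sqf_ge0|exact: ker_ge0]].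
have E k : ((alpha k)%:E * attraction (sqf v) (r k) y =
    \int[mu]_x (alpha k * (sqf v ((x : R3 R) - y)%R / enorm ((x : R3 R) - r k)%R))%:E)%E.
  have mgk : measurable_fun [set: T3] (fun x : T3 => sqf v ((x : R3 R) - y) / enorm ((x : R3 R) - r k)).
    exact: measurable_funM.
  have gk0 (x : T3) : 0 <= sqf v ((x : R3 R) - y) / enorm ((x : R3 R) - r k).
    by apply: mulr_ge0; [exact: sqf_ge0|exact: ker_ge0].
  rewrite (ge0_integralZ_real (ltW (alpha_gt0 k)) mgk gk0); congr (_ * _)%E.
  have mgkE : measurable_fun [set: T3] (fun x : T3 => (sqf v ((x : R3 R) - y) / enorm ((x : R3 R) - r k))%:E).
    exact/measurable_EFinP.
  rewrite -(ge0_integral_shift y mgkE) => [|x]; last by rewrite lee_fin.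
  by apply: eq_integral => x _; rewrite addrK.
rewrite (eq_bigr _ (fun k _ => E k)) -ge0_integral_sum//; last 2 first.
- by move=> k; apply/measurable_EFinP.
- by move=> k x _; rewrite lee_fin.
have /integrableP[mVv _] := iV.
apply: ge0_le_integralT => //.
- by apply: emeasurable_sum => k; apply/measurable_EFinP.
- by move=> x; apply: sume_ge0 => k _; rewrite lee_fin.
move=> x; rewrite sumEFin lee_fin /=.
apply: le_trans (ler_wpM2r (sqr_ge0 _) (V_ge_TF x)).
rewrite /V_TF mulr_suml; apply: ler_sum => k _.
by rewrite /sqf mulrA mulrAC.
Qed.

Hypothesis V_form : forall u, H1 u -> integrable (fun x => V x * u x ^+ 2).

(** The translate of [v] is dominated by [mixture v v y], already known to lie in H^1, so [V_form]
    applies to the latter. *)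
Lemma V_form_shift v y : H1 v -> integrable (fun x => V x * v ((x : R3 R) - y) ^+ 2).
Proof.
move=> Hv; have [Hz _] := H1_mixture y Hv Hv.
apply: (le_integrable measurableT _ _ (V_form Hz)).
  apply/measurable_EFinP/measurable_funM => //.
  exact: (measurable_comp_shift (- y) (measurable_sqf Hv)).
move=> x _ /=; rewrite lee_fin sqr_mixture (normrM (V x) (v _ ^+ 2)) (normrM (V x) (_ + _)).
by apply: ler_wpM2l => //; rewrite !ger0_norm ?addr_ge0 ?sqr_ge0// lerDr sqr_ge0.
Qed.

Local Notation EV := (finite_energy c1 c2 V).
Local Notation E0 := (finite_energy c1 c2 (cst 0)).

Lemma strict_binding w v a b : H1 w -> H1 v -> mass w = a%:E -> mass v = b%:E ->
    0 < b -> a < \sum_k alpha k ->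
  exists z, [/\ H1 z, mass z = (a + b)%:E & EV z < EV w + E0 v].
Proof.
move=> Hw Hv wa vb b0 aZ.
have C0 : 0 <= Crep c1 c2 by exact: Crep_ge0.
have [y yP] := exists_attraction_gt_repulsion (measurable_sqf Hw) (measurable_sqf Hv)
  (sqf_ge0 w) (sqf_ge0 v) wa vb C0 r alpha_gt0 aZ b0.
have iv := V_form_shift y Hv.
have [Hz _] := H1_mixture y Hw Hv.
exists (mixture w v y); split => //; first exact: mass_mixture.
have := lt_le_trans yP (attraction_sum_le Hv iv).
rewrite -(fineK (@repulsion_fin R c1 c2 w v y Hw Hv)) lte_fin => lt.
apply: le_lt_trans (mixture_energy_le c1_gt0 c2_gt0 Hw Hv (V_form Hw) iv) _.
by rewrite -addrA gtrDl subr_lt0.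
Qed.

Lemma weak_binding w v a b eps : H1 w -> H1 v -> mass w = a%:E -> mass v = b%:E -> 0 < eps ->
  exists z, [/\ H1 z, mass z = (a + b)%:E & EV z <= EV w + E0 v + eps].
Proof.
move=> Hw Hv wa vb e0.
have C0 : 0 <= Crep c1 c2 by exact: Crep_ge0.
have [y yP] := exists_small_repulsion (measurable_sqf Hw) (measurable_sqf Hv)
  (sqf_ge0 w) (sqf_ge0 v) wa vb C0 e0.
have iv := V_form_shift y Hv.
have [Hz _] := H1_mixture y Hw Hv.
exists (mixture w v y); split => //; first exact: mass_mixture.
move: yP; rewrite -(fineK (@repulsion_fin R c1 c2 w v y Hw Hv)) lte_fin => lt.
apply: le_trans (mixture_energy_le c1_gt0 c2_gt0 Hw Hv (V_form Hw) iv) _.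
have I0 : 0 <= \int[mu]_x (V x * v ((x : R3 R) - y) ^+ 2).
  by apply: Rintegral_ge0 => x _; apply: mulr_ge0; [exact: V_ge0|exact: sqr_ge0].
apply: (le_trans (y := EV w + E0 v + fine (repulsion (sqf w) (sqf v) (Crep c1 c2) y))).
  by rewrite gerBl.
by rewrite lerD2l ltW.
Qed.

Lemma weak_binding_seq (I : eqType) (s : seq I) (w : I -> R3 R -> R) (m : I -> R) z a eps :
    H1 z -> mass z = a%:E -> (forall i, H1 (w i)) -> (forall i, mass (w i) = (m i)%:E) -> 0 < eps ->
  exists z', [/\ H1 z', mass z' = (a + \sum_(i <- s) m i)%:E
    & EV z' <= EV z + \sum_(i <- s) E0 (w i) + eps].
Proof.
move=> Hz za Hw wm; elim: s eps => [|i s IH] eps e0.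
  by exists z; rewrite !big_nil !addr0; split => //; rewrite lerDl ltW.
have e2 : 0 < eps / 2 by rewrite divr_gt0.
have [z1 [Hz1 m1 E1]] := IH _ e2.
have [z2 [Hz2 m2 E2]] := weak_binding Hz1 (Hw i) m1 (wm i) e2.
exists z2; split => //; rewrite !big_cons; first by rewrite m2; congr EFin; rewrite -addrA [m i + _]addrC.
apply: le_trans E2 _; exact: add_half_step.
Qed.

Lemma no_splitting_below (N : nat) (m : 'I_N.+1 -> R) (w : 'I_N.+1 -> R3 R -> R) (M : R) :
    (0 < N)%N -> (forall i, 0 < m i) -> (forall i, H1 (w i)) ->
    (forall i, mass (w i) = (m i)%:E) ->
    energy c1 c2 V (w ord0) = inf_energy c1 c2 V (m ord0) ->
    (forall i, i != ord0 -> energy c1 c2 (cst 0) (w i) = inf_energy c1 c2 (cst 0) (m i)) ->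
    \sum_(i < N.+1) m i = M ->
    (inf_energy c1 c2 V (m ord0)
      + \sum_(i < N.+1 | i != ord0) inf_energy c1 c2 (cst 0%R) (m i) = inf_energy c1 c2 V M)%E ->
  \sum_k alpha k <= m ord0.
Proof.
move=> N0 m0 Hw wm e0 ei sm se; rewrite leNgt; apply/negP => mZ.
have i0 u : H1 u -> integrable (fun x => (cst 0 : R3 R -> R) x * u x ^+ 2).
  move=> _; have -> : (fun x : T3 => (cst 0 : R3 R -> R) x * u x ^+ 2) = cst 0.
    by apply/funext => x; rewrite mul0r.
  exact: integrable0.
have {}e0 : inf_energy c1 c2 V (m ord0) = (EV (w ord0))%:E.
  by rewrite -e0; apply: energyE => //; exact: V_form.
have {}ei i : i != ord0 -> inf_energy c1 c2 (cst 0) (m i) = (E0 (w i))%:E.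
  by move=> /ei <-; apply: energyE => //; exact: i0.
have infM : inf_energy c1 c2 V M = (EV (w ord0) + \sum_(i < N.+1 | i != ord0) E0 (w i))%:E.
  by rewrite -se e0 (eq_bigr _ ei) sumEFin.
(* Since [N > 0], the index 1 is available; this profile provides the strict gain. *)
pose j : 'I_N.+1 := Ordinal (N0 : (1 < N.+1)%N).
have j0 : j != ord0 by [].
have [z [Hz zm zE]] := strict_binding (Hw ord0) (Hw j) (wm ord0) (wm j) (m0 j) mZ.
pose s := [seq i <- index_enum 'I_N.+1 | (i != ord0) && (i != j)].
(* The strict gain; half of it pays for attaching the remaining profiles. *)
pose d := EV (w ord0) + E0 (w j) - EV z; have d0 : 0 < d / 2 by rewrite divr_gt0// subr_gt0.
have [z' [Hz' zm' zE']] := @weak_binding_seq _ s w m z _ (d / 2) Hz zm Hw wm d0.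
have sM : m ord0 + m j + \sum_(i <- s) m i = M.
  by rewrite -sm (bigD1 ord0)//= (bigD1 j)//= big_filter addrA.
have sE : \sum_(i < N.+1 | i != ord0) E0 (w i) = E0 (w j) + \sum_(i <- s) E0 (w i).
  by rewrite (bigD1 j)//= big_filter.
have : (inf_energy c1 c2 V M <= (EV z')%:E)%E.
  have <- : energy c1 c2 V z' = (EV z')%:E by apply: energyE => //; exact: V_form.
  apply: ereal_inf_lbound; exists z' => //=.
  by split => //; rewrite zm' sM.
rewrite infM lee_fin sE; apply/negP; rewrite -ltNge.
by apply: le_lt_trans zE' _; exact: add_half_gap.
Qed.

End Binding.

(** * Energies equal to minus infinity *)

Section UnboundedBelow.
Variables (R : realType) (c1 c2 : R) (V : R3 R -> R).
Local Notation T1 := (measurableTypeR R).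
Local Notation T3 := (T1 * T1 * T1)%type.
Local Notation mu := (leb3 R).
Local Notation integrable f := (mu.-integrable setT (EFin \o (f : T3 -> R))).
Implicit Types (u v w : R3 R -> R).
Hypotheses (mV : measurable_fun setT (V : T3 -> R)) (V0 : forall x, 0 <= V x).

(** The integrand is [f - g] with [f] integrable and [g = V u^2 >= 0]. Its positive part is at most
    [|f|], while an integrable negative part would make [g] integrable. The finite Coulomb term
    cannot compensate. *)
Lemma energy_Ny u : H1 u -> ~ integrable (fun x => V x * u x ^+ 2) -> energy c1 c2 V u = -oo%E.
Proof.
move=> Hu nV; have [ig _] := gradsq_integral Hu; have ih := nlin_integrable c1 c2 Hu.
pose f (x : T3) := gradsq u x + nlin c1 c2 (u x); pose g (x : T3) := V x * u x ^+ 2.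
have if_ : integrable f by exact: (integrableD measurableT ig ih).
have /integrableP[/measurable_EFinP mf foo] := if_.
have mg : measurable_fun setT g by apply: measurable_funM => //; exact: measurable_sqf.
have g0 x : 0 <= g x by rewrite mulr_ge0 ?sqr_ge0.
pose F (x : T3) : \bar R := (f x - g x)%:E.
have mF : measurable_fun setT F by apply/measurable_EFinP; exact: measurable_funB.
have mfa : measurable_fun setT (fun x => `|(f x)%:E|%E) by apply: measurableT_comp => //; exact/measurable_EFinP.
have posoo : (\int[mu]_x F^\+ x < +oo)%E.
  apply: le_lt_trans foo; apply: ge0_le_integralT => //; first exact: measurable_funepos.
  move=> x; rewrite funeposE -EFin_max lee_fin ge_max normr_ge0 andbT.
  by apply: le_trans (ler_norm _); rewrite gerBl.
have negoo : (\int[mu]_x F^\- x = +oo)%E.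
  apply/eqP; rewrite eq_le leey /= leNgt; apply/negP => noo; apply: nV.
  apply/integrableP; split; first exact/measurable_EFinP.
  apply: (@le_lt_trans _ _ (\int[mu]_x (`|(f x)%:E| + F^\- x))%E).
    apply: ge0_le_integralT => //.
    - by apply: measurableT_comp => //; exact/measurable_EFinP.
    - by apply: emeasurable_funD => //; exact: measurable_funeneg.
    move=> x; rewrite funenegE -EFinN -EFin_max -EFinD lee_fin -/(g x) (ger0_norm (g0 x)).
    rewrite -lerBlDl; apply: (@le_trans _ _ (- (f x - g x))); last by rewrite le_max lexx.
    by rewrite opprB lerD2l lerN2 ler_norm.
  rewrite ge0_integralD//; last exact: measurable_funeneg.
  exact: lte_add_pinfty.
rewrite /energy -/(coul (sqf u) (sqf u)).
have -> : (\int[mu]_x (gradsq u x + c1 * `|u x| `^ (10 / 3) - c2 * `|u x| `^ (8 / 3) -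
    V x * u x ^+ 2)%R%:E = \int[mu]_x F x)%E.
  by apply: eq_integral => x _; rewrite /F /f /g /nlin addrA.
rewrite integralE negoo.
have := coul_sqf_fin Hu Hu; move: posoo; have : (0 <= \int[mu]_x F^\+ x)%E by exact: integral_ge0.
by move: (integral _ _ _) (coul _ _) => [p| |] [q| |].
Qed.

(** The multiple of [u] with mass [M] still has a nonintegrable potential term, so its energy is the
    least extended real. Such a multiple exists because a function of mass 0 vanishes almost
    everywhere, which would make [V u^2] integrable. *)
Lemma attained_of_nonintegrable u M : H1 u -> ~ integrable (fun x => V x * u x ^+ 2) -> 0 < M ->
  attained_masses c1 c2 V M.
Proof.
move=> Hu nV M0; split => //.
have u2 := Hu.1; have /Lfun2P[mu_ _] := u2.
pose a := ip mu u u; have a0 : 0 <= a := ip_ge0 _ _.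
have mg : measurable_fun setT (fun x : T3 => V x * u x ^+ 2).
  by apply: measurable_funM => //; exact: measurable_sqf.
have ap : 0 < a.
  rewrite lt_neqAle a0 andbT eq_sym; apply/eqP => az; apply: nV.
  have m2 : measurable_fun setT (EFin \o sqf u) by apply/measurable_EFinP; exact: measurable_sqf.
  have : (\int[mu]_x `|(EFin \o sqf u) x| = 0)%E.
    have <- : (\int[mu]_x (u x ^+ 2)%:E = 0)%E by rewrite (ip_sqrE u2) -/a az.
    apply: eq_integral => x _.
    by rewrite /= ger0_norm ?sqr_ge0.
  move=> /(ae_eq_integral_abs mu measurableT m2) u0.
  apply/integrableP; split; first exact/measurable_EFinP.
  have -> : (\int[mu]_x `|(EFin \o (fun x : T3 => (V x * u x ^+ 2)%R)) x| = 0)%E; last exact: ltry.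
  apply/(ae_eq_integral_abs mu measurableT); first exact/measurable_EFinP.
  apply: filterS u0 => x /(_ I) /= [ux] _; rewrite /sqf in ux; by rewrite ux mulr0.
pose t := Num.sqrt (M / a).
have t2 : t ^+ 2 = M / a by rewrite sqr_sqrtr// divr_ge0// ltW.
have Htu := H1_scale t Hu.
have tM : mass (fun x => t * u x) = M%:E.
  rewrite /mass (ip_sqrE Htu.1) (ipZl _ u2 (Lfun2Z t u2)) (ipZr _ u2 u2) mulrA -expr2 t2 -/a.
  by congr EFin; rewrite divfK// gt_eqF.
have tNy : energy c1 c2 V (fun x => t * u x) = -oo%E.
  apply: energy_Ny => // tV; apply: nV.
  have := integrableZl measurableT (t ^- 2) tV; apply: eq_integrable => // x _.
  rewrite /= -EFinM exprMn; congr EFin; rewrite mulrCA [V x * _]mulrC mulrA -mulrA mulKf//.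
    by rewrite mulrC.
  by rewrite t2 gt_eqF// divr_gt0.
exists (fun x => t * u x); split => //; rewrite tNy; apply/esym/eqP; rewrite -leeNy_eq -tNy.
by apply: ereal_inf_lbound; exists (fun x => t * u x).
Qed.

End UnboundedBelow.

(** * Invariance under a change of the potential on a null set *)

Section ModifiedPotential.
Variables (R : realType) (c1 c2 : R).
Local Notation T1 := (measurableTypeR R).
Local Notation T3 := (T1 * T1 * T1)%type.
Local Notation mu := (leb3 R).
Variables V W : R3 R -> R.
Hypotheses (mV : measurable_fun setT (V : T3 -> R)) (mW : measurable_fun setT (W : T3 -> R)).
Hypothesis VW : {ae mu, forall x : T3, V x = W x}.

Lemma energy_ae_eq u : H1 u -> energy c1 c2 V u = energy c1 c2 W u.
Proof.
move=> Hu; rewrite /energy; congr (_ + _)%E.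
have [ig _] := gradsq_integral Hu; have ih := nlin_integrable c1 c2 Hu.
have /integrableP[/measurable_EFinP mf _] := integrableD measurableT ig ih.
have mE (U : R3 R -> R) : measurable_fun setT (U : T3 -> R) -> measurable_fun setT (fun x : T3 =>
    (gradsq u x + c1 * `|u x| `^ (10 / 3) - c2 * `|u x| `^ (8 / 3) - U x * u x ^+ 2)%:E).
  move=> mU; under eq_fun do rewrite -(addrA (gradsq u _)).
  apply/measurable_EFinP; apply: (measurable_funB mf).
  by apply: measurable_funM => //; exact: measurable_sqf.
apply: ae_eq_integral => //; [exact: mE|exact: mE|].
by apply: filterS VW => x -> _.
Qed.

Lemma inf_energy_ae_eq M : inf_energy c1 c2 V M = inf_energy c1 c2 W M.
Proof.
congr ereal_inf; apply/seteqP; split => _ [u [Hu um] <-]; exists u => //;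
  by rewrite energy_ae_eq.
Qed.

Lemma attained_ae_eq M : attained_masses c1 c2 W M -> attained_masses c1 c2 V M.
Proof.
move=> [M0 [u [Hu um uE]]]; split => //; exists u; split => //.
by rewrite energy_ae_eq// uE inf_energy_ae_eq.
Qed.

End ModifiedPotential.

Section Measurability.
Variable R : realType.
Local Notation T3 := (measurableTypeR R * measurableTypeR R * measurableTypeR R)%type.

Lemma measurable_V_TF (K : nat) (alpha : 'I_K -> R) (r : 'I_K -> R3 R) :
  measurable_fun [set: T3] (V_TF alpha r).
Proof.
apply: measurable_sum => k; apply: measurable_funM => //.
by have := measurable_comp_shift (- (r k)) (@measurable_ker R).
Qed.

Lemma measurable_L32_plus_Loo (V : R3 R -> R) : L32_plus_Loo V ->
  measurable_fun [set: T3] V.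
Proof.
move=> [V1 [V2 [L1 L2 VE]]].
have m1 : measurable_fun [set: T3] V1.
  by move: L1; rewrite inE => /andP[]; rewrite inE.
have m2 : measurable_fun [set: T3] V2.
  by move: L2; rewrite inE => /andP[]; rewrite inE.
have -> : V = (fun x => V1 x + V2 x) by apply/funext.
exact: measurable_funD.
Qed.

End Measurability.

Theorem theoremI2 (R : realType) (c1 c2 : R) (c1_gt0 : 0 < c1) (c2_gt0 : 0 < c2)
    (V : R3 R -> R)
    (V_ge0 : {ae @leb3 R, forall x : R3 R, 0 <= V x})
    (V_sum : L32_plus_Loo V)
    (V_lim : vanishes_at_infinity V)
    (K : nat) (K_gt0 : (0 < K)%N) (alpha : 'I_K -> R) (r : 'I_K -> R3 R)
    (alpha_gt0 : forall k, 0 < alpha k)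
    (V_ge_TF : {ae @leb3 R, forall x : R3 R, V_TF alpha r x <= V x})
    (M : R) (M_gt0 : 0 < M)
    (u : nat -> R3 R -> R) (u_min : minimizing_sequence c1 c2 V M u)
    (N : nat) (m : 'I_N.+1 -> R) (x : nat -> 'I_N.+1 -> R3 R)
    (w : 'I_N.+1 -> R3 R -> R)
    (data : concentration_data c1 c2 V M u m x w) :
  attained_masses c1 c2 V M \/
  ((1 <= N)%N /\ \sum_(k < K) alpha k <= m ord0).
Proof.
have [m0 [_ [Hw [_ [wm [e0 [ei [sm [se _]]]]]]]]] := data.
have [N0|N0] := posnP N.
  (* With [N = 0] the whole mass is carried by [w ord0], which then attains the infimum at
     [m ord0 = M]. *)
  left; split => //; exists (w ord0).
  have mM : m ord0 = M by subst N; rewrite -sm big_ord_recl big_ord0 addr0.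
  by split; [exact: Hw|rewrite wm mM|rewrite e0 mM].
pose T3 := (measurableTypeR R * measurableTypeR R * measurableTypeR R)%type.
have mV := measurable_L32_plus_Loo V_sum.
(* [W] has the same energies as [V], but dominates [V_TF] everywhere. *)
pose W (y : R3 R) := Num.max (V y) (V_TF alpha r y).
have mW : measurable_fun [set: T3] W.
  by apply: measurable_maxr => //; exact: measurable_V_TF.
have W_ge y : V_TF alpha r y <= W y by rewrite le_max lexx orbT.
have W0 y : 0 <= W y by exact: le_trans (V_TF_ge0 r alpha_gt0 y) (W_ge y).
have VW : {ae leb3 R, forall y : T3, V y = W y}.
  have VT : {ae leb3 R, forall y : T3,
    V_TF alpha r y <= V y} := V_ge_TF.
  by apply: filterS VT => y Vy; rewrite /W; apply/esym/max_idPl.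
have infE := inf_energy_ae_eq c1 c2 mV mW VW.
have [form|] := pselect (forall v : R3 R -> R, H1 v ->
    (leb3 R).-integrable setT (fun y => (W y * v y ^+ 2)%:E)).
  right; split => //.
  apply: (no_splitting_below c1_gt0 c2_gt0 mW alpha_gt0 W_ge form N0 m0 Hw wm _ ei sm).
    by rewrite -(energy_ae_eq c1 c2 mV mW VW (Hw ord0)) -infE.
  by rewrite -!infE.
move=> /existsNP[v] /not_implyP[Hv nV]; left.
apply: (attained_ae_eq mV mW VW).
exact: (attained_of_nonintegrable c1 c2 mW W0 Hv nV M_gt0).
Qed.
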